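(* For every $n\in\mathbb N$, let $P_n\in\mathcal P_n(\mathcal L_l,\mathcal L_w,C_0)$ (class defined in the context) and suppose that under $P_n$ the error term $v_{P_n}$ has a Lebesgue density. Define $\beta_n=\beta_{P_n}$ to be the minimizer of $\beta\mapsto\mathbb E_{(x_0,y_0)}[(y_0-\beta'x_0)^2]$ over $\mathbb R^{p_n}$ (expectation under $P_n$). If $p_n/n\to\kappa\in[0,1)$, $c_n\in[0,1]$ for all $n\in\mathbb N$, and $$\limsup_{n\to\infty}\mathbb E_{x_{0,n}}\left[\left(\frac{\mu_{P_n}(x_{0,n})-x_{0,n}'\beta_n}{\sigma_{P_n}}\right)^2\right]<\infty,$$ then the positive part James-Stein estimator $\hat\beta_n(c_n)$ satisfies $$\limsup_{n\to\infty}\mathbb P_n\left(\left\|\Sigma_{P_n}^{1/2}(\hat\beta_n(c_n)-\beta_n)/\sigma_{P_n}\right\|_2>M\right)\xrightarrow[M\to\infty]{}0.$$ If, in addition, $\kappa>0$, then for every $\varepsilon>0$, $$\mathbb P_n\left(\left\|\Sigma_{P_n}^{1/2}(\hat\beta_n(c_n)-\hat\beta_n^{[1]}(c_n))/\sigma_{P_n}\right\|_2>\varepsilon\right)\xrightarrow[n\to\infty]{}0.$$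
   Context: Throughout, $(p_n)$ is a sequence of positive integers with $n>p_n+1$ for all $n$ under consideration. Model class. Fix finite constants $C_0>0$, $c_0>0$ and probability measures $\mathcal L_l,\mathcal L_w$ on $\mathbb R$ such that $\mathcal L_w$ has mean zero, unit variance and finite fourth moment, $\int s^2\,\mathcal L_l(ds)=1$ and $\mathcal L_l((-c_0,c_0))=0$. $\mathcal P_n(\mathcal L_l,\mathcal L_w,C_0)$ consists of all probability measures $P$ on (Borel subsets $\mathcal Z$ of) $\mathbb R^{p_n+1}$, the law of $(x_0,y_0)$, such that: (a) $x_0$ is distributed as $l_0\Sigma_P^{1/2}(w_1,\dots,w_{p_n})'$, where $w_1,\dots,w_{p_n}$ are i.i.d. with law $\mathcal L_w$, $l_0\sim\mathcal L_l$ is independent of the $w_j$, and $\Sigma_P^{1/2}$ is the unique symmetric positive definite square root of a positive definite $p_n\times p_n$ covariance matrix $\Sigma_P$; (b) the conditional distribution of $y_0$ given $x_0$ is that of $\mu_P(x_0)+\sigma_Pv_P$, where $v_P$ is independent of $x_0$ with mean zero, unit variance and fourth moment bounded by $C_0$, $\mu_P:\mathbb R^{p_n}\to\mathbb R$ is measurable with $\mathbb E_{x_0}[\mu_P(x_0)]=0$, and $\sigma_P\in(0,\infty)$. Data. Under $\mathbb P_n$, $(x_0,y_0)=(x_{0,n},y_{0,n})$ and $(x_i,y_i)$, $i=1,\dots,n$, are i.i.d. from $P_n$. $X=[x_1,\dots,x_n]'\in\mathbb R^{n\times p_n}$, $Y=(y_1,\dots,y_n)'$; $X_{[1]},Y_{[1]}$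 are obtained by deleting the first observation. $A^\dagger$ is the Moore-Penrose inverse, $a_+=\max(a,0)$. Estimators. $\hat\beta_n=(X'X)^\dagger X'Y$, $\hat\sigma_n^2=\|Y-X\hat\beta_n\|_2^2/(n-p_n)$ and, for $c\in[0,1]$, $$\hat\beta_n(c)=\left(1-\frac{cp_n\hat\sigma_n^2}{\hat\beta_n'X'X\hat\beta_n}\right)_+\hat\beta_n\ \text{ if }\hat\beta_n'X'X\hat\beta_n>0,\qquad\hat\beta_n(c)=0\ \text{ if }\hat\beta_n'X'X\hat\beta_n=0.$$ The leave-one-out version $\hat\beta_n^{[1]}(c)$ is defined in the same way with $X,Y$ replaced by $X_{[1]},Y_{[1]}$, i.e. with $\hat\beta_n^{[1]}=(X_{[1]}'X_{[1]})^\dagger X_{[1]}'Y_{[1]}$ in place of $\hat\beta_n$ and $\hat\sigma_{n,[1]}^2=\|Y_{[1]}-X_{[1]}\hat\beta_n^{[1]}\|_2^2/(n-1-p_n)$ in place of $\hat\sigma_n^2$. *)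

(* Defs.v *)
From HB Require Import structures.
From mathcomp Require Import all_boot all_order all_algebra.
From mathcomp Require Import all_classical all_reals all_analysis.
Import Order.TTheory GRing.Theory Num.Theory.
Import numFieldNormedType.Exports.

Set Implicit Arguments.
Unset Strict Implicit.
Unset Printing Implicit Defensive.

Local Open Scope classical_set_scope.
Local Open Scope ring_scope.

Section linear_algebra.
Context {R : realType}.

(* The library's norm on matrices is the sup norm. *)
Definition norm2 {p} (v : 'cV[R]_p) : R := Num.sqrt (\sum_i v i 0 ^+ 2).

Definition dotv {p} (u v : 'cV[R]_p) : R := (u^T *m v) 0 0.

Definition symmetric_posdef {p} (A : 'M[R]_p) :=
  A^T = A /\ forall v : 'cV[R]_p, v != 0 -> 0 < dotv v (A *m v).

Definition is_posdef_sqrt {p} (A S : 'M[R]_p) :=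
  symmetric_posdef S /\ S *m S = A.

Definition penrose {m n} (A : 'M[R]_(m, n)) : set 'M[R]_(n, m) :=
  [set B | [/\ A *m B *m A = A, B *m A *m B = B,
               (A *m B)^T = A *m B & (B *m A)^T = B *m A]].

Definition moore_penrose {m n} (A : 'M[R]_(m, n)) : 'M[R]_(n, m) :=
  xget 0 (penrose A).

Lemma trmx_mul_self_eq0 m n (A : 'M[R]_(m, n)) : A *m A^T = 0 -> A = 0.
Proof.
move=> AA0; apply/matrixP => i j; rewrite mxE; apply/eqP.
have /eqP := congr1 (fun M : 'M[R]_m => M i i) AA0.
rewrite !mxE psumr_eq0; last by move=> k _; rewrite mxE -expr2 sqr_ge0.
by move=> /allP /(_ j (mem_index_enum _)); rewrite mxE -expr2 sqrf_eq0.
Qed.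

Lemma row_free_gram_unit r n (B : 'M[R]_(r, n)) :
  row_free B -> B *m B^T \in unitmx.
Proof.
move=> Bfree; rewrite -row_free_unit -kermx_eq0; apply/eqP.
set K := kermx _; have KB : K *m (B *m B^T) = 0 by exact: mulmx_ker.
have /trmx_mul_self_eq0 KB0 : (K *m B) *m (K *m B)^T = 0.
  by rewrite trmx_mul !mulmxA -(mulmxA K) KB mul0mx.
by apply: (row_free_inj Bfree); rewrite KB0 mul0mx.
Qed.

Lemma penrose_ex m n (A : 'M[R]_(m, n)) : exists B, penrose A B.
Proof.
move: (mulmx_base A) (col_base_full A) (row_base_free A).
move: (\rank A) (col_base A) (row_base A) => r C D AE Cfull Dfree.
have uD : D *m D^T \in unitmx by exact: row_free_gram_unit.
have uC : C^T *m C \in unitmx.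
  rewrite -[X in _ *m X]trmxK; apply: row_free_gram_unit.
  by rewrite /row_free mxrank_tr.
set G := invmx (D *m D^T); set H := invmx (C^T *m C).
have DG : D *m D^T *m G = 1%:M by rewrite mulmxV.
have HC : H *m (C^T *m C) = 1%:M by rewrite mulVmx.
have GT : G^T = G by rewrite /G trmx_inv trmx_mul trmxK.
have HT : H^T = H by rewrite /H trmx_inv trmx_mul trmxK.
pose B := D^T *m G *m H *m C^T.
have AB : A *m B = C *m H *m C^T.
  rewrite /B -AE !mulmxA -(mulmxA C D) -(mulmxA C (D *m _)).
  by rewrite DG mulmx1.
have BA : B *m A = D^T *m G *m D.
  by rewrite /B -AE !mulmxA -(mulmxA _ C^T) -(mulmxA _ H) HC mulmx1.
exists B; split.
- by rewrite AB -AE !mulmxA -(mulmxA _ C^T) -(mulmxA _ H) HC mulmx1.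
- rewrite BA /B !mulmxA -(mulmxA _ D) -(mulmxA _ (D *m _)) DG.
  by rewrite mulmx1.
- by rewrite AB !trmx_mul trmxK HT mulmxA.
- by rewrite BA !trmx_mul trmxK GT mulmxA.
Qed.

Lemma penrose_uniq m n (A : 'M[R]_(m, n)) B1 B2 :
  penrose A B1 -> penrose A B2 -> B1 = B2.
Proof.
move=> [a1 b1 c1 d1] [a2 b2 c2 d2].
have e1 : A *m B1 = A *m B2.
  rewrite -c1 -{1}a2 -(mulmxA (A *m B2)) trmx_mul c1 c2 mulmxA.
  by rewrite a1.
have e2 : B1 *m A = B2 *m A.
  rewrite -d1 -{1}a2 !mulmxA -(mulmxA _ B2) trmx_mul d1 d2 -mulmxA.
  by rewrite [A *m (B1 *m A)]mulmxA a1.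
by rewrite -b1 -mulmxA e1 mulmxA e2 b2.
Qed.

Lemma moore_penroseP m n (A : 'M[R]_(m, n)) : penrose A (moore_penrose A).
Proof. by apply: xgetPex; exact: penrose_ex. Qed.

End linear_algebra.

Section estimators.
Context {R : realType} {m p : nat}.
Implicit Types (X : 'M[R]_(m, p)) (Y : 'cV[R]_m).

Definition ols X Y : 'cV[R]_p := moore_penrose (X^T *m X) *m X^T *m Y.

Definition sigma2_hat X Y : R :=
  norm2 (Y - X *m ols X Y) ^+ 2 / (m%:R - p%:R).

Definition james_stein (c : R) X Y : 'cV[R]_p :=
  let b := ols X Y in
  let s := (b^T *m X^T *m X *m b) 0 0 in
  if 0 < s then Num.max (1 - c * p%:R * sigma2_hat X Y / s) 0 *: b else 0.

End estimators.

Section probability.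
Context {R : realType}.

Definition has_law {d d'} {T : measurableType d} {U : measurableType d'}
    (Pr : probability T R) (X : T -> U) (L : set U -> \bar R) :=
  measurable_fun setT X /\
  forall A, measurable A -> pushforward Pr X A = L A.

Definition mutually_independent {d d'} {T : measurableType d}
    {U : measurableType d'} (Pr : probability T R) {I : finType}
    (X : I -> T -> U) :=
  forall A : I -> set U, (forall i, measurable (A i)) ->
    Pr (\bigcap_(i in [set: I]) (X i @^-1` A i)) =
    (\prod_i Pr (X i @^-1` A i))%E.

Definition has_lebesgue_density (L : probability R R) :=
  exists f : R -> R, [/\ measurable_fun setT f, forall v, 0 <= f v &
    forall A, measurable A ->
      L A = (\int[@lebesgue_measure R]_(v in A) (f v)%:E)%E].

End probability.

Section model.
Context {R : realType}.

Definition admissible_Lw (Lw : probability R R) :=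
  [/\ ('E_Lw[idfun] = 0)%E, ('V_Lw[idfun] = 1)%E &
      ('E_Lw[fun s => (s ^+ 4)%R] < +oo)%E].

Definition admissible_Ll (c0 : R) (Ll : probability R R) :=
  ('E_Ll[fun s => (s ^+ 2)%R] = 1)%E /\ Ll `]- c0, c0[%classic = 0%E.

(* R^{p+1} is p.-tuple R * R with the product sigma-algebra, which is its
   Borel sigma-algebra: the first component is x_0, the second one y_0. *)
Definition vec {p} (x : p.-tuple R) : 'cV[R]_p := \col_j tnth x j.

Definition design_law {p} (Ll Lw : probability R R) (S : 'M[R]_p)
    (Q : set (p.-tuple R) -> \bar R) :=
  exists (d : measure_display) (T : measurableType d) (Pr : probability T R)
         (l : T -> R) (w : 'I_p -> T -> R),
  [/\ has_law Pr l Ll,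
      forall j, has_law Pr (w j) Lw,
      mutually_independent Pr
        (fun i : option 'I_p => if i is Some j then w j else l) &
      has_law Pr
        (fun t => [tuple (l t *: (S *m \col_j w j t)) i 0 | i < p]) Q].

Record params (p : nat) := Params {
  Sigma : 'M[R]_p;
  Sigma_half : 'M[R]_p;
  mu : p.-tuple R -> R;
  sigma : R;
  v_law : probability R R }.

(* P belongs to the model class, with Sigma_P, Sigma_P^{1/2}, mu_P, sigma_P
   and the law of v_P given by th.  All of th is determined by P, except that
   mu_P is determined up to a null set only.  In the last clause the kernel
   sending x to the law of mu_P(x) + sigma_P v_P is the conditional
   distribution of y_0 given x_0. *)
Record in_model {p} (Ll Lw : probability R R) (C0 : R)
    (P : probability (p.-tuple R * R)%type R) (th : params p) : Prop := InModel {
  Sigma_posdef : symmetric_posdef (Sigma th);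
  Sigma_halfP : is_posdef_sqrt (Sigma th) (Sigma_half th);
  x_law : design_law Ll Lw (Sigma_half th) (pushforward P fst);
  mu_measurable : measurable_fun setT (mu th);
  mu_integrable : P.-integrable setT (fun z => (mu th z.1)%:E);
  mu_mean : ('E_P[fun z => mu th z.1] = 0)%E;
  sigma_gt0 : 0 < sigma th;
  v_mean : ('E_(v_law th)[idfun] = 0)%E;
  v_var : ('V_(v_law th)[idfun] = 1)%E;
  v_moment4 : ('E_(v_law th)[fun v => (v ^+ 4)%R] <= C0%:E)%E;
  y_conditional : forall (A : set (p.-tuple R)) (B : set R),
    measurable A -> measurable B ->
    P (A `*` B) = (\int[P]_(z in A `*` setT)
      v_law th [set v | B (mu th z.1 + sigma th * v)%R])%E }.

Definition is_risk_minimizer {p} (P : probability (p.-tuple R * R)%type R)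
    (beta : 'cV[R]_p) :=
  forall b : 'cV[R]_p,
    ('E_P[fun z => ((z.2 - dotv beta (vec z.1)) ^+ 2)%R] <=
     'E_P[fun z => ((z.2 - dotv b (vec z.1)) ^+ 2)%R])%E.

Definition misspecification {p} (P : probability (p.-tuple R * R)%type R)
    (th : params p) (beta : 'cV[R]_p) : \bar R :=
  ('E_P[fun z => (((mu th z.1 - dotv (vec z.1) beta) / sigma th) ^+ 2)%R])%E.

End model.

Arguments params R p : clear implicits.

Section data.
Context {R : realType} {p : nat}.

Definition iid_data {d} {T : measurableType d} (Pr : probability T R) (n : nat)
    (z : nat -> T -> p.-tuple R * R) (P : probability (p.-tuple R * R)%type R) :=
  (forall i : 'I_n.+1, has_law Pr (z i) P) /\
  mutually_independent Pr (fun i : 'I_n.+1 => z i).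

(* The m observations (x_i, y_i) with k <= i < k + m; the full sample of size n
   is (k, m) = (1, n), and the one without its first observation is
   (k, m) = (2, n - 1). *)
Definition Xdata (k m : nat) (z : nat -> p.-tuple R * R) : 'M[R]_(m, p) :=
  \matrix_(i < m, j < p) tnth (z (k + i)%N).1 j.

Definition Ydata (k m : nat) (z : nat -> p.-tuple R * R) : 'cV[R]_m :=
  \col_(i < m) (z (k + i)%N).2.

Definition js_full (n : nat) (c : R) (z : nat -> p.-tuple R * R) : 'cV[R]_p :=
  james_stein c (Xdata 1 n z) (Ydata 1 n z).

Definition js_loo (n : nat) (c : R) (z : nat -> p.-tuple R * R) : 'cV[R]_p :=
  james_stein c (Xdata 2 n.-1 z) (Ydata 2 n.-1 z).

Definition scaled_dist (th : params R p) (b1 b2 : 'cV[R]_p) : R :=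
  norm2 ((sigma th)^-1 *: (Sigma_half th *m (b1 - b2))).

End data.

(* Main.v *)
(* The crux is that the smallest eigenvalue of the standardized Gram matrix
   exceeds [del * n] with probability tending to one, although only fourth
   moments are available.  With rows [w_j], let
   [D_(k+1) = D_k - eta + w_k w_k'] and [D_0 = s], and consider the potential
     [(1 + B tr D^-2) exp (lam (tr D^-1 - phi))].
   By the Sherman-Morrison formula and the second moments of quadratic forms in
   [w], it is a supermartingale as long as it stays below one, and below one it
   forces [D] to be positive definite.  It starts below any given level when
   [s] is a suitable multiple of [n] and [p / n] is bounded away from one.

   On that event, Pythagoras bounds the error of least squares by the residual
   sum of squares [U] at [beta], which is [O(n sigma^2)] by Markov's inequality,
   and the James-Stein weight [v] satisfies [(1 - v)^2 |X b|^2 <= tau], with [tau] at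
   most a multiple of [U]; this is the first claim.

   For the second claim, [|X (b - b')|^2 <= e^2], where [b'] omits the first
   observation and [e] is its prediction error by [b'], which is [O(sigma)].
   If [|Sigma^(1/2) beta|] is of order [sigma], the weights are compared through
   the map [r |-> (r - tau / r)_+], which is 2-Lipschitz in [r] and 1/2-Hoelder in
   [tau]; if it is much larger, both weights are close to one. *)
From HB Require Import structures.
Require Import Defs.
From mathcomp Require Import all_boot all_order all_algebra.
From mathcomp Require Import all_classical all_reals all_analysis.
From mathcomp Require Import measurable_realfun ring lra.
Import Order.TTheory GRing.Theory Num.Theory.
Import numFieldNormedType.Exports.

Set Implicit Arguments.
Unset Strict Implicit.
Unset Printing Implicit Defensive.

Local Open Scope classical_set_scope.
Local Open Scope ring_scope.

(** [w' D^-1 w] deviates from [tr D^-1] by the order of the Frobenius norm of [D^-1]. So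
    [1 / (1 + tr D^-1)] describes the gain of a rank one update only while [tr D^-2] is small, and
    subtracting [eta] is safe only while [D^-1] is bounded in norm. A bound on [tr D^-1] does not
    make [tr D^-2] small; this is why the potential has the factor [1 + B tr D^-2] with a large [B].
    The factor is cheap at the start, where [tr D^-2 = p / s^2] is of order [1 / n].

    The radial factor has a second moment and stays away from zero; as the potential decreases in
    the size of the update, its lower bound is what enters there.

    The residual [y - x' beta] may depend on [x], so it enters through its second moment only.
    Inverse Gram matrices come without moment bounds; every estimate therefore lives on a good
    event, and that event ignores the first observation so that [b'] and [x_1] remain independent on
    it.

    The case distinction in the second claim is due to [x_1' b']: it changes the length of the
    fitted values when the row is removed, and it is of the order of [|Sigma^(1/2) beta|], not of
    [sigma]. *)

(** * Quadratic forms and traces of semidefinite matrices *)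

Section quadratic_forms.
Context {R : realType}.

(** Common source of [psd_cauchy] and [mxtrace_cauchy]: nonnegativity along a line is all that is
    required, so the form may be degenerate. *)
Lemma discriminant_le (a b c : R) :
  (forall t, 0 <= a + 2 * t * b + t ^+ 2 * c) -> b ^+ 2 <= a * c.
Proof.
move=> h.
have a0 : 0 <= a by have := h 0; rewrite mulr0 mul0r expr0n mul0r !addr0.
have c0 : 0 <= c.
  rewrite leNgt; apply/negP => c0.
  have c1 : c != 0 by rewrite lt_eqF.
  (* Adding the values at [t] and [- t] cancels the linear term; this [t] is at least one and makes
     [t * (t * - c)] exceed [a]. *)
  pose t := (`|b| + 1 + a) / - c + 1.
  have := h t; have := h (- t); have cn : 0 < - c by lra.
  have E : t * - c = `|b| + 1 + a - c by rewrite /t mulrDl mul1r divfK// oppr_eq0.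
  have t1 : 1 <= t by rewrite lerDr divr_ge0 ?ltW//; have := normr_ge0 b; lra.
  rewrite sqrrN => h1 h2.
  have h3 : 0 <= a + t ^+ 2 * c by lra.
  have : t * (t * - c) <= a by lra.
  rewrite E; have := normr_ge0 b; nra.
have [c00|c00] := eqVneq c 0.
  have [->|b0] := eqVneq b 0; first by rewrite expr0n mulr_ge0.
  have := h (- (a + 1) / (2 * b)); rewrite c00 mulr0 addr0.
  have -> : 2 * (- (a + 1) / (2 * b)) * b = - (a + 1) by field.
  by move=> ?; exfalso; lra.
have cp : 0 < c by rewrite lt_def c00.
have := h (- b / c).
have -> : a + 2 * (- b / c) * b + (- b / c) ^+ 2 * c = (a * c - b ^+ 2) / c by field.
by rewrite pmulr_lge0 ?invr_gt0// subr_ge0.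
Qed.

Lemma dotvE p (u v : 'cV[R]_p) : dotv u v = \sum_i u i 0 * v i 0.
Proof. by rewrite /dotv mxE; apply: eq_bigr => i _; rewrite mxE. Qed.

Lemma dotvC p (u v : 'cV[R]_p) : dotv u v = dotv v u.
Proof. by rewrite !dotvE; apply: eq_bigr => i _; rewrite mulrC. Qed.

Lemma dotvDl p (u v w : 'cV[R]_p) : dotv (u + v) w = dotv u w + dotv v w.
Proof. by rewrite /dotv linearD /= mulmxDl mxE. Qed.

Lemma dotvDr p (u v w : 'cV[R]_p) : dotv w (u + v) = dotv w u + dotv w v.
Proof. by rewrite /dotv mulmxDr mxE. Qed.

Lemma dotvZl p a (u v : 'cV[R]_p) : dotv (a *: u) v = a * dotv u v.
Proof. by rewrite /dotv linearZ /= -scalemxAl mxE. Qed.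

Lemma dotvZr p a (u v : 'cV[R]_p) : dotv u (a *: v) = a * dotv u v.
Proof. by rewrite /dotv -scalemxAr mxE. Qed.

Lemma dotvNl p (u v : 'cV[R]_p) : dotv (- u) v = - dotv u v.
Proof. by rewrite -scaleN1r dotvZl mulN1r. Qed.

Lemma dotvNr p (u v : 'cV[R]_p) : dotv u (- v) = - dotv u v.
Proof. by rewrite -scaleN1r dotvZr mulN1r. Qed.

Lemma dotvBr p (u v w : 'cV[R]_p) : dotv w (u - v) = dotv w u - dotv w v.
Proof. by rewrite dotvDr dotvNr. Qed.

Lemma dotv0l p (u : 'cV[R]_p) : dotv 0 u = 0.
Proof. by rewrite /dotv trmx0 mul0mx mxE. Qed.

Lemma dotv_mulmx m p (A : 'M[R]_(m, p)) u v :
  dotv u (A *m v) = dotv (A^T *m u) v.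
Proof. by rewrite /dotv trmx_mul trmxK mulmxA. Qed.

Lemma dotv_ge0 p (u : 'cV[R]_p) : 0 <= dotv u u.
Proof. by rewrite dotvE sumr_ge0// => i _; rewrite -expr2 sqr_ge0. Qed.

Lemma dotv_eq0 p (u : 'cV[R]_p) : (dotv u u == 0) = (u == 0).
Proof.
apply/idP/eqP => [|->]; last by rewrite dotv0l.
rewrite dotvE psumr_eq0 => [/allP h|i _]; last by rewrite -expr2 sqr_ge0.
apply/matrixP => i j; rewrite (ord1 j) mxE; apply/eqP.
by have := h i (mem_index_enum _); rewrite -expr2 sqrf_eq0.
Qed.

Lemma norm2_sqr p (u : 'cV[R]_p) : norm2 u ^+ 2 = dotv u u.
Proof.
rewrite /norm2 sqr_sqrtr ?sumr_ge0// => [|i _]; last exact: sqr_ge0.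
by rewrite dotvE; apply: eq_bigr => i _; rewrite expr2.
Qed.

Lemma norm2E p (u : 'cV[R]_p) : norm2 u = Num.sqrt (dotv u u).
Proof. by rewrite -norm2_sqr sqrtr_sqr ger0_norm// sqrtr_ge0. Qed.

Lemma norm2_ge0 p (u : 'cV[R]_p) : 0 <= norm2 u.
Proof. exact: sqrtr_ge0. Qed.

Definition psd p (Q : 'M[R]_p) :=
  Q^T = Q /\ forall v : 'cV[R]_p, 0 <= dotv v (Q *m v).

Lemma psd_sym p (Q : 'M[R]_p) : psd Q -> Q^T = Q. Proof. by case. Qed.

Lemma posdef_psd p (Q : 'M[R]_p) : symmetric_posdef Q -> psd Q.
Proof.
case=> QT Q0; split=> // v.
by have [->|v0] := eqVneq v 0; [rewrite dotv0l | exact/ltW/Q0].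
Qed.

Lemma psd1 p : psd (1%:M : 'M[R]_p).
Proof. by split=> [|v]; rewrite ?trmx1// mul1mx dotv_ge0. Qed.

Lemma psd_cauchy p (Q : 'M[R]_p) u v : psd Q ->
  dotv u (Q *m v) ^+ 2 <= dotv u (Q *m u) * dotv v (Q *m v).
Proof.
move=> [QT Q0]; apply: discriminant_le => t.
have E : dotv v (Q *m u) = dotv u (Q *m v) by rewrite dotv_mulmx QT dotvC.
have := Q0 (u + t *: v).
rewrite mulmxDr -scalemxAr dotvDl !dotvDr !dotvZl !dotvZr E.
congr (0 <= _); ring.
Qed.

Lemma dotv_cauchy p (u v : 'cV[R]_p) : dotv u v ^+ 2 <= dotv u u * dotv v v.
Proof. by have := psd_cauchy u v (psd1 p); rewrite !mul1mx. Qed.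

Lemma norm2D p (u v : 'cV[R]_p) : norm2 (u + v) <= norm2 u + norm2 v.
Proof.
rewrite -ler_sqr ?nnegrE ?addr_ge0 ?norm2_ge0// sqrrD !norm2_sqr.
rewrite dotvDl !dotvDr (dotvC v u).
suff : dotv u v <= norm2 u * norm2 v by lra.
rewrite (le_trans (ler_norm _))// -ler_sqr ?nnegrE ?mulr_ge0 ?norm2_ge0//.
by rewrite real_normK ?num_real// exprMn !norm2_sqr dotv_cauchy.
Qed.

Lemma norm2N p (u : 'cV[R]_p) : norm2 (- u) = norm2 u.
Proof. by rewrite !norm2E dotvNl dotvNr opprK. Qed.

Lemma norm2Z p a (u : 'cV[R]_p) : norm2 (a *: u) = `|a| * norm2 u.
Proof.
by rewrite !norm2E dotvZl dotvZr mulrA -expr2 sqrtrM ?sqr_ge0// sqrtr_sqr.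
Qed.

Lemma mxtrace_trmul m p (A B : 'M[R]_(m, p)) :
  \tr (A^T *m B) = \sum_j dotv (col j A) (col j B).
Proof.
rewrite /mxtrace; apply: eq_bigr => j _; rewrite dotvE mxE.
by apply: eq_bigr => i _; rewrite !mxE.
Qed.

Lemma mxtrace_sqr_ge0 m p (A : 'M[R]_(m, p)) : 0 <= \tr (A^T *m A).
Proof. by rewrite mxtrace_trmul sumr_ge0// => j _; exact: dotv_ge0. Qed.

Lemma mxtrace_cauchy m p (A B : 'M[R]_(m, p)) :
  \tr (A^T *m B) ^+ 2 <= \tr (A^T *m A) * \tr (B^T *m B).
Proof.
apply: discriminant_le => t; have := mxtrace_sqr_ge0 (A + t *: B).
have E : \tr (B^T *m A) = \tr (A^T *m B).
  by rewrite -mxtrace_tr trmx_mul trmxK.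
have -> : (A + t *: B)^T = A^T + t *: B^T by rewrite linearD linearZ.
rewrite mulmxDl !mulmxDr -!scalemxAl -!scalemxAr scalerA.
rewrite !mxtraceD !mxtraceZ E; congr (0 <= _); ring.
Qed.

Lemma psd_mxtrace m p (Q : 'M[R]_m) (A : 'M[R]_(m, p)) : psd Q ->
  0 <= \tr (A^T *m Q *m A).
Proof.
move=> [_ Q0]; rewrite -mulmxA mxtrace_trmul sumr_ge0// => j _.
by rewrite !colE -!mulmxA.
Qed.

Lemma psd_conj m p (Q : 'M[R]_m) (A : 'M[R]_(m, p)) : psd Q ->
  psd (A^T *m Q *m A).
Proof.
move=> [QT Q0]; split; first by rewrite !trmx_mul trmxK QT mulmxA.
by move=> v; rewrite -!mulmxA dotv_mulmx trmxK.
Qed.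

Lemma psd_mxtrace_ge0 p (Q : 'M[R]_p) : psd Q -> 0 <= \tr Q.
Proof. by move=> /(psd_mxtrace 1%:M); rewrite trmx1 mul1mx mulmx1. Qed.

Lemma psdD p (P Q : 'M[R]_p) : psd P -> psd Q -> psd (P + Q).
Proof.
move=> [PT P0] [QT Q0]; split; first by rewrite linearD/= PT QT.
by move=> v; rewrite mulmxDl dotvDr addr_ge0.
Qed.

Lemma psdZ p a (Q : 'M[R]_p) : 0 <= a -> psd Q -> psd (a *: Q).
Proof.
move=> a0 [QT Q0]; split; first by rewrite linearZ/= QT.
by move=> v; rewrite -scalemxAl dotvZr mulr_ge0.
Qed.

Lemma psd_sqr p (Q : 'M[R]_p) : psd Q -> psd (Q *m Q).
Proof.
by move=> [QT _]; have := psd_conj Q (psd1 p); rewrite QT mulmx1.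
Qed.

Lemma psd_cube p (Q : 'M[R]_p) : psd Q -> psd (Q *m Q *m Q).
Proof. by move=> Q0; have := psd_conj Q Q0; rewrite (psd_sym Q0). Qed.

Lemma dotv_delta p (Q : 'M[R]_p) i j :
  dotv (delta_mx i 0) (Q *m delta_mx j 0) = Q i j.
Proof. by rewrite -colE dotvE (bigD1 i)//= !mxE !eqxx mul1r big1 ?addr0// => k /negPf ki; rewrite mxE ki mul0r. Qed.

(** Cauchy-Schwarz on basis vectors gives [Q i j ^+ 2 <= Q i i * Q j j]; sum over both indices. *)
Lemma psd_mxtrace_sqr_le p (Q : 'M[R]_p) : psd Q ->
  \tr (Q *m Q) <= (\tr Q) ^+ 2.
Proof.
move=> Q0; rewrite expr2 /mxtrace mulr_suml ler_sum// => i _.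
rewrite mxE mulr_sumr ler_sum// => j _.
rewrite -{2}(psd_sym Q0) mxE -expr2.
by have := psd_cauchy (delta_mx i 0) (delta_mx j 0) Q0; rewrite !dotv_delta.
Qed.

Lemma norm_mulmx_le m p (A : 'M[R]_(m, p)) v :
  dotv (A *m v) (A *m v) <= \tr (A^T *m A) * dotv v v.
Proof.
have -> : \tr (A^T *m A) = \sum_i dotv (col i A^T) (col i A^T).
  by rewrite mxtrace_mulC -mxtrace_trmul trmxK.
rewrite dotvE mulr_suml.
rewrite ler_sum// => i _.
have -> : (A *m v) i 0 = dotv (col i A^T) v.
  by rewrite dotvE mxE; apply: eq_bigr => k _; rewrite !mxE.
by rewrite -expr2 dotv_cauchy.
Qed.

(* The Frobenius norm bounds the operator norm. *)
Lemma psd_form_le p (Q : 'M[R]_p) r v : psd Q -> 0 <= r ->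
  \tr (Q *m Q) <= r ^+ 2 -> dotv v (Q *m v) <= r * dotv v v.
Proof.
move=> Q0 r0 Qr; have v0 := dotv_ge0 v.
rewrite -ler_sqr ?nnegrE ?mulr_ge0//; last by case: Q0.
have := norm_mulmx_le Q v; rewrite (psd_sym Q0) => h.
rewrite (le_trans (dotv_cauchy _ _))//.
have -> : (r * dotv v v) ^+ 2 = dotv v v * (r ^+ 2 * dotv v v) by ring.
by rewrite ler_wpM2l// (le_trans h)// ler_wpM2r.
Qed.

(** In the semidefinite order this is [Q^2 <= r Q]. Cauchy-Schwarz in the form of [Q], applied to
    [v] and [Q *m v], reduces it to [psd_form_le] at [Q *m v], without eigenvectors. *)
Lemma psd_norm_le p (Q : 'M[R]_p) r v : psd Q -> 0 <= r ->
  \tr (Q *m Q) <= r ^+ 2 ->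
  dotv (Q *m v) (Q *m v) <= r * dotv v (Q *m v).
Proof.
move=> Q0 r0 Qr; set n := dotv _ _; set q := dotv v _.
have n0 : 0 <= n by exact: dotv_ge0.
have q0 : 0 <= q by apply: (proj2 Q0).
have h1 := psd_cauchy v (Q *m v) Q0.
have h2 := psd_form_le (Q *m v) Q0 r0 Qr.
have E : dotv v (Q *m (Q *m v)) = n by rewrite dotv_mulmx (psd_sym Q0).
rewrite E -/q in h1; rewrite -/n in h2.
have : n * n <= (r * q) * n.
  rewrite -expr2 (le_trans h1)// [r * q]mulrC -mulrA.
  by rewrite ler_wpM2l.
have [->|n1] := eqVneq n 0; first by rewrite mulr_ge0.
by rewrite ler_pM2r// lt_def n1.
Qed.

(** Log-convexity of the forms of successive powers. It is what makes [tr Q^2] monotone in the size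
    of a rank one update. *)
Lemma psd_form_sqr_le p (Q : 'M[R]_p) v : psd Q ->
  dotv v (Q *m Q *m v) ^+ 2 <= dotv v (Q *m v) * dotv v (Q *m Q *m Q *m v).
Proof.
move=> Q0; have := psd_cauchy v (Q *m v) Q0.
by rewrite -!mulmxA [dotv (Q *m v) _]dotv_mulmx !dotv_mulmx (psd_sym Q0).
Qed.

Lemma posdef_unitmx p (D : 'M[R]_p) : symmetric_posdef D -> D \in unitmx.
Proof.
move=> [DT D0]; rewrite -unitmx_tr -row_free_unit -kermx_eq0; apply/eqP.
apply/row_matrixP => i; rewrite row0; set u := row i _.
have uD : u *m D^T = 0 by rewrite -row_mul mulmx_ker row0.
apply: contraTeq isT => u0; have := D0 u^T; rewrite trmx_eq0 => /(_ u0).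
by rewrite -(trmxK D) -trmx_mul uD trmx0 dotvC dotv0l ltxx.
Qed.

Lemma posdef_inv p (D : 'M[R]_p) : symmetric_posdef D -> psd (invmx D).
Proof.
move=> D0; have uD := posdef_unitmx D0; have [DT Dp] := D0.
have QT : (invmx D)^T = invmx D by rewrite trmx_inv DT.
split=> // v; rewrite dotvC -{2}(mulKVmx uD v).
exact: (proj2 (posdef_psd D0)).
Qed.

End quadratic_forms.

(** * Potential of a rank one update and of a shift *)

Section barrier.
Context {R : realType}.

Lemma invmx_uniq p (A B : 'M[R]_p) : A *m B = 1%:M -> invmx A = B.
Proof. by move=> AB; have [uA _] := mulmx1_unit AB; rewrite -[RHS](mulKmx uA) AB mulmx1. Qed.

Lemma mxtrace_outer p (u : 'cV[R]_p) : \tr (u *m u^T) = dotv u u.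
Proof. by rewrite mxtrace_mulC /mxtrace big_ord1. Qed.

Lemma outer_mul p (u w : 'cV[R]_p) : u^T *m w = (dotv u w)%:M.
Proof. by apply/matrixP => i j; rewrite !ord1 /dotv !mxE eqxx mulr1n. Qed.

(* Sherman-Morrison *)
Lemma invmx_rank1 p (D : 'M[R]_p) (w : 'cV[R]_p) b :
  symmetric_posdef D -> 0 <= b ->
  let u := invmx D *m w in
  invmx (D + b *: (w *m w^T)) =
  invmx D - (b / (1 + b * dotv w u)) *: (u *m u^T).
Proof.
move=> Dp b0 u; have Q0 := posdef_inv Dp; have uD := posdef_unitmx Dp.
set x := dotv w u; have x0 : 0 <= x by exact: (proj2 Q0).
have bx : 1 + b * x != 0 by rewrite gt_eqF// ltr_pwDl// mulr_ge0.
apply: invmx_uniq.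
have Du : D *m u = w by rewrite mulKVmx.
have wQ : w^T *m invmx D = u^T by rewrite trmx_mul (psd_sym Q0).
have E : (D + b *: (w *m w^T)) *m (u *m u^T) = (1 + b * x) *: (w *m u^T).
  rewrite mulmxDl mulmxA Du -scalemxAl -mulmxA (mulmxA w^T) outer_mul.
  by rewrite mul_scalar_mx -scalemxAr scalerA scalerDl scale1r.
rewrite mulmxBr -scalemxAr E scalerA divfK// mulmxDl mulmxV//.
by rewrite -scalemxAl -mulmxA wQ addrK.
Qed.

Lemma posdef_rank1 p (D : 'M[R]_p) (w : 'cV[R]_p) b :
  symmetric_posdef D -> 0 <= b -> symmetric_posdef (D + b *: (w *m w^T)).
Proof.
move=> [DT D0] b0; split.
  by rewrite linearD linearZ /= DT trmx_mul trmxK.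
move=> v v0; rewrite mulmxDl dotvDr -scalemxAl dotvZr ltr_pwDl ?D0//.
by rewrite mulr_ge0// -mulmxA dotv_mulmx dotv_ge0.
Qed.

Lemma mxtrace_rank1 p (D : 'M[R]_p) (w : 'cV[R]_p) b :
  symmetric_posdef D -> 0 <= b ->
  let Q := invmx D in
  let Q1 := invmx (D + b *: (w *m w^T)) in
  let t := b / (1 + b * dotv w (Q *m w)) in
  let x2 := dotv w (Q *m Q *m w) in
  \tr Q1 = \tr Q - t * x2 /\
  \tr (Q1 *m Q1) =
    \tr (Q *m Q) - 2 * t * dotv w (Q *m Q *m Q *m w) + (t * x2) ^+ 2.
Proof.
move=> Dp b0 Q Q1 t x2; rewrite /Q1 (invmx_rank1 w Dp b0) -/Q -/t.
set u := Q *m w; have Q0 : psd Q := posdef_inv Dp.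
have uu : dotv u u = x2 by rewrite /x2 -mulmxA [RHS]dotv_mulmx (psd_sym Q0).
split; first by rewrite linearB linearZ /= mxtrace_outer uu.
rewrite mulmxBl !mulmxBr -!scalemxAl -!scalemxAr !linearB /= !linearZ /=.
have E1 : \tr (Q *m (u *m u^T)) = dotv w (Q *m Q *m Q *m w).
  rewrite mulmxA mxtrace_mulC trace_mx11 -/(dotv u (Q *m u)).
  by rewrite -!mulmxA [RHS]dotv_mulmx (psd_sym Q0).
have E2 : \tr (u *m u^T *m Q) = dotv w (Q *m Q *m Q *m w).
  by rewrite mxtrace_mulC E1.
have E3 : \tr (u *m u^T *m (u *m u^T)) = x2 ^+ 2.
  rewrite -mulmxA (mulmxA u^T) outer_mul mul_scalar_mx -scalemxAr linearZ /=.
  by rewrite mxtrace_outer uu expr2.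
by rewrite E1 E2 E3 /GRing.scale /=; ring.
Qed.

(** [psd_norm_le] at [D *m v] reads [dotv v v <= r * dotv v (D *m v)]: the eigenvalues of [D] are at
    least [1 / r], and [e] stays below that. *)
Lemma posdef_shift p (D : 'M[R]_p) r e :
  symmetric_posdef D -> 0 < r -> \tr (invmx D *m invmx D) <= r ^+ 2 ->
  e * r < 1 -> symmetric_posdef (D - e%:M).
Proof.
move=> Dp r0 Qr er; have [DT D0] := Dp; have Q0 := posdef_inv Dp.
split; first by rewrite linearB /= DT tr_scalar_mx.
move=> v v0; rewrite mulmxBl dotvBr mul_scalar_mx dotvZr.
have := psd_norm_le (D *m v) Q0 (ltW r0) Qr.
rewrite mulKmx ?posdef_unitmx// [dotv (D *m v) v]dotvC => h.
have vv : 0 < dotv v v by rewrite lt_def dotv_ge0 dotv_eq0 v0.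
have Dv := D0 v v0.
have [e0|e0] := leP e 0; first by nra.
have : e * dotv v v <= (e * r) * dotv v (D *m v) by rewrite -mulrA ler_wpM2l// ltW.
nra.
Qed.

(** Everything follows from the resolvent identity [Q1 - Q = e *: (Q *m Q1)], in which [Q] and [Q1]
    commute. The growth is expressed by powers of [Q1] because the decrease due to the next rank one
    update is expressed by the same traces and has to outweigh it. *)
Lemma mxtrace_shift p (D : 'M[R]_p) r e :
  symmetric_posdef D -> 0 < r -> \tr (invmx D *m invmx D) <= r ^+ 2 ->
  0 <= e -> e * r <= 2^-1 ->
  let Q := invmx D in let Q1 := invmx (D - e%:M) in
  [/\ \tr Q1 <= \tr Q + e * \tr (Q1 *m Q1),
      \tr (Q1 *m Q1) <= \tr (Q *m Q) + 2 * e * \tr (Q1 *m Q1 *m Q1) &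
      \tr (Q1 *m Q1) <= 4 * \tr (Q *m Q)].
Proof.
move=> Dp r0 Qr e0 er Q Q1.
have D1p : symmetric_posdef (D - e%:M) by apply: (posdef_shift Dp r0 Qr); lra.
have Q0 : psd Q := posdef_inv Dp; have Q10 : psd Q1 := posdef_inv D1p.
have QT := psd_sym Q0; have Q1T := psd_sym Q10.
have uD := posdef_unitmx Dp; have uD1 := posdef_unitmx D1p.
have E1 : Q1 = Q + e *: (Q *m Q1).
  rewrite -[Q1 in LHS](mulKmx uD) -/Q.
  have -> : D *m Q1 = 1%:M + e *: Q1.
    by rewrite -[X in X *m _](subrK e%:M) mulmxDl mulmxV// mul_scalar_mx.
  by rewrite mulmxDr mulmx1 -scalemxAr.
have E2 : Q1 = Q + e *: (Q1 *m Q).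
  by rewrite -[LHS]Q1T {1}E1 linearD linearZ /= trmx_mul QT Q1T.
have QQ1 : psd (Q *m Q1).
  rewrite {1}E2 mulmxDr -scalemxAr; apply: psdD; first exact: psd_sqr.
  by apply: psdZ => //; rewrite mulmxA -{1}QT; exact: psd_conj.
have e1 : e *: (Q *m Q1) = Q1 - Q by rewrite {2}E1 addrC addKr.
have e2 : e *: (Q1 *m Q) = Q1 - Q by rewrite {2}E2 addrC addKr.
have h1 : \tr (Q1 *m Q1) - \tr (Q *m Q1) = e * \tr (Q1^T *m Q *m Q1).
  by rewrite -mxtraceZ -linearB /= -mulmxBl -e2 -scalemxAl Q1T.
have h2 : 0 <= \tr (Q1^T *m Q *m Q1) by exact: psd_mxtrace.
have h3 : \tr (Q1^T *m Q *m Q1) <= r * \tr (Q1 *m Q1).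
  rewrite -mulmxA -{3}Q1T !mxtrace_trmul mulr_sumr ler_sum// => j _.
  by rewrite !colE -mulmxA; apply: psd_form_le => //; exact: ltW.
have h4 : 0 <= \tr (Q1 *m Q1) by rewrite -{1}Q1T mxtrace_sqr_ge0.
have h5 : 0 <= \tr (Q *m Q1) by exact: psd_mxtrace_ge0.
have h6 : \tr (Q *m Q1) ^+ 2 <= \tr (Q *m Q) * \tr (Q1 *m Q1).
  by have := mxtrace_cauchy Q Q1; rewrite QT Q1T.
have h7 : 0 <= \tr (Q *m Q) by rewrite -{1}QT mxtrace_sqr_ge0.
have h8 : e * \tr (Q1^T *m Q *m Q1) <= 2^-1 * \tr (Q1 *m Q1).
  by rewrite (le_trans (ler_wpM2l e0 h3))// mulrA ler_wpM2r.
split.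
- have -> : \tr Q1 = \tr Q + e * \tr (Q *m Q1) by rewrite {1}E1 linearD linearZ.
  by rewrite lerD2l ler_wpM2l// -subr_ge0 h1 mulr_ge0.
- have a1 : \tr (Q1 *m Q1) - \tr (Q *m Q1) = e * \tr (Q1 *m Q *m Q1).
    by rewrite h1 Q1T.
  have a2 : \tr (Q *m Q1) - \tr (Q *m Q) = e * \tr (Q *m Q1 *m Q).
    by rewrite -mxtraceZ -linearB /= -mulmxBr -e2 -scalemxAr mulmxA.
  have a3 : \tr (Q1 *m Q1 *m Q1) - \tr (Q1 *m Q *m Q1) = e * \tr (Q1^T *m (Q *m Q1) *m Q1).
    by rewrite -mxtraceZ -linearB /= -mulmxBl -mulmxBr -e1 -scalemxAr -scalemxAl Q1T !mulmxA.
  have a4 : 0 <= \tr (Q1^T *m (Q *m Q1) *m Q1) by exact: psd_mxtrace.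
  have a5 : \tr (Q1 *m Q *m Q1) - \tr (Q *m Q1 *m Q) = e * \tr ((Q *m Q1)^T *m (Q *m Q1)).
    rewrite (psd_sym QQ1) -mxtraceZ -mulmxA mxtrace_mulC -linearB /= -mulmxBr -e1.
    by rewrite -scalemxAr !mulmxA.
  have a6 : 0 <= \tr ((Q *m Q1)^T *m (Q *m Q1)) by exact: mxtrace_sqr_ge0.
  have a7 : \tr (Q1 *m Q *m Q1) <= \tr (Q1 *m Q1 *m Q1) by rewrite -subr_ge0 a3 mulr_ge0.
  have a8 : \tr (Q *m Q1 *m Q) <= \tr (Q1 *m Q *m Q1) by rewrite -subr_ge0 a5 mulr_ge0.
  have := ler_wpM2l e0 a7; have := ler_wpM2l e0 a8; lra.
(* Half of [tr Q1^2] is at most [tr (Q Q1)], which Cauchy-Schwarz for the trace bounds in turn;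
   squaring produces the factor four. *)
- have [z|z] := eqVneq (\tr (Q1 *m Q1)) 0; first by rewrite z mulr_ge0.
  have : 2^-1 * \tr (Q1 *m Q1) <= \tr (Q *m Q1) by lra.
  move=> k; have : (2^-1 * \tr (Q1 *m Q1)) ^+ 2 <= \tr (Q *m Q) * \tr (Q1 *m Q1).
    by rewrite (le_trans _ h6)// ler_sqr ?nnegrE// mulr_ge0.
  have zp : 0 < \tr (Q1 *m Q1) by rewrite lt_def z.
  rewrite exprMn [_ ^+ 2 in X in X <= _]expr2 mulrA (ler_pM2r zp).
  lra.
Qed.

Definition pot p (lam phi B : R) (D : 'M[R]_p) : R :=
  (1 + B * \tr (invmx D *m invmx D)) * expR (lam * (\tr (invmx D) - phi)).

Lemma pot_gt0 p lam phi B (D : 'M[R]_p) : 0 <= B -> symmetric_posdef D ->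
  0 < pot lam phi B D.
Proof.
move=> B0 Dp; have QT := psd_sym (posdef_inv Dp).
rewrite mulr_gt0 ?expR_gt0// ltr_pwDl// mulr_ge0//.
by rewrite -{1}QT mxtrace_sqr_ge0.
Qed.

(** Each factor of [pot] has a lower bound: the first is at least one, which bounds the exponential;
    the exponential is at least [expR (- (lam * phi))], which bounds the first. *)
Lemma pot_lt1 p lam phi B (D : 'M[R]_p) : 0 < lam -> 0 <= phi -> 0 <= B -> symmetric_posdef D ->
  pot lam phi B D < 1 -> \tr (invmx D) < phi /\
  B * \tr (invmx D *m invmx D) <= expR (lam * phi).
Proof.
move=> lam0 phi0 B0 Dp; have Q0 := posdef_inv Dp; have QT := psd_sym Q0.
have T10 := psd_mxtrace_ge0 Q0.
have T20 : 0 <= \tr (invmx D *m invmx D) by rewrite -{1}QT mxtrace_sqr_ge0.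
rewrite /pot; set T1 := \tr (invmx D) in T10 *; set T2 := \tr _ in T20 *.
have BT : 0 <= B * T2 by rewrite mulr_ge0.
have e0 := expR_gt0 (lam * (T1 - phi)) => h; split.
  rewrite ltNge; apply/negP => p1; have : 1 <= expR (lam * (T1 - phi)).
    by rewrite -expR0 ler_expR mulr_ge0 ?subr_ge0// ltW.
  by move: h; set E := expR _ => h h1; nra.
have : B * T2 * expR (lam * (T1 - phi)) <= 1 by lra.
rewrite -ler_pdivlMr// mul1r -expRN => /le_trans; apply.
rewrite ler_expR -mulrN opprB ler_wpM2l ?(ltW lam0)//; lra.
Qed.

Lemma expRN_le (t : R) : 0 <= t -> expR (- t) <= 1 - t + t ^+ 2.
Proof.
move=> t0; rewrite expRN -[leLHS]mul1r ler_pdivrMr ?expR_gt0//.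
rewrite (@le_trans _ _ ((1 - t + t ^+ 2) * (1 + t)))//.
  have -> : (1 - t + t ^+ 2) * (1 + t) = 1 + t ^+ 3 by ring.
  by rewrite lerDl exprn_ge0.
by rewrite ler_wpM2l ?expR_ge1Dx//; nra.
Qed.

(* Upper bound of [pot (D + b ww')] by a polynomial in [w]: [pot] decreases in
   [b], so one may take [b = 1], and [1 / (1 + x1)] lies above its tangent at
   [x1 = T1]. *)
Lemma pot_rank1_le p lam phi B r (D : 'M[R]_p) (w : 'cV[R]_p) b :
  0 <= lam -> 0 <= B -> 0 <= r -> lam * r <= 1 -> 1 <= b ->
  symmetric_posdef D -> \tr (invmx D *m invmx D) <= r ^+ 2 ->
  let Q := invmx D in
  let T1 := \tr Q in let H := 1 + B * \tr (Q *m Q) in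
  let x1 := dotv w (Q *m w) in let x2 := dotv w (Q *m Q *m w) in
  let x3 := dotv w (Q *m Q *m Q *m w) in
  let al := (1 + T1)^-1 in
  is_true (pot lam phi B (D + b *: (w *m w^T)) <=
  expR (lam * (T1 - phi)) *
    (H - (lam * H * x2 + 2 * B * (1 - lam * r) * x3) * (al - al ^+ 2 * (x1 - T1))
     + (lam ^+ 2 * H + B) * x2 ^+ 2)).
Proof.
move=> lam0 B0 r0 lr b1 Dp Qr Q T1 H x1 x2 x3 al.
have Q0 : psd Q := posdef_inv Dp; have QT := psd_sym Q0.
have b0 : 0 <= b by lra.
have [t1E t2E] := mxtrace_rank1 w Dp b0; rewrite -/Q -/x1 -/x2 -/x3 in t1E t2E.
have x10 : 0 <= x1 by exact: (proj2 Q0).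
have x20 : 0 <= x2 by exact: (proj2 (psd_sqr Q0)).
have x30 : 0 <= x3 by exact: (proj2 (psd_cube Q0)).
have T10 : 0 <= T1 := psd_mxtrace_ge0 Q0.
have T20 : 0 <= \tr (Q *m Q) by rewrite -{1}QT mxtrace_sqr_ge0.
have x213 : x2 ^+ 2 <= x1 * x3 by exact: psd_form_sqr_le.
have x2r : x2 <= r * x1.
  by have := psd_norm_le w Q0 r0 Qr; rewrite dotv_mulmx QT mulmxA dotvC.
have H0 : 0 < H by rewrite ltr_pwDl// mulr_ge0.
pose t0 := (1 + x1)^-1; pose d := t0 * x2; pose x := t0 * x3.
have t00 : 0 < t0 by rewrite invr_gt0; lra.
have t0E : t0 * (1 + x1) = 1 by rewrite mulVf// gt_eqF//; lra.
have t01 : t0 <= 1 by nra.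
set t := b / _ in t1E t2E.
have bx : 0 < 1 + b * x1 by nra.
have tE : t * (1 + b * x1) = b by rewrite divfK// gt_eqF.
have tx : t * x1 <= 1.
  by rewrite /t mulrAC ler_pdivrMr// mul1r lerDr.
have t0t : t0 <= t.
  rewrite /t0 /t -[leLHS]mul1r ler_pdivrMr; last lra.
  rewrite mulrAC ler_pdivlMr// mul1r; nra.
have d0 : 0 <= d by rewrite mulr_ge0// ltW.
have x0 : 0 <= x by rewrite mulr_ge0// ltW.
have dx2 : d <= x2 by rewrite /d; nra.
(* This holds for every [w], however large, because [x2 <= r * x1]; hence
   [expR (- (lam * d)) >= 1 - lam * r] pointwise. *)
have dr : d <= r.
  rewrite (@le_trans _ _ (t0 * (r * x1)))// ?ler_pM2l//.
  by rewrite -[leRHS]mulr1 -t0E; nra.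
have ld : lam * d <= lam * r by rewrite ler_wpM2l.
have alE : al * (1 + T1) = 1 by rewrite mulVf// gt_eqF//; lra.
have alp : 0 < al by rewrite invr_gt0; lra.
have tang : al - al ^+ 2 * (x1 - T1) <= t0.
  rewrite -subr_ge0.
  have -> : t0 - (al - al ^+ 2 * (x1 - T1)) = t0 * al ^+ 2 * (x1 - T1) ^+ 2.
    by rewrite /t0 /al; field; rewrite !gt_eqF//; lra.
  by rewrite mulr_ge0 ?sqr_ge0// mulr_ge0 ?sqr_ge0// ltW.
rewrite /pot t1E t2E.
(* [- 2 t x3 + t^2 x2^2] decreases between [t0] and [t]: the slope is controlled by [x2^2 <= x1 x3]
   together with [t x1 <= 1]. *)
have s1 : (1 + B * (\tr (Q *m Q) - 2 * t * x3 + (t * x2) ^+ 2)) <=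
          (H - 2 * B * x + B * d ^+ 2).
  suff : 0 <= 2 * (t - t0) * x3 - (t ^+ 2 - t0 ^+ 2) * x2 ^+ 2.
    by move=> /(mulr_ge0 B0); rewrite /H /x /d; nra.
  have -> : 2 * (t - t0) * x3 - (t ^+ 2 - t0 ^+ 2) * x2 ^+ 2 =
    (t - t0) * (2 * x3 - (t + t0) * x2 ^+ 2) by ring.
  rewrite mulr_ge0 ?subr_ge0//.
  have t0x : t0 * x1 <= 1 by nra.
  have tp : 0 <= t + t0 by lra.
  have k1 := ler_wpM2l tp x213.
  rewrite (le_trans k1)//.
  have -> : (t + t0) * (x1 * x3) = (t * x1 + t0 * x1) * x3 by ring.
  by rewrite ler_wpM2r//; lra.
have s2 : expR (lam * (T1 - t * x2 - phi)) <=
          expR (lam * (T1 - phi)) * expR (- (lam * d)).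
  rewrite -expRD ler_expR.
  have -> : lam * (T1 - phi) - lam * d = lam * (T1 - d - phi) by ring.
  by rewrite ler_wpM2l// lerD2r lerD2l lerN2 /d ler_wpM2r.
set e0 := expR (lam * (T1 - phi)) in s2 *; set e1 := expR (- _) in s2.
have e00 : 0 < e0 := expR_gt0 _.
have e10 : 0 < e1 := expR_gt0 _.
have e11 : e1 <= 1 by rewrite -expR0 ler_expR oppr_le0 mulr_ge0.
have e1u : e1 <= 1 - lam * d + (lam * d) ^+ 2.
  by apply: expRN_le; rewrite mulr_ge0.
have e1l : 1 - lam * r <= e1.
  by rewrite (@le_trans _ _ (1 - lam * d)) ?lerD2l ?lerN2// expR_ge1Dx.
have P0 : 0 <= 1 + B * (\tr (Q *m Q) - 2 * t * x3 + (t * x2) ^+ 2).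
  rewrite -t2E addr_ge0// mulr_ge0//.
  have D1p := posdef_rank1 w Dp b0.
  by rewrite -{1}(psd_sym (posdef_inv D1p)) mxtrace_sqr_ge0.
rewrite (le_trans (ler_pM P0 (expR_ge0 _) s1 s2))//.
rewrite mulrCA ler_pM2l//.
have g1 : H * e1 <= H * (1 - lam * d + (lam * d) ^+ 2) by rewrite ler_pM2l.
have g2 : B * x * (1 - lam * r) <= B * x * e1 by rewrite ler_wpM2l// mulr_ge0.
have g3 : B * d ^+ 2 * e1 <= B * d ^+ 2 by rewrite ler_piMr// mulr_ge0// sqr_ge0.
set ta := al - _ in tang *.
have g4 : lam * H * (x2 * ta) <= lam * H * d.
  apply: ler_wpM2l; first by rewrite mulr_ge0// ltW.
  by rewrite /d [_ * ta]mulrC ler_wpM2r.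
have g5 : B * (1 - lam * r) * (x3 * ta) <= B * (1 - lam * r) * x.
  apply: ler_wpM2l; first by rewrite mulr_ge0// subr_ge0.
  by rewrite /x [_ * ta]mulrC ler_wpM2r.
have g6 : (lam ^+ 2 * H + B) * d ^+ 2 <= (lam ^+ 2 * H + B) * x2 ^+ 2.
  rewrite ler_wpM2l//; first by rewrite addr_ge0// mulr_ge0 ?sqr_ge0// ltW.
  by rewrite ler_sqr ?nnegrE.
lra.
Qed.

End barrier.

(** * Moments of independent families *)

Section tuple_measures.
Context {R : realType} {d : measure_display} {U : measurableType d}.

Lemma tuple_measure_unique n (m1 m2 : {measure set n.-tuple U -> \bar R}) :
  (m1 setT < +oo)%E ->
  (forall A : 'I_n -> set U, (forall i, measurable (A i)) ->
    m1 [set t | forall i, A i (tnth t i)] = m2 [set t | forall i, A i (tnth t i)]) ->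
  forall A, measurable A -> m1 A = m2 A.
Proof.
move=> m1oo m12.
pose G : set (set (n.-tuple U)) := [set B | exists2 A : 'I_n -> set U,
  (forall i, measurable (A i)) & B = [set t | forall i, A i (tnth t i)]].
have GT : G setT.
  by exists (fun=> setT) => //; apply/seteqP; split.
have GM : G `<=` measurable.
  move=> _ [A mA ->].
  rewrite (_ : [set t | _] = \bigcap_(i in [set: 'I_n]) ((@tnth n U)^~ i @^-1` A i)).
    apply: fin_bigcap_measurable => [|i _]; first exact: finite_finset.
    by rewrite -[X in measurable X]setTI; exact: measurable_tnth.
  by apply/seteqP; split=> [t h i _|t h i]; [exact: h | exact: (h i I)].
move=> A mA; apply: (measure_unique G (fun=> setT)) => //.
- apply/seteqP; split; last by apply: smallest_sub => //; exact: sigma_algebra_measurable.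
  apply: smallest_sub; first exact: smallest_sigma_algebra.
  move=> B; rewrite -bigcup_seq => -[i _ /= [Y mY <-]].
  apply: sub_sigma_algebra; exists (fun j => if j == i then Y else setT).
    by move=> j; case: ifP.
  apply/seteqP; split => [t [_ /= ty] j|t h].
    by case: ifP => // /eqP ->.
  by split=> //=; have := h i; rewrite eqxx.
- move=> _ _ [A1 mA1 ->] [A2 mA2 ->]; exists (fun i => A1 i `&` A2 i).
    by move=> i; exact: measurableI.
  apply/seteqP; split => [t [h1 h2] i|t h]; first by split.
  by split=> i; case: (h i).
- by apply/seteqP; split => // x _; exists 0%N.
- by move=> _ [B mB ->]; exact: m12.
Qed.

End tuple_measures.

Section resampling.
Context {R : realType} {dT dU : measure_display} {T : measurableType dT}
  {U : measurableType dU} {I : finType}.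
Variables (Pr : probability T R) (X : I -> T -> U) (i0 : I) (mu : probability U R).

Definition upd (f : I -> U) (x : U) : I -> U := fun i => if i == i0 then x else f i.

(** A family indexed by [I] is read as a tuple through [enum_rank], which gives access to the
    product sigma-algebra on tuples. *)
Definition mfam {dV} {V : measurableType dV} (F : (I -> U) -> V) :=
  measurable_fun setT (fun t : #|I|.-tuple U => F (fun i => tnth t (enum_rank i))).

Hypothesis mX : forall i, measurable_fun setT (X i).
Hypothesis indepX : mutually_independent Pr X.
Hypothesis lawX : forall A, measurable A -> Pr (X i0 @^-1` A) = mu A.

Let tX (w : T) : #|I|.-tuple U := [tuple X (enum_val i) w | i < #|I|].
Let tu (z : T * U) : #|I|.-tuple U :=
  [tuple upd (X ^~ z.1) z.2 (enum_val i) | i < #|I|].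

Let mtX : measurable_fun setT tX.
Proof.
apply/measurable_fun_tnthP => i; rewrite (_ : _ \o _ = X (enum_val i))//.
by apply/funext => w /=; rewrite tnth_mktuple.
Qed.

Let mtu : measurable_fun setT tu.
Proof.
apply/measurable_fun_tnthP => i.
have [ei|ei] := eqVneq (enum_val i) i0.
  rewrite (_ : _ \o _ = snd)//; apply/funext => w /=.
  by rewrite tnth_mktuple /upd ei eqxx.
rewrite (_ : _ \o _ = X (enum_val i) \o fst); first exact: measurableT_comp.
by apply/funext => w /=; rewrite tnth_mktuple /upd (negPf ei).
Qed.

Lemma mfam_comp {dV} {V : measurableType dV} (F : (I -> U) -> V) :
  mfam F -> measurable_fun setT (fun w => F (X ^~ w)).
Proof.
move=> mF; rewrite (_ : (fun _ => _) =
  (fun t : #|I|.-tuple U => F (fun i => tnth t (enum_rank i))) \o tX).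
  exact: measurableT_comp.
apply/funext => w /=; congr F; apply/funext => i.
by rewrite tnth_mktuple enum_rankK.
Qed.

Lemma mfam_upd {dV} {V : measurableType dV} (F : (I -> U) -> V) :
  mfam F -> measurable_fun setT (fun z : T * U => F (upd (X ^~ z.1) z.2)).
Proof.
move=> mF; rewrite (_ : (fun _ => _) =
  (fun t : #|I|.-tuple U => F (fun i => tnth t (enum_rank i))) \o tu).
  exact: measurableT_comp.
apply/funext => w /=; congr F; apply/funext => i.
by rewrite tnth_mktuple enum_rankK.
Qed.

Let tXE (w : T) (F : (I -> U) -> \bar R) :
  F (X ^~ w) = F (fun i => tnth (tX w) (enum_rank i)).
Proof. by congr F; apply/funext => i; rewrite tnth_mktuple enum_rankK. Qed.

Let tuE (z : T * U) (F : (I -> U) -> \bar R) :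
  F (upd (X ^~ z.1) z.2) = F (fun i => tnth (tu z) (enum_rank i)).
Proof. by congr F; apply/funext => i; rewrite tnth_mktuple enum_rankK. Qed.

(** Replacing the coordinate [i0] by an independent copy keeps the joint law. On rectangles the
    factor of [i0] splits off, by independence on one side and by the product measure on the
    other. *)
Let law_tu (A : set (#|I|.-tuple U)) : measurable A ->
  pushforward Pr tX A = pushforward (Pr \x mu)%E tu A.
Proof.
pose mtX' := isMeasurableFun.Build _ _ _ _ _ mtX.
pose mtu' := isMeasurableFun.Build _ _ _ _ _ mtu.
pose fX : {mfun T >-> #|I|.-tuple U} := HB.pack tX mtX'.
pose fu : {mfun (T * U)%type >-> #|I|.-tuple U} := HB.pack tu mtu'.
move=> mA; apply: (@tuple_measure_unique _ _ _ _ (pushforward Pr fX)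
  (pushforward (Pr \x mu)%E fu)) => //=.
  by rewrite /pushforward /= preimage_setT probability_setT ltry.
move=> B mB; rewrite /pushforward /=.
pose C i := B (enum_rank i).
rewrite (_ : _ @^-1` _ = \bigcap_(i in [set: I]) (X i @^-1` C i)); last first.
  apply/seteqP; split => [w h i _|w h i] /=.
    by have := h (enum_rank i); rewrite /= tnth_mktuple enum_rankK.
  by rewrite tnth_mktuple; have := h (enum_val i) Logic.I; rewrite /C /= enum_valK.
rewrite indepX; last by move=> i; exact: mB.
pose C' i := if i == i0 then setT else C i.
rewrite (_ : _ @^-1` _ =
  (\bigcap_(i in [set: I]) (X i @^-1` C' i)) `*` C i0); last first.
  apply/seteqP; split => [[w x] h|[w x] [/= h hx] i] /=.
    split=> [i _|] /=.
      rewrite /C'; case: eqVneq => // ii0.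
      have := h (enum_rank i).
      by rewrite /= tnth_mktuple enum_rankK /upd (negPf ii0).
    by have := h (enum_rank i0); rewrite /= tnth_mktuple enum_rankK /upd eqxx.
  rewrite tnth_mktuple /upd; case: eqVneq => [e|ii0].
    by move: hx; rewrite /C -e enum_valK.
  by have := h (enum_val i) Logic.I; rewrite /C' /= (negPf ii0) /C enum_valK.
have mC' i : measurable (C' i) by rewrite /C'; case: ifP => // _; exact: mB.
rewrite product_measure1E//; last 2 first.
- apply: fin_bigcap_measurable => [|i _]; first exact: finite_finset.
  by rewrite -[X in measurable X]setTI; exact: mX.
- exact: mB.
transitivity ((\prod_i Pr (X i @^-1` C' i)) * mu (C i0))%E; last first.
  by congr (_ * _)%E; exact/esym/indepX.
rewrite (bigD1 i0)//= [in RHS](bigD1 i0)//=.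
rewrite {1}/C' eqxx preimage_setT probability_setT mul1e lawX; last exact: mB.
rewrite muleC; congr (_ * _)%E; apply: eq_bigr => i /negPf ii0.
by rewrite /C' ii0.
Qed.

(** Takes the place of conditioning on all coordinates except [i0]: the inner integral averages that
    coordinate with the others frozen. *)
Lemma resample_ge0 (F : (I -> U) -> \bar R) :
  (forall f, 0 <= F f)%E -> mfam F ->
  (\int[Pr]_w F (X ^~ w) = \int[Pr]_w \int[mu]_x F (upd (X ^~ w) x))%E.
Proof.
move=> F0 mF.
rewrite -(fubini_tonelli1 (m1 := Pr) (m2 := mu) (fun z => F (upd (X ^~ z.1) z.2))) //=; last first.
  exact: mfam_upd.
under eq_integral do rewrite tXE.
under [in RHS]eq_integral do rewrite tuE.
pose mtX' := isMeasurableFun.Build _ _ _ _ _ mtX.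
pose mtu' := isMeasurableFun.Build _ _ _ _ _ mtu.
pose fX : {mfun T >-> #|I|.-tuple U} := HB.pack tX mtX'.
pose fu : {mfun (T * U)%type >-> #|I|.-tuple U} := HB.pack tu mtu'.
pose G (t : #|I|.-tuple U) := F (fun i => tnth t (enum_rank i)).
transitivity (\int[pushforward Pr fX]_t G t)%E.
  by rewrite ge0_integral_pushforward//= => t _; exact: F0.
transitivity (\int[pushforward (Pr \x mu)%E fu]_t G t)%E.
  apply: eq_measure_integral => A mA _; exact: law_tu.
by rewrite ge0_integral_pushforward//= => t _; exact: F0.
Qed.

Lemma resample_integral (F : (I -> U) -> R) :
  mfam F -> Pr.-integrable setT (fun w => (F (X ^~ w))%:E) ->
  (\int[Pr]_w (F (X ^~ w))%:E =
   \int[Pr]_w \int[mu]_x (F (upd (X ^~ w) x))%:E)%E.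
Proof.
move=> mF iF.
have mEF : mfam (fun f => (F f)%:E) by exact/measurable_EFinP.
have mU : measurable_fun setT (fun z : T * U => (F (upd (X ^~ z.1) z.2))%:E).
  exact: (mfam_upd mEF).
have iU : (Pr \x mu)%E.-integrable setT
    (fun z : T * U => (F (upd (X ^~ z.1) z.2))%:E).
  apply/integrableP; split=> //.
  rewrite fubini_tonelli1//; last exact: measurableT_comp.
  have mA : mfam (fun f => `|(F f)%:E|%E).
    by apply: measurableT_comp => //; exact: mEF.
  rewrite /fubini_F -(resample_ge0 _ mA)//.
  by case/integrableP : iF.
rewrite (integral12_prod_meas1 iU).
under eq_integral do rewrite (tXE _ (fun f => (F f)%:E)).
under [in RHS]eq_integral do rewrite (tuE _ (fun f => (F f)%:E)).
pose mtX' := isMeasurableFun.Build _ _ _ _ _ mtX.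
pose mtu' := isMeasurableFun.Build _ _ _ _ _ mtu.
pose fX : {mfun T >-> #|I|.-tuple U} := HB.pack tX mtX'.
pose fu : {mfun (T * U)%type >-> #|I|.-tuple U} := HB.pack tu mtu'.
pose G (t : #|I|.-tuple U) := (F (fun i => tnth t (enum_rank i)))%:E.
transitivity (\int[pushforward Pr fX]_t G t)%E.
  rewrite integral_pushforward//=.
  by apply: eq_integrable iF => // w _; rewrite (tXE _ (fun f => (F f)%:E)).
transitivity (\int[pushforward (Pr \x mu)%E fu]_t G t)%E.
  apply: eq_measure_integral => A mA _; exact: law_tu.
rewrite integral_pushforward//=.
by apply: eq_integrable iU => // w _; rewrite (tuE _ (fun f => (F f)%:E)).
Qed.

End resampling.

Section has_mean.
Context {R : realType} {d : measure_display} {T : measurableType d}.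
Variable Pr : probability T R.

Definition has_mean (f : T -> R) (m : R) :=
  Pr.-integrable setT (fun t => (f t)%:E) /\ (\int[Pr]_t (f t)%:E)%E = m%:E.

Lemma eq_has_mean f g m : f =1 g -> has_mean f m -> has_mean g m.
Proof. by move=> fg; rewrite (_ : f = g)//; exact/funext. Qed.

Lemma integrable_has_mean f : Pr.-integrable setT (fun t => (f t)%:E) ->
  has_mean f (fine (\int[Pr]_t (f t)%:E)%E).
Proof. by move=> fi; split=> //; rewrite fineK//; exact: integrable_fin_num. Qed.

Lemma has_mean_cst c : has_mean (fun=> c) c.
Proof.
split; first exact: finite_measure_integrable_cst.
by rewrite /= integral_cst//= probability_setT mule1.
Qed.

Lemma has_meanZ c f m : has_mean f m -> has_mean (fun t => c * f t) (c * m).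
Proof.
move=> [fi fm]; split; first by under eq_fun do rewrite EFinM; exact: integrableZl.
by under eq_integral do rewrite EFinM; rewrite integralZl// fm.
Qed.

Lemma has_meanD f g m n : has_mean f m -> has_mean g n ->
  has_mean (fun t => f t + g t) (m + n).
Proof.
move=> [fi fm] [gi gm]; split.
  by under eq_fun do rewrite EFinD; exact: integrableD.
by under eq_integral do rewrite EFinD; rewrite integralD// fm gm.
Qed.

Lemma has_mean_sum (I : Type) (s : seq I) (f : I -> T -> R) m :
  (forall i, has_mean (f i) (m i)) ->
  has_mean (fun t => \sum_(i <- s) f i t) (\sum_(i <- s) m i).
Proof.
move=> h; elim: s => [|i s ih].
  rewrite big_nil; apply: eq_has_mean (has_mean_cst 0) => t.
  by rewrite big_nil.
rewrite big_cons; apply: eq_has_mean (has_meanD (h i) ih) => t.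
by rewrite big_cons.
Qed.

Lemma has_mean_ge0 (f : T -> R) m : measurable_fun setT f -> (forall t, 0 <= f t) ->
  (\int[Pr]_t (f t)%:E)%E = m%:E -> has_mean f m.
Proof.
move=> mf f0 fm; split=> //; apply/integrableP; split; first exact/measurable_EFinP.
by under eq_integral do rewrite gee0_abs ?lee_fin//; rewrite fm ltry.
Qed.

Lemma le_integrable_ge0 (f g : T -> R) : measurable_fun setT f ->
  (forall t, `|f t| <= g t) ->
  Pr.-integrable setT (fun t => (g t)%:E) ->
  Pr.-integrable setT (fun t => (f t)%:E).
Proof.
move=> mf fg; apply: le_integrable => //; first exact/measurable_EFinP.
by move=> t _; rewrite lee_fin (le_trans (fg t))// ler_norm.
Qed.

End has_mean.

Lemma has_mean_law {R : realType} {d d' : measure_display}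
    {T : measurableType d} {U : measurableType d'} (Pr : probability T R)
    (mu : probability U R) (X : T -> U) (f : U -> R) m :
  measurable_fun setT X -> (forall A, measurable A -> Pr (X @^-1` A) = mu A) ->
  has_mean mu f m -> has_mean Pr (fun t => f (X t)) m.
Proof.
move=> mX lX [fi fm].
have mf : measurable_fun setT (EFin \o f) by exact: measurable_int fi.
have iX : Pr.-integrable setT (fun t => (f (X t))%:E).
  apply/integrableP; split; first exact: (measurableT_comp mf mX).
  have := ge0_integral_pushforward mX Pr measurableT (f := fun u => `|(f u)%:E|%E).
  rewrite preimage_setT => <- //; last exact: measurableT_comp.
  rewrite (eq_measure_integral mu) => [|A mA _]; last exact: lX.
  by case/integrableP : fi.
split=> //; rewrite -fm.
have := @integral_pushforward _ _ _ _ _ X mX Pr setT (EFin \o f) mf.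
rewrite preimage_setT => <- //.
by apply: eq_measure_integral => A mA _; exact: lX.
Qed.

Section has_mean_indep.
Context {R : realType} {dT dU : measure_display} {T : measurableType dT}
  {U : measurableType dU} {I : finType}.
Variables (Pr : probability T R) (X : I -> T -> U) (i0 : I) (mu : probability U R).
Hypothesis mX : forall i, measurable_fun setT (X i).
Hypothesis indepX : mutually_independent Pr X.
Hypothesis lawX : forall A, measurable A -> Pr (X i0 @^-1` A) = mu A.

Lemma mfam_coord i (f : U -> R) : measurable_fun setT f -> mfam (fun h : I -> U => f (h i)).
Proof.
by move=> mf; apply: measurableT_comp => //; exact: measurable_tnth.
Qed.

(** Invariance of [G] under [upd i0] says that [G] reads the other coordinates only; resampling [i0]
    then factors the integral. *)
Lemma has_mean_indep (f : U -> R) (G : (I -> U) -> R) m g :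
  measurable_fun setT f -> mfam G -> (forall h x, G (upd i0 h x) = G h) ->
  has_mean mu f m -> has_mean Pr (fun t => G (X ^~ t)) g ->
  has_mean Pr (fun t => f (X i0 t) * G (X ^~ t)) (m * g).
Proof.
move=> mf mG Gi [fi fm] [gi gm].
pose F (h : I -> U) := f (h i0) * G h.
have mF : mfam F by apply: measurable_funM => //; exact: mfam_coord.
have Fu h x : F (upd i0 h x) = G h * f x by rewrite /F /upd eqxx Gi mulrC.
have iF : Pr.-integrable setT (fun t => (F (X ^~ t))%:E).
  apply/integrableP; split; first exact/measurable_EFinP/(mfam_comp mX mF).
  rewrite (resample_ge0 mX indepX lawX (F := fun h => `|(F h)%:E|%E))//; last first.
    by apply/measurable_EFinP; exact: measurableT_comp.
  under eq_integral do under eq_integral do rewrite Fu EFinM abseM.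
  under eq_integral => t _.
    rewrite ge0_integralZl//; last by do 2 apply: measurableT_comp => //.
    over.
  have [[_ fo] [_ go]] := (integrableP _ _ _ fi, integrableP _ _ _ gi).
  rewrite ge0_integralZr//; first by rewrite lte_mul_pinfty// ?integral_ge0// ge0_fin_numE ?integral_ge0.
    by do 2 apply: measurableT_comp => //; exact: (mfam_comp mX mG).
  exact: integral_ge0.
split; first exact: iF.
rewrite (resample_integral mX indepX lawX mF iF).
under eq_integral do under eq_integral do rewrite Fu EFinM.
under eq_integral do rewrite integralZl// fm.
by rewrite integralZr// gm muleC.
Qed.

End has_mean_indep.

Section quadratic_moments.
Context {R : realType} {d : measure_display} {T : measurableType d} {p : nat}.
Variables (Pr : probability T R) (X : option 'I_p -> T -> R) (Ll Lw : probability R R).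
Hypothesis mX : forall i, measurable_fun setT (X i).
Hypothesis indepX : mutually_independent Pr X.
Hypothesis lawl : forall A, measurable A -> Pr (X None @^-1` A) = Ll A.
Hypothesis laww : forall j A, measurable A -> Pr (X (Some j) @^-1` A) = Lw A.

Let w j := X (Some j).
Let wv t : 'cV[R]_p := \col_j w j t.

Variable nu : R.
Hypothesis Lw1 : has_mean Lw id 0.
Hypothesis Lw2 : has_mean Lw (fun s => s ^+ 2) 1.
Hypothesis Lw4 : has_mean Lw (fun s => s ^+ 4) nu.

Let upd_other (i j : option 'I_p) h x : j != i -> upd i h x j = h j :> R.
Proof. by rewrite /upd => /negPf ->. Qed.

Let mfam1 k : mfam (fun h : option 'I_p -> R => h (Some k)).
Proof. exact: (@mfam_coord _ _ _ _ (Some k) (fun x => x)). Qed.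

Lemma has_mean_scale_form (j k : 'I_p) : has_mean Ll (fun s => s ^+ 2) 1 ->
  has_mean Pr (fun t => X None t ^+ 2 * (w j t * w k t)) (j == k)%:R.
Proof.
move=> Ll2; rewrite -[_%:R]mul1r.
apply: (has_mean_indep mX indepX lawl (f := fun s => s ^+ 2)
  (G := fun h => h (Some j) * h (Some k))) => //.
- by apply: measurable_funM; exact: mfam1.
- have [->|jk] := eqVneq j k.
    apply: eq_has_mean (has_mean_law (mX _) (@laww k) Lw2) => t.
    by rewrite expr2.
  rewrite -[_%:R]/(false%:R) -[false%:R](mul0r 0).
  apply: (has_mean_indep mX indepX (@laww j) (f := id) (G := fun h => h (Some k))) => //.
  + by move=> h x; rewrite upd_other//; apply: contra jk => /eqP[->].
  + exact: (has_mean_law (mX _) (@laww k) Lw1).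
Qed.

Let w4 j : has_mean Pr (fun t => w j t ^+ 4) nu.
Proof. exact: (has_mean_law (mX _) (@laww j) Lw4). Qed.

Let w3_mean (j k l : 'I_p) : exists m, has_mean Pr (fun t => w j t * w k t * w l t) m.
Proof.
eexists; apply: integrable_has_mean.
(* Only the existence of this moment matters: in [w_single] it is multiplied by the mean zero of
   [w i]. *)
pose g t := 1 + (w j t ^+ 4 + (w k t ^+ 4 + w l t ^+ 4)).
apply: (@le_integrable_ge0 _ _ _ _ _ g).
- have mw i : measurable_fun setT (w i) := mX (Some i).
  exact: measurable_funM (measurable_funM (mw j) (mw k)) (mw l).
- move=> t; rewrite /g; set a := w j t; set b := w k t; set c := w l t.
  have E (x : R) : x ^+ 4 = (x ^+ 2) ^+ 2 by rewrite -exprM.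
  rewrite !E ler_norml; have := sqr_ge0 (a ^+ 2 - b ^+ 2); have := sqr_ge0 (c ^+ 2 - 1).
  have := sqr_ge0 (a * b - c); have := sqr_ge0 (a * b + c).
  by move=> *; apply/andP; split; nra.
- have [] := has_meanD (has_mean_cst Pr 1) (has_meanD (w4 j) (has_meanD (w4 k) (w4 l))).
  by [].
Qed.

(** Wick's pairing formula, corrected by the fourth cumulant [nu - 3] when all four indices
    agree. *)
Let M (i j k l : 'I_p) : R :=
  ((i == j) && (k == l))%:R + ((i == k) && (j == l))%:R +
  ((i == l) && (j == k))%:R + (nu - 3) * ((i == j) && (j == k) && (k == l))%:R.

Let w_single (i j k l : 'I_p) : i != j -> i != k -> i != l ->
  has_mean Pr (fun t => w i t * (w j t * w k t * w l t)) 0.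
Proof.
move=> ij ik il; have [m hm] := w3_mean j k l; rewrite -(mul0r m).
apply: (has_mean_indep mX indepX (@laww i) (f := id)
  (G := fun h => h (Some j) * h (Some k) * h (Some l))) => //.
- by apply: measurable_funM; [apply: measurable_funM|]; exact: mfam1.
- by move=> h x; rewrite !upd_other//; [move: il|move: ik|move: ij]; apply: contra => /eqP[->].
Qed.

Let w_pair (i j : 'I_p) : i != j ->
  has_mean Pr (fun t => w i t ^+ 2 * w j t ^+ 2) 1.
Proof.
move=> ij; rewrite -(mulr1 1).
apply: (has_mean_indep mX indepX (@laww i) (f := fun s => s ^+ 2)
  (G := fun h => h (Some j) ^+ 2)) => //.
- by apply: measurable_funX; exact: mfam1.
- by move=> h x; rewrite !upd_other//; move: ij; apply: contra => /eqP[->].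
- exact: (has_mean_law (mX _) (@laww j) Lw2).
Qed.

Let w_quad (i j k l : 'I_p) :
  has_mean Pr (fun t => w i t * w j t * w k t * w l t) (M i j k l).
Proof.
have MM M' m f : has_mean Pr f m -> m = M' ->
    (forall t, f t = w i t * w j t * w k t * w l t) ->
    has_mean Pr (fun t => w i t * w j t * w k t * w l t) M'.
  by move=> h <- e; apply: eq_has_mean h.
rewrite /M.
have [ij|ij] := eqVneq i j.
  subst j; have [kl|kl] := eqVneq k l.
    subst l; have [ik|ik] := eqVneq i k.
      subst k; refine (MM _ _ _ (w4 i) _ _); last by move=> t; ring.
      by rewrite ?eqxx /=; lra.
    refine (MM _ _ _ (w_pair ik) _ _); last by move=> t; ring.
    by rewrite ?eqxx ?(negPf ik) /=; lra.
  have [ik|ik] := eqVneq i k.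
    subst k; have li : l != i by rewrite eq_sym.
    refine (MM _ _ _ (w_single li li li) _ _); last by move=> t; ring.
    by rewrite ?eqxx ?(negPf kl) /=; lra.
  have ki : k != i by rewrite eq_sym.
  refine (MM _ _ _ (w_single ki ki kl) _ _); last by move=> t; ring.
  by rewrite ?eqxx ?(negPf kl) ?(negPf ik) /= ?andbF /=; lra.
have [ik|ik] := eqVneq i k.
  subst k; have ji : j != i by rewrite eq_sym.
  have [jl|jl] := eqVneq j l.
    subst l; refine (MM _ _ _ (w_pair ij) _ _); last by move=> t; ring.
    by rewrite ?eqxx ?(negPf ij) ?(negPf ji) /=; lra.
  refine (MM _ _ _ (w_single ji ji jl) _ _); last by move=> t; ring.
  by rewrite ?eqxx ?(negPf ij) ?(negPf jl) ?(negPf ji) /= ?andbF /=; lra.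
have [il|il] := eqVneq i l.
  subst l; have ji : j != i by rewrite eq_sym.
  have [jk|jk] := eqVneq j k.
    subst k; refine (MM _ _ _ (w_pair ij) _ _); last by move=> t; ring.
    by rewrite ?eqxx /=; lra.
  refine (MM _ _ _ (w_single ji jk ji) _ _); last by move=> t; ring.
  by rewrite /=; lra.
refine (MM _ _ _ (w_single ij ik il) _ _); last by move=> t; ring.
by rewrite /=; lra.
Qed.

Lemma has_mean_form (P : 'M[R]_p) : has_mean Pr (fun t => dotv (wv t) (P *m wv t)) (\tr P).
Proof.
have h i j : has_mean Pr (fun t => P i j * (w i t * w j t)) (P i j * (i == j)%:R).
  apply: has_meanZ; have [->|ij] := eqVneq i j.
    by apply: eq_has_mean (has_mean_law (mX _) (@laww j) Lw2) => t; rewrite expr2.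
  rewrite -[_%:R]/(false%:R) -[false%:R](mul0r 0).
  apply: (has_mean_indep mX indepX (@laww i) (f := id) (G := fun h => h (Some j))) => //.
  + by move=> g x; rewrite upd_other//; apply: contra ij => /eqP[->].
  + exact: (has_mean_law (mX _) (@laww j) Lw1).
have := has_mean_sum (index_enum 'I_p)
  (fun i => has_mean_sum (index_enum 'I_p) (fun j => h i j)).
have -> : \sum_(i <- index_enum 'I_p) \sum_(j <- index_enum 'I_p) P i j * (i == j)%:R = \tr P.
  rewrite /mxtrace; apply: eq_bigr => i _; rewrite (bigD1 i)//= eqxx mulr1.
  by rewrite big1 ?addr0// => j /negPf ji; rewrite eq_sym ji mulr0.
apply: eq_has_mean => t; rewrite dotvE; apply: eq_bigr => i _.
rewrite !mxE mulr_sumr; apply: eq_bigr => j _; rewrite !mxE; ring.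
Qed.

(** Of the three pairings one contracts to [tr P * tr Q] and, by symmetry, two contract to
    [tr (P *m Q)]; the cumulant sees the diagonals only. *)
Lemma has_mean_form_mul (P Q : 'M[R]_p) : P^T = P -> Q^T = Q ->
  has_mean Pr (fun t => dotv (wv t) (P *m wv t) * dotv (wv t) (Q *m wv t))
   (\tr P * \tr Q + 2 * \tr (P *m Q) + (nu - 3) * \sum_i P i i * Q i i).
Proof.
move=> PT QT.
have := has_mean_sum (index_enum 'I_p) (fun i => has_mean_sum (index_enum 'I_p)
  (fun j => has_mean_sum (index_enum 'I_p) (fun k => has_mean_sum (index_enum 'I_p)
  (fun l => has_meanZ (P i j * Q k l) (w_quad i j k l))))).
(* Used from right to left: Kronecker deltas are inserted until both sides are sums over the same
   indices, so that [ring] can compare them term by term. *)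
have del (f : 'I_p -> R) a : \sum_i f i * (a == i)%:R = f a.
  rewrite (bigD1 a)//= eqxx mulr1 big1 ?addr0// => i /negPf ia.
  by rewrite eq_sym ia mulr0.
have -> : \sum_(i <- index_enum 'I_p) \sum_(j <- index_enum 'I_p)
    \sum_(k <- index_enum 'I_p) \sum_(l <- index_enum 'I_p) P i j * Q k l * M i j k l =
    \tr P * \tr Q + 2 * \tr (P *m Q) + (nu - 3) * \sum_i P i i * Q i i.
  transitivity (\sum_i \sum_j \sum_k
      (P i j * Q k k * (i == j)%:R + P i j * Q k j * (i == k)%:R +
       P i j * Q k i * (j == k)%:R + (nu - 3) * (P i j * Q k k * (i == j)%:R * (j == k)%:R))).
    apply: eq_bigr => i _; apply: eq_bigr => j _; apply: eq_bigr => k _.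
    rewrite -[Q k k](del (fun l => Q k l)) -[Q k j](del (fun l => Q k l)) -[Q k i](del (fun l => Q k l)).
    rewrite !mulr_sumr !mulr_suml !mulr_sumr -!big_split /=.
    by apply: eq_bigr => l _; rewrite /M -!mulnb !natrM; ring.
  transitivity (\sum_i \sum_j (P i j * \tr Q * (i == j)%:R + P i j * Q i j + P i j * Q j i
       + (nu - 3) * (P i j * Q j j * (i == j)%:R))).
    apply: eq_bigr => i _; apply: eq_bigr => j _.
    rewrite -[Q j j](del (fun k => Q k k)) -{1}[Q i j](del (fun k => Q k j)) -{1}[Q j i](del (fun k => Q k i)).
    rewrite /mxtrace !mulr_sumr !mulr_suml !mulr_sumr -!big_split /=.
    by apply: eq_bigr => k _; ring.
  rewrite mulr_suml mulr_sumr.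
  have -> : 2 * \tr (P *m Q) = \sum_i \sum_j (P i j * Q i j + P i j * Q j i).
    rewrite mulr_sumr; apply: eq_bigr => i _; rewrite mxE mulr_sumr; apply: eq_bigr => j _.
    by rewrite -[in Q i j]QT mxE; ring.
  rewrite -!big_split /=; apply: eq_bigr => i _.
  rewrite -(del (fun j => P i j * \tr Q)) -(del (fun j => P i j * Q j j)).
  rewrite mulr_sumr -!big_split /=.
  by apply: eq_bigr => j _; ring.
apply: eq_has_mean => t; rewrite !dotvE mulr_suml; apply: eq_bigr => i _.
rewrite !mxE -mulrA mulr_suml mulr_sumr; apply: eq_bigr => j _.
rewrite !mxE !mulr_sumr; apply: eq_bigr => k _.
rewrite !mxE !mulr_sumr; apply: eq_bigr => l _; rewrite !mxE; ring.
Qed.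

End quadratic_moments.

(** * Measurability of matrix inverses and of the estimators *)

Section measurable_matrices.
Context {R : realType} {d : measure_display} {T : measurableType d}.

Definition mxmeas m n (F : T -> 'M[R]_(m, n)) :=
  forall i j, measurable_fun setT (fun t => F t i j).

Lemma measurable_inv (f : T -> R) : measurable_fun setT f ->
  measurable_fun setT (fun t => (f t)^-1).
Proof.
move=> mf; rewrite (_ : (fun _ => _) = (fun t => f t * ((f t) ^+ 2) `^ (-1))).
  apply: measurable_funM => //.
  exact: (measurableT_comp (measurable_powR (-1)) (measurable_funX 2 mf)).
apply/funext => t; rewrite powR_inv1 ?sqr_ge0//.
have [->|ft] := eqVneq (f t) 0; first by rewrite invr0 mul0r.
by field.
Qed.

Lemma measurable_sqrt (f : T -> R) : measurable_fun setT f ->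
  measurable_fun setT (fun t => Num.sqrt (f t)).
Proof.
apply: measurableT_comp.
exact: (continuous_measurable_fun (@sqrt_continuous R)).
Qed.

Lemma measurable_gtset (f g : T -> R) : measurable_fun setT f ->
  measurable_fun setT g -> measurable [set t | f t < g t].
Proof.
move=> mf mg; have := measurable_fun_ltr mf mg measurableT (Y := [set true]).
by rewrite setTI; apply.
Qed.

Lemma mxmeas_cst m n (A : 'M[R]_(m, n)) : mxmeas (fun=> A).
Proof. by move=> i j; exact: measurable_cst. Qed.

Lemma mxmeasD m n (F G : T -> 'M[R]_(m, n)) : mxmeas F -> mxmeas G ->
  mxmeas (fun t => F t + G t).
Proof.
by move=> mF mG i j; under eq_fun do rewrite mxE; exact: measurable_funD.
Qed.

Lemma mxmeasZ m n (f : T -> R) (F : T -> 'M[R]_(m, n)) : measurable_fun setT f ->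
  mxmeas F -> mxmeas (fun t => f t *: F t).
Proof.
by move=> mf mF i j; under eq_fun do rewrite mxE; exact: measurable_funM.
Qed.

Lemma mxmeasB m n (F G : T -> 'M[R]_(m, n)) : mxmeas F -> mxmeas G ->
  mxmeas (fun t => F t - G t).
Proof.
by move=> mF mG i j; under eq_fun do rewrite !mxE; exact: measurable_funB.
Qed.

Lemma mxmeasM m n p (F : T -> 'M[R]_(m, n)) (G : T -> 'M[R]_(n, p)) :
  mxmeas F -> mxmeas G -> mxmeas (fun t => F t *m G t).
Proof.
move=> mF mG i j; under eq_fun do rewrite mxE.
by apply: measurable_sum => k; exact: measurable_funM.
Qed.

Lemma mxmeas_tr m n (F : T -> 'M[R]_(m, n)) : mxmeas F -> mxmeas (fun t => (F t)^T).
Proof. by move=> mF i j; under eq_fun do rewrite mxE; exact: mF. Qed.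

Lemma measurable_mxtrace n (F : T -> 'M[R]_n) : mxmeas F ->
  measurable_fun setT (fun t => \tr (F t)).
Proof. by move=> mF; apply: measurable_sum => i; exact: mF. Qed.

Lemma measurable_dotv n (F G : T -> 'cV[R]_n) : mxmeas F -> mxmeas G ->
  measurable_fun setT (fun t => dotv (F t) (G t)).
Proof. by move=> mF mG; apply: (mxmeasM (mxmeas_tr mF) mG). Qed.

Lemma measurable_norm2 n (F : T -> 'cV[R]_n) : mxmeas F ->
  measurable_fun setT (fun t => norm2 (F t)).
Proof.
move=> mF; under eq_fun do rewrite norm2E.
by apply: measurable_sqrt; exact: measurable_dotv.
Qed.

Lemma measurable_det n (F : T -> 'M[R]_n) : mxmeas F ->
  measurable_fun setT (fun t => \det (F t)).
Proof.
move=> mF; apply: measurable_sum => s; apply: measurable_funM => //.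
elim: (index_enum _) => [|i r ih].
  by under eq_fun do rewrite big_nil; exact: measurable_cst.
by under eq_fun do rewrite big_cons; apply: measurable_funM => //; exact: mF.
Qed.

Lemma mxmeas_inv n (F : T -> 'M[R]_n) : mxmeas F -> mxmeas (fun t => invmx (F t)).
Proof.
move=> mF i j; have mD := measurable_det mF.
(* Cramer's rule; [invmx] returns its argument when that is singular, hence the first branch. *)
rewrite (_ : (fun _ => _) = (fun t => if \det (F t) == 0 then F t i j else
    (\det (F t))^-1 * ((-1) ^+ (j + i) * \det (row' j (col' i (F t)))))).
  apply: measurable_fun_ifT => //.
    exact: measurable_fun_eqr.
  apply: measurable_funM; first exact: measurable_inv.
  apply: measurable_funM => //; apply: measurable_det => k l.
  by under eq_fun do rewrite !mxE; exact: mF.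
apply/funext => t; rewrite /invmx unitmxE unitfE.
by case: eqP => //= _; rewrite !mxE.
Qed.

Lemma shifted_sqr_posdef n (G : 'M[R]_n) e : G^T = G -> 0 < e ->
  symmetric_posdef (G *m G + e%:M).
Proof.
move=> GT e0; split; first by rewrite linearD /= trmx_mul GT tr_scalar_mx.
move=> v v0; rewrite mulmxDl mul_scalar_mx dotvDr dotvZr -mulmxA dotv_mulmx GT.
by rewrite ltr_wpDl ?dotv_ge0// mulr_gt0// lt_def dotv_ge0 dotv_eq0 v0.
Qed.

Lemma shifted_sqr_inv_le n (G : 'M[R]_n) e v : G^T = G -> 0 < e ->
  let u := e *: (invmx (G *m G + e%:M) *m v) in
  is_true (dotv u u <= dotv v v).
Proof.
move=> GT e0 u; have Dp := shifted_sqr_posdef GT e0.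
have Du : (G *m G + e%:M) *m u = e *: v by rewrite -scalemxAr mulKVmx ?posdef_unitmx.
have h1 : e * dotv u u <= e * dotv u v.
  rewrite -[leRHS]dotvZr -Du mulmxDl mul_scalar_mx dotvDr dotvZr lerDr.
  by rewrite -mulmxA dotv_mulmx GT dotv_ge0.
rewrite ler_pM2l// in h1.
have := dotv_cauchy u v; have := dotv_ge0 u; have := dotv_ge0 v.
nra.
Qed.

(** Tikhonov regularization. The matrix [C = B *m B *m B] solves [G *m G *m C = B], so with [M] the
    regularized inverse the error is [e *: (C - e *: (M *m C))]; as [e *: M] is a contraction, it is
    of order [e]. The Moore-Penrose inverse jumps where the rank drops, but it is thus a pointwise
    limit of measurable functions. *)
Lemma moore_penrose_cvg n (G : 'M[R]_n) i j : G^T = G ->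
  (invmx (G *m G + (harmonic k)%:M) *m G) i j @[k --> \oo] --> moore_penrose G i j.
Proof.
move=> GT; set B := moore_penrose G.
have [p1 p2 p3 p4] := moore_penroseP G; rewrite -/B in p1 p2 p3 p4.
have BT : B^T = B.
  apply: (@penrose_uniq _ _ _ G); last by split.
  have e1 : G *m B^T = B *m G by rewrite -p4 trmx_mul GT.
  have e2 : B^T *m G = G *m B by rewrite -p3 trmx_mul GT.
  split; rewrite ?e1 ?e2//.
  - by have := congr1 trmx p1; rewrite !trmx_mul GT mulmxA e1.
  - by have := congr1 trmx p2; rewrite !trmx_mul GT mulmxA e2.
have GB : G *m B = B *m G by rewrite -p3 trmx_mul BT GT.
pose C := B *m B *m B.
have GGB : G *m G *m B = G by rewrite -mulmxA GB mulmxA.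
have GGC : G *m G *m C = B.
  by rewrite /C !mulmxA GGB GB p2.
pose N := `|C i j| + Num.sqrt (dotv (col j C) (col j C)).
have bound k : `|B i j - (invmx (G *m G + (harmonic k)%:M) *m G) i j| <= harmonic k * N.
  set e := harmonic k; have e0 : 0 < e by rewrite /e /harmonic invr_gt0.
  have Dp := shifted_sqr_posdef GT e0; have uD := posdef_unitmx Dp.
  set M := invmx _.
  have E : B - M *m G = e *: (C - e *: (M *m C)).
    have l : (G *m G + e%:M) *m (B - M *m G) = e *: B.
      by rewrite mulmxBr mulKVmx// mulmxDl GGB mul_scalar_mx addrC addKr.
    have r : (G *m G + e%:M) *m (e *: (C - e *: (M *m C))) = e *: B.
      rewrite -scalemxAr mulmxBr -scalemxAr mulKVmx// mulmxDl GGC mul_scalar_mx.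
      by rewrite addrK.
    have := etrans l (esym r).
    by move=> /(congr1 (mulmx M)); rewrite !mulKmx.
  have -> : B i j - (M *m G) i j = e * (C i j - (e *: (M *m C)) i j).
    by have /matrixP/(_ i j) := E; rewrite !mxE.
  rewrite normrM gtr0_norm// ler_pM2l// (le_trans (ler_normB _ _))// lerD2l.
  have -> : (e *: (M *m C)) i j = (e *: (M *m col j C)) i 0.
    by rewrite !mxE; congr (_ * _); apply: eq_bigr => l _; rewrite !mxE.
  rewrite -sqrtr_sqr ler_sqrt ?dotv_ge0//.
  apply: le_trans (shifted_sqr_inv_le (col j C) GT e0).
  rewrite dotvE (bigD1 i)//= expr2 lerDl sumr_ge0// => l _.
  by rewrite -expr2 sqr_ge0.
apply/cvgrPdist_le => eps eps0.
have hN : harmonic k * N @[k --> \oo] --> 0 * N.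
  by apply: cvgMr_tmp; exact: cvg_harmonic.
rewrite mul0r in hN; near=> k; rewrite (le_trans (bound k))//.
have : `|harmonic k * N| <= eps.
  by near: k; have /cvgr0Pnorm_le := hN; exact.
by apply: le_trans; rewrite ler_norm.
Unshelve. all: by end_near.
Qed.

Lemma mxmeas_moore_penrose n (F : T -> 'M[R]_n) : mxmeas F ->
  (forall t, (F t)^T = F t) -> mxmeas (fun t => moore_penrose (F t)).
Proof.
move=> mF FT i j.
apply: (@measurable_fun_cvg _ _ _ setT
  (fun k t => (invmx (F t *m F t + (harmonic k)%:M) *m F t) i j)).
  move=> k; apply: mxmeasM => //; apply: mxmeas_inv; apply: mxmeasD.
    exact: mxmeasM.
  exact: mxmeas_cst.
by move=> t _; exact: moore_penrose_cvg.
Qed.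

Lemma mxmeas_ols m p (X : T -> 'M[R]_(m, p)) (Y : T -> 'cV[R]_m) :
  mxmeas X -> mxmeas Y -> mxmeas (fun t => ols (X t) (Y t)).
Proof.
move=> mX mY; apply: mxmeasM => //; apply: mxmeasM; last exact: mxmeas_tr.
apply: mxmeas_moore_penrose; last by move=> t; rewrite trmx_mul trmxK.
by apply: mxmeasM => //; exact: mxmeas_tr.
Qed.

Lemma mxmeas_james_stein m p c (X : T -> 'M[R]_(m, p)) (Y : T -> 'cV[R]_m) :
  mxmeas X -> mxmeas Y -> mxmeas (fun t => james_stein c (X t) (Y t)).
Proof.
move=> mX mY i j; have mb := mxmeas_ols mX mY.
pose s t := ((ols (X t) (Y t))^T *m (X t)^T *m X t *m ols (X t) (Y t)) 0 0.
have ms : measurable_fun setT s.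
  by apply: mxmeasM => //; do 2 (apply: mxmeasM => //); exact: mxmeas_tr.
have m2 : measurable_fun setT (fun t => sigma2_hat (X t) (Y t)).
  apply: measurable_funM => //; apply: measurable_funX; apply: measurable_norm2.
  by apply: mxmeasB => //; exact: mxmeasM.
rewrite (_ : (fun _ => _) = (fun t => if 0 < s t then
    Num.max (1 - c * p%:R * sigma2_hat (X t) (Y t) / s t) 0 * ols (X t) (Y t) i j else 0)).
  apply: measurable_fun_ifT => //; first exact: measurable_fun_ltr.
  apply: measurable_funM => //; apply: measurable_maxr => //.
  apply: measurable_funB => //; apply: measurable_funM; last exact: measurable_inv.
  by apply: measurable_funM.
by apply/funext => t; rewrite /james_stein -/(s t); case: ifP => _; rewrite mxE.
Qed.

Lemma measurable_pot p lam phi B (F : T -> 'M[R]_p) : mxmeas F ->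
  measurable_fun setT (fun t => pot lam phi B (F t)).
Proof.
move=> mF; have mI := mxmeas_inv mF; apply: measurable_funM.
  apply: measurable_funD => //; apply: measurable_funM => //.
  by apply: measurable_mxtrace; exact: mxmeasM.
apply: measurableT_comp => //; apply: measurable_funM => //.
by apply: measurable_funB => //; exact: measurable_mxtrace.
Qed.

End measurable_matrices.

(** * Lower bound on the smallest eigenvalue *)

Section one_step.
Context {R : realType} {d : measure_display} {T : measurableType d} {p : nat}.
Variables (Pr : probability T R) (X : option 'I_p -> T -> R) (Ll Lw : probability R R).
Hypothesis mX : forall i, measurable_fun setT (X i).
Hypothesis indepX : mutually_independent Pr X.
Hypothesis lawl : forall A, measurable A -> Pr (X None @^-1` A) = Ll A.
Hypothesis laww : forall j A, measurable A -> Pr (X (Some j) @^-1` A) = Lw A.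

Let wv t : 'cV[R]_p := \col_j X (Some j) t.

Variables (nu c0 : R).
Hypothesis Lw1 : has_mean Lw id 0.
Hypothesis Lw2 : has_mean Lw (fun s => s ^+ 2) 1.
Hypothesis Lw4 : has_mean Lw (fun s => s ^+ 4) nu.
Hypothesis c0_gt0 : 0 < c0.
Hypothesis Ll0 : Ll `]- c0, c0[%classic = 0%E.

Let K := 2 + `|nu - 3|.

(** The left side is the covariance of the forms of [P] and [Q] in [w]. Cauchy-Schwarz, for the
    trace and for the diagonals, leaves only Frobenius norms, and the constant does not see the
    dimension. *)
Lemma form_mul_le (P Q : 'M[R]_p) a b : P^T = P -> Q^T = Q -> 0 <= a -> 0 <= b ->
  \tr (P *m P) <= a ^+ 2 -> \tr (Q *m Q) <= b ^+ 2 ->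
  2 * \tr (P *m Q) + (nu - 3) * \sum_i P i i * Q i i <= K * (a * b).
Proof.
move=> PT QT a0 b0 Pa Qb.
have P0 : 0 <= \tr (P *m P) by rewrite -{1}PT mxtrace_sqr_ge0.
have Q0 : 0 <= \tr (Q *m Q) by rewrite -{1}QT mxtrace_sqr_ge0.
have sq x : x ^+ 2 <= \tr (P *m P) * \tr (Q *m Q) -> `|x| <= a * b.
  move=> h; rewrite -ler_sqr ?nnegrE ?mulr_ge0// real_normK ?num_real//.
  by rewrite (le_trans h)// exprMn ler_pM.
have h1 : `|\tr (P *m Q)| <= a * b.
  by apply: sq; have := mxtrace_cauchy P Q; rewrite PT QT.
have diag_le (A : 'M[R]_p) : A^T = A -> \sum_i A i i ^+ 2 <= \tr (A *m A).
  move=> AT; rewrite ler_sum// => i _; rewrite mxE (bigD1 i)//= expr2 lerDl.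
  by rewrite sumr_ge0// => j _; rewrite -{2}AT mxE -expr2 sqr_ge0.
have h2 : `|\sum_i P i i * Q i i| <= a * b.
  apply: sq; have := dotv_cauchy (\col_i P i i) (\col_i Q i i).
  rewrite !dotvE; under eq_bigr do rewrite !mxE.
  move=> /le_trans; apply; apply: ler_pM.
  - by rewrite sumr_ge0// => i _; rewrite -expr2 sqr_ge0.
  - by rewrite sumr_ge0// => i _; rewrite -expr2 sqr_ge0.
  - by rewrite (le_trans _ (diag_le _ PT))// ler_sum// => i _; rewrite !mxE.
  - by rewrite (le_trans _ (diag_le _ QT))// ler_sum// => i _; rewrite !mxE.
have -> : K * (a * b) = 2 * (a * b) + `|nu - 3| * (a * b) by rewrite /K mulrDl.
rewrite lerD//.
  by rewrite ler_pM2l// (le_trans (ler_norm _)).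
by rewrite (le_trans (ler_norm _))// normrM ler_wpM2l.
Qed.

(** Integrates the polynomial bound of [pot_rank1_le]. The means alone would give the tangent value
    [(1 + T1)^-1]; the covariances with the linear term of the tangent cost at most [K * r], and the
    difference is [be]. *)
Lemma pot_expect_le lam phi B r (D : 'M[R]_p) :
  0 <= lam -> 0 <= B -> 0 <= r -> lam * r <= 1 ->
  symmetric_posdef D -> \tr (invmx D *m invmx D) <= r ^+ 2 ->
  let Q := invmx D in
  let T1 := \tr Q in let T2 := \tr (Q *m Q) in let H := 1 + B * T2 in
  let be := (1 + T1)^-1 - K * r in
  is_true (\int[Pr]_t (pot lam phi B
     (D + ((X None t / c0) ^+ 2) *: (wv t *m (wv t)^T)))%:E <=
  (expR (lam * (T1 - phi)) *
    (H - (lam * H * T2 + 2 * B * (1 - lam * r) * \tr (Q *m Q *m Q)) * be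
     + (lam ^+ 2 * H + B) * (1 + K) * T2 ^+ 2))%:E)%E.
Proof.
move=> lam0 B0 r0 lr Dp Qr Q T1 T2 H be.
have Q0 : psd Q := posdef_inv Dp; have QT := psd_sym Q0.
have T10 : 0 <= T1 := psd_mxtrace_ge0 Q0.
have T20 : 0 <= T2 by exact: psd_mxtrace_ge0 (psd_sqr Q0).
have T30 : 0 <= \tr (Q *m Q *m Q) by exact: psd_mxtrace_ge0 (psd_cube Q0).
set T3 := \tr (Q *m Q *m Q) in T30 *.
have H0 : 0 <= H by rewrite addr_ge0// mulr_ge0.
pose al := (1 + T1)^-1.
have al0 : 0 <= al by rewrite invr_ge0 addr_ge0.
have al1 : al <= 1 by rewrite invf_le1 ?lerDl// ltr_pwDl.
pose c3 := 2 * B * (1 - lam * r); have c30 : 0 <= c3 by rewrite !mulr_ge0// subr_ge0.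
pose c4 := lam ^+ 2 * H + B; have c40 : 0 <= c4 by rewrite addr_ge0// mulr_ge0// sqr_ge0.
pose x1 t := dotv (wv t) (Q *m wv t).
pose x2 t := dotv (wv t) (Q *m Q *m wv t).
pose x3 t := dotv (wv t) (Q *m Q *m Q *m wv t).
pose pol t := H - (lam * H * x2 t + c3 * x3 t) * (al - al ^+ 2 * (x1 t - T1))
     + c4 * x2 t ^+ 2.
set e0 := expR (lam * (T1 - phi)).
have e00 : 0 < e0 := expR_gt0 _.
have Q2T : (Q *m Q)^T = Q *m Q := psd_sym (psd_sqr Q0).
have Q3T : (Q *m Q *m Q)^T = Q *m Q *m Q := psd_sym (psd_cube Q0).
have polM := has_meanD (has_mean_cst Pr H) (has_meanD
  (has_meanZ (- (lam * H * (al + al ^+ 2 * T1))) (has_mean_form mX indepX laww Lw1 Lw2 (Q *m Q)))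
  (has_meanD (has_meanZ (- (c3 * (al + al ^+ 2 * T1))) (has_mean_form mX indepX laww Lw1 Lw2 (Q *m Q *m Q)))
  (has_meanD (has_meanZ (lam * H * al ^+ 2) (has_mean_form_mul mX indepX laww Lw1 Lw2 Lw4 Q2T QT))
  (has_meanD (has_meanZ (c3 * al ^+ 2) (has_mean_form_mul mX indepX laww Lw1 Lw2 Lw4 Q3T QT))
   (has_meanZ c4 (has_mean_form_mul mX indepX laww Lw1 Lw2 Lw4 Q2T Q2T)))))).
set m := (X in has_mean _ _ X) in polM.
have polm : has_mean Pr pol m.
  by apply: eq_has_mean polM => t; rewrite /pol /x1 /x2 /x3 /wv; ring.
have [ipol epol] := has_meanZ e0 polm.
have mwv : mxmeas wv by move=> i j; under eq_fun do rewrite mxE; exact: mX.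
have mww : mxmeas (fun t => wv t *m (wv t)^T) by apply: mxmeasM => //; exact: mxmeas_tr.
have mpot : measurable_fun setT (fun t => pot lam phi B
     (D + ((X None t / c0) ^+ 2) *: (wv t *m (wv t)^T))).
  apply: measurable_pot; apply: mxmeasD; first exact: mxmeas_cst.
  by apply: mxmeasZ => //; apply: measurable_funX; apply: measurable_funM.
have ptw t b : 1 <= b -> pot lam phi B (D + b *: (wv t *m (wv t)^T)) <= e0 * pol t.
  by move=> b1; exact: pot_rank1_le.
have le1 : (\int[Pr]_t (pot lam phi B
     (D + ((X None t / c0) ^+ 2) *: (wv t *m (wv t)^T)))%:E <= \int[Pr]_t (e0 * pol t)%:E)%E.
  apply: ae_ge0_le_integral => //.
  - move=> t _; rewrite lee_fin ltW// pot_gt0//; apply: posdef_rank1 => //; exact: sqr_ge0.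
  - exact/measurable_EFinP.
  - move=> t _; rewrite lee_fin (le_trans _ (ptw t 1 _))// ltW// pot_gt0//.
    exact: posdef_rank1.
  - exact: measurable_int ipol.
  (* The null set where the radial factor is smaller than [c0]: outside it the coefficient of the
     update is at least one, as the pointwise bound requires. *)
  exists (X None @^-1` `]- c0, c0[%classic); split.
  - by rewrite -[X in measurable X]setTI; exact: mX.
  - by rewrite -[RHS]Ll0; apply: lawl.
  move=> t /= h; rewrite in_itv /=; apply: contrapT => hc; apply: h => _.
  rewrite lee_fin; apply: ptw; rewrite exprMn exprVn ler_pdivlMr ?exprn_gt0// mul1r.
  move/negP : hc; rewrite -ltr_norml -leNgt => {}h.
  by rewrite -[leRHS]real_normK ?num_real// ler_sqr ?nnegrE// ltW.
rewrite (le_trans le1)// epol lee_fin ler_pM2l//.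
have T2r : \tr (Q *m Q) <= r ^+ 2 by [].
have s2 : \tr (Q *m Q *m (Q *m Q)) <= T2 ^+ 2 by exact: psd_mxtrace_sqr_le (psd_sqr Q0).
have s3 : \tr (Q *m Q *m Q *m (Q *m Q *m Q)) <= T3 ^+ 2 by exact: psd_mxtrace_sqr_le (psd_cube Q0).
have b1 := form_mul_le Q2T QT T20 r0 s2 T2r.
have b2 := form_mul_le Q3T QT T30 r0 s3 T2r.
have b3 := form_mul_le Q2T Q2T T20 T20 s2 s2.
have K0 : 0 <= K by rewrite addr_ge0.
rewrite /m -/T2 -/T3 -/T1.
move: b1 b2 b3; set y1 := 2 * _ + _; set y2 := 2 * _ + _; set y3 := 2 * _ + _ => b1 b2 b3.
have k1 : lam * H * al ^+ 2 * y1 <= lam * H * (K * (T2 * r)).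
  apply: (le_trans (ler_wpM2l _ b1)); first by rewrite !mulr_ge0.
  apply: ler_wpM2r; first by rewrite !mulr_ge0.
  by rewrite ler_piMr ?mulr_ge0// expr_le1.
have k2 : c3 * al ^+ 2 * y2 <= c3 * (K * (T3 * r)).
  apply: (le_trans (ler_wpM2l _ b2)); first by apply: mulr_ge0 => //; exact: sqr_ge0.
  apply: ler_wpM2r; first by rewrite !mulr_ge0.
  by apply: ler_piMr => //; rewrite expr_le1.
have k3 : c4 * y3 <= c4 * (K * (T2 * T2)) by rewrite ler_wpM2l.
rewrite /be -/al -/c3 -/c4.
suff h : lam * H * al ^+ 2 * y1 + c3 * al ^+ 2 * y2 + c4 * y3 <=
       lam * H * (K * (T2 * r)) + c3 * (K * (T3 * r)) + c4 * (K * (T2 * T2)).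
  rewrite -subr_ge0 in h; rewrite -subr_ge0 (le_trans h)// le_eqVlt.
  by apply/orP; left; apply/eqP; rewrite /y1 /y2 /y3; ring.
by rewrite !lerD.
Qed.

End one_step.

Section moments_of_laws.
Context {R : realType}.
Implicit Types L : probability R R.

Lemma standardized_sqr L : ('E_L[idfun] = 0)%E -> ('V_L[idfun] = 1)%E ->
  has_mean L (fun s => s ^+ 2) 1.
Proof.
rewrite /variance !unlock => m1 m2; apply: has_mean_ge0.
- exact: measurable_funX.
- by move=> t; exact: sqr_ge0.
- rewrite -m2 m1; apply: eq_integral => t _ /=.
  by rewrite /GRing.mul /= subr0 expr2.
Qed.

Lemma standardized_mean L : ('E_L[idfun] = 0)%E -> ('V_L[idfun] = 1)%E ->
  has_mean L id 0.
Proof.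
move=> m1 m2; split; last by move: m1; rewrite unlock.
apply: (@le_integrable_ge0 _ _ _ L id (fun s => 1 + s ^+ 2)) => //.
  by move=> s; rewrite ler_norml; apply/andP; split; nra.
by have [] := has_meanD (has_mean_cst L 1) (standardized_sqr m1 m2).
Qed.

Lemma fourth_moment L : ('E_L[fun s => (s ^+ 4)%R] < +oo)%E ->
  exists nu, has_mean L (fun s => s ^+ 4) nu.
Proof.
rewrite unlock => h; eexists; apply: integrable_has_mean.
apply/integrableP; split; first exact/measurable_EFinP/measurable_funX.
under eq_integral => t _.
  rewrite gee0_abs; last by rewrite lee_fin (exprM t 2 2) sqr_ge0.
  over.
by [].
Qed.

End moments_of_laws.

Definition design_tuple {R : realType} {p : nat} (S : 'M[R]_p) (h : option 'I_p -> R) :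
  p.-tuple R := [tuple (h None *: (S *m \col_j h (Some j))) i 0 | i < p].

Section design.
Context {R : realType} {p : nat}.
Variables (Ll Lw : probability R R) (S : 'M[R]_p).
Variable (P : probability (p.-tuple R * R)%type R).

Lemma vec_mxmeas : mxmeas (@vec R p).
Proof. by move=> i j; under eq_fun do rewrite mxE; exact: measurable_tnth. Qed.

Lemma vec_tuple (v : 'cV[R]_p) : vec [tuple v i 0 | i < p] = v.
Proof. by apply/matrixP => i j; rewrite mxE tnth_mktuple (ord1 j). Qed.

(** The factors [l] and [w] live on an auxiliary space and are not functions of the observation;
    integrals of functions of [x_0] are moved there before moments are taken. *)
Lemma design_integral :
  design_law Ll Lw S (pushforward P fst) ->
  exists (d : measure_display) (T : measurableType d) (Pr : probability T R)
    (X : option 'I_p -> T -> R),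
  [/\ forall i, measurable_fun setT (X i), mutually_independent Pr X,
      forall A, measurable A -> Pr (X None @^-1` A) = Ll A,
      forall j A, measurable A -> Pr (X (Some j) @^-1` A) = Lw A &
      forall f : p.-tuple R -> \bar R, measurable_fun setT f ->
        (forall x, 0 <= f x)%E ->
        (\int[P]_z f z.1)%E = (\int[Pr]_t f (design_tuple S (X ^~ t)))%E].
Proof.
move=> [d [T [Pr [l [w [[ml ll] lw ind [mx lx]]]]]]].
exists d, T, Pr, (fun i => if i is Some j then w j else l); split=> //.
- by case=> [j|//]; case: (lw j).
- by move=> j A mA; case: (lw j) => _; exact.
move=> g mg g0.
have e1 := ge0_integral_pushforward (@measurable_fst _ _ (p.-tuple R) R) P measurableT mg.
rewrite preimage_setT in e1; rewrite -e1//.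
have e2 := ge0_integral_pushforward mx Pr measurableT mg.
rewrite preimage_setT in e2; rewrite -e2//.
by apply: eq_measure_integral => A mA _; exact/esym/lx.
Qed.

End design.

Section step.
Context {R : realType}.

(* [Phi], [Psi] are the traces of the first two powers of the resolvent of the
   current matrix, [T1], [T2], [T3] those after the shift by [eta]. *)
Lemma step_arith (lam B r0 phi eta e1 K Phi Psi T1 T2 T3 : R) :
  0 < lam -> 0 < B -> 0 < r0 -> r0 <= 4^-1 -> 0 <= K -> 2 * K * r0 <= e1 ->
  2 * lam * r0 <= e1 -> 0 <= eta -> 0 < e1 -> 0 <= phi ->
  eta + 2 * e1 <= (1 + phi + 4^-1)^-1 -> 2 * (1 + K) <= lam * e1 ->
  Phi < phi -> 0 <= Psi -> Psi <= r0 ^+ 2 ->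
  0 <= T1 -> 0 <= T2 -> 0 <= T3 ->
  T1 <= Phi + eta * T2 -> T2 <= Psi + 2 * eta * T3 -> T2 <= 4 * Psi ->
  expR (lam * (T1 - phi)) * (1 + B * T2 -
    (lam * (1 + B * T2) * T2 + 2 * B * (1 - lam * (2 * r0)) * T3) *
      ((1 + T1)^-1 - K * (2 * r0)) +
    (lam ^+ 2 * (1 + B * T2) + B) * (1 + K) * T2 ^+ 2) <=
  (1 + B * Psi) * expR (lam * (Phi - phi)).
Proof.
move=> lam0 B0 r00 r04 K0 Kr lr eta0 e10 phi0 etae lamK Pp P0 Pr T10 T20 T30 h1 h2 h3.
set H := 1 + B * T2; set be := _ - K * _.
have inv1 : (1 + phi + 4^-1)^-1 <= 1.
  by rewrite invf_le1; lra.
have eta1 : eta + 2 * e1 <= 1 by exact: le_trans inv1.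
have r02 : r0 ^+ 2 <= 4^-1 * r0 by rewrite expr2 ler_wpM2r// ltW.
have etaT : eta * T2 <= r0.
  have : eta * T2 <= 1 * T2 by apply: ler_wpM2r => //; lra.
  lra.
(* The slack [2 * e1] in [etae] is spent here and below: one [e1] absorbs the covariance loss
   [K * (2 * r0)]; the other absorbs the factor [1 - lam * (2 * r0)] in the terms with [T3] and the
   second-order terms in those with [T2]. *)
have beE : eta + e1 <= be.
  have : (1 + phi + 4^-1)^-1 <= (1 + T1)^-1.
    by rewrite lef_pV2 ?posrE; lra.
  rewrite /be; lra.
have H0 : 1 <= H by rewrite lerDl mulr_ge0// ltW.
have HT : 0 <= H * T2 by rewrite mulr_ge0//; lra.
have g1 : eta <= (1 - lam * (2 * r0)) * be.
  have a1 : 1 - e1 <= 1 - lam * (2 * r0) by lra.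
  have a2 : (1 - e1) * (eta + e1) <= (1 - lam * (2 * r0)) * be.
    by apply: ler_pM => //; lra.
  apply: le_trans a2; nra.
have g2 : (lam ^+ 2 * H + B) * (1 + K) * T2 ^+ 2 <= lam * e1 * (H * T2).
  have b1 : lam ^+ 2 * T2 <= 1.
    have -> : 1 = 1 ^+ 2 :> R by rewrite expr1n.
    have l1 : 2 * lam * r0 <= 1 by lra.
    have : (2 * lam * r0) ^+ 2 <= 1 ^+ 2.
      by rewrite ler_sqr ?nnegrE// !mulr_ge0// ltW.
    apply: le_trans.
    have -> : (2 * lam * r0) ^+ 2 = lam ^+ 2 * (4 * r0 ^+ 2) by ring.
    by rewrite ler_wpM2l ?sqr_ge0//; lra.
  have b2 : (lam ^+ 2 * H + B) * T2 <= 2 * H.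
    have : lam ^+ 2 * T2 * H <= 1 * H by apply: ler_wpM2r => //; lra.
    have : B * T2 <= H by rewrite /H; lra.
    lra.
  have -> : (lam ^+ 2 * H + B) * (1 + K) * T2 ^+ 2 =
     ((lam ^+ 2 * H + B) * T2) * ((1 + K) * T2) by ring.
  have b3 : 0 <= (1 + K) * T2 by rewrite mulr_ge0//; lra.
  rewrite (le_trans (ler_wpM2r b3 b2))//.
  have -> : 2 * H * ((1 + K) * T2) = 2 * (1 + K) * (H * T2) by ring.
  by rewrite ler_wpM2r.
(* The shift multiplies the exponential by at most [expR y], the update supplies the factor [1 - y],
   and [(1 - y) * expR y <= 1]. The growth of [T2] by [2 * eta * T3] is cancelled separately. *)
pose y := lam * eta * T2.
have y0 : 0 <= y by rewrite !mulr_ge0// ltW.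
have y1 : y <= 1.
  have : lam * (eta * T2) <= lam * r0 by rewrite ler_wpM2l// ltW.
  rewrite /y; lra.
have g3 : B * T3 * eta <= B * T3 * ((1 - lam * (2 * r0)) * be).
  by rewrite ler_wpM2l// mulr_ge0// ltW.
have g4 : lam * (H * T2) * (eta + e1) <= lam * (H * T2) * be.
  by rewrite ler_wpM2l// mulr_ge0// ltW.
have BT3 : 0 <= B * T3 * eta by rewrite !mulr_ge0// ltW.
have W0 : 0 <= (1 + B * Psi) * (1 - y).
  by rewrite mulr_ge0 ?subr_ge0// addr_ge0// mulr_ge0// ltW.
have g5 : H - (lam * H * T2 + 2 * B * (1 - lam * (2 * r0)) * T3) * be +
    (lam ^+ 2 * H + B) * (1 + K) * T2 ^+ 2 <= (1 + B * Psi) * (1 - y).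
  apply: (@le_trans _ _ (H * (1 - y) - 2 * B * eta * T3)).
    by move: g2 g3 g4; rewrite /y; lra.
  have : (H - 2 * B * eta * T3) * (1 - y) <= (1 + B * Psi) * (1 - y).
    apply: ler_wpM2r; first by rewrite subr_ge0.
    have : B * T2 <= B * (Psi + 2 * eta * T3) by rewrite ler_wpM2l// ltW.
    rewrite /H; lra.
  apply: le_trans.
  have := mulr_ge0 y0 BT3; lra.
rewrite (le_trans (ler_wpM2l (expR_ge0 _) g5))//.
have g6 : expR (lam * (T1 - phi)) <= expR (lam * (Phi - phi)) * expR y.
  rewrite -expRD ler_expR /y.
  have : lam * T1 <= lam * (Phi + eta * T2) by rewrite ler_wpM2l// ltW.
  lra.
rewrite (le_trans (ler_wpM2r W0 g6))//.
have -> : expR (lam * (Phi - phi)) * expR y * ((1 + B * Psi) * (1 - y)) =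
  (1 + B * Psi) * expR (lam * (Phi - phi)) * ((1 - y) * expR y) by ring.
rewrite ler_piMr// ?mulr_ge0 ?expR_ge0//.
  by rewrite addr_ge0// mulr_ge0// ltW.
have : (1 - y) <= expR (- y) by exact: expR_ge1Dx.
move=> /(ler_wpM2r (expR_ge0 y)); rewrite expRN mulVf// gt_eqF// expR_gt0.
by [].
Qed.

Variables (Ll Lw : probability R R) (nu c0 : R).
Hypothesis Lw1 : has_mean Lw id 0.
Hypothesis Lw2 : has_mean Lw (fun s => s ^+ 2) 1.
Hypothesis Lw4 : has_mean Lw (fun s => s ^+ 4) nu.
Hypothesis c0_gt0 : 0 < c0.
Hypothesis Ll0 : Ll `]- c0, c0[%classic = 0%E.

Variables (p : nat) (S : 'M[R]_p) (P : probability (p.-tuple R * R)%type R).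
Hypothesis Sp : symmetric_posdef S.
Hypothesis Px : design_law Ll Lw S (pushforward P fst).

(* Dividing by [c0] makes the radial factor at least one in absolute value. *)
Definition whiten (x : p.-tuple R) : 'cV[R]_p := c0^-1 *: (invmx S *m vec x).

Lemma whiten_mxmeas : mxmeas whiten.
Proof.
apply: mxmeasZ => //; apply: mxmeasM; [exact: mxmeas_cst|exact: vec_mxmeas].
Qed.

(** A potential below one bounds both traces, and the size of [B] turns the second bound into
    [tr D^-2 <= r0 ^+ 2]. The shift at most doubles the Frobenius norm of the inverse, hence
    [2 * r0] in the arithmetic. *)
Lemma pot_step lam phi eta e1 B r0 (D : 'M[R]_p) :
  0 < lam -> 0 < B -> 0 < r0 -> r0 <= 4^-1 ->
  2 * (2 + `|nu - 3|) * r0 <= e1 -> 2 * lam * r0 <= e1 ->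
  0 <= eta -> 0 < e1 -> 0 <= phi ->
  eta + 2 * e1 <= (1 + phi + 4^-1)^-1 ->
  2 * (1 + (2 + `|nu - 3|)) <= lam * e1 ->
  expR (lam * phi) <= B * r0 ^+ 2 ->
  symmetric_posdef D -> pot lam phi B D < 1 ->
  symmetric_posdef (D - eta%:M) /\
  (\int[P]_z (pot lam phi B (D - eta%:M + whiten z.1 *m (whiten z.1)^T))%:E <=
    (pot lam phi B D)%:E)%E.
Proof.
move=> lam0 B0 r00 r04 Kr lr eta0 e10 phi0 etae lamK Br Dp Dlt.
have [P1 P2] := pot_lt1 lam0 phi0 (ltW B0) Dp Dlt.
have Q0 := posdef_inv Dp; have QT := psd_sym Q0.
set Phi := \tr (invmx D) in P1; set Psi := \tr (invmx D *m invmx D) in P2.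
have Psi0 : 0 <= Psi := psd_mxtrace_ge0 (psd_sqr Q0).
have Psir : Psi <= r0 ^+ 2 by rewrite -(ler_pM2l B0) (le_trans P2).
have inv1 : (1 + phi + 4^-1)^-1 <= 1 by rewrite invf_le1; lra.
have eta1 : eta <= 1 by lra.
have er0 : eta * r0 <= 2^-1.
  have : eta * r0 <= 1 * r0 by apply: ler_wpM2r => //; exact: ltW.
  lra.
have D1p : symmetric_posdef (D - eta%:M) by apply: (posdef_shift Dp r00 Psir); lra.
split=> //.
have [t1 t2 t3] := mxtrace_shift Dp r00 Psir eta0 er0.
have [d [T [Pr [X [mX iX lX wX intX]]]]] := design_integral Px.
have mpot : measurable_fun setT (fun x : p.-tuple R =>
    (pot lam phi B (D - eta%:M + whiten x *m (whiten x)^T))%:E).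
  apply/measurable_EFinP/measurable_pot; apply: mxmeasD; first exact: mxmeas_cst.
  by apply: mxmeasM; [|apply: mxmeas_tr]; exact: whiten_mxmeas.
have pot0 (x : p.-tuple R) :
    (0 <= (pot lam phi B (D - eta%:M + whiten x *m (whiten x)^T))%:E)%E.
  rewrite lee_fin ltW// pot_gt0 ?(ltW B0)//.
  by have := posdef_rank1 (whiten x) D1p ler01; rewrite scale1r.
rewrite (intX _ mpot pot0).
under eq_integral => t _.
  have -> : whiten (design_tuple S (X ^~ t)) = (X None t / c0) *: (\col_j X (Some j) t).
    rewrite /whiten vec_tuple -scalemxAr mulKmx ?posdef_unitmx// scalerA.
    by rewrite mulrC.
  rewrite linearZ /= -scalemxAl -scalemxAr scalerA -expr2.
  over.
have r20 : 0 <= 2 * r0 by lra.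
have T2r : \tr (invmx (D - eta%:M) *m invmx (D - eta%:M)) <= (2 * r0) ^+ 2.
  rewrite (le_trans t3)// exprMn; have -> : 2 ^+ 2 = 4 :> R by ring.
  by rewrite ler_pM2l.
have lr1 : lam * (2 * r0) <= 1 by lra.
apply: (le_trans (pot_expect_le mX iX lX wX Lw1 Lw2 Lw4 c0_gt0 Ll0 phi (ltW lam0) (ltW B0) r20 lr1 D1p T2r)).
rewrite lee_fin /pot -/Phi -/Psi.
have Q1 := posdef_inv D1p.
apply: (@step_arith lam B r0 phi eta e1) => //; try by rewrite ?addr_ge0.
- exact: psd_mxtrace_ge0.
- exact/psd_mxtrace_ge0/psd_sqr.
- exact/psd_mxtrace_ge0/psd_cube.
Qed.

End step.

(** * The stopped potential along a path of rank one updates *)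

Section barrier_path.
Context {R : realType} {p : nat}.
Variables (s eta lam phi B : R).
Implicit Types v : nat -> 'cV[R]_p.

Fixpoint barrier_mx v k : 'M[R]_p :=
  if k is j.+1 then barrier_mx v j - eta%:M + v j *m (v j)^T else s%:M.

(** Stage [k] tests the matrices of index [j < k] only, so whether the path continues beyond [k] is
    decided before the row [v k] is seen. *)
Fixpoint below_barrier v k : bool :=
  if k is j.+1 then below_barrier v j && (pot lam phi B (barrier_mx v j) < 1)
  else true.

(** After a stop the value is one, not the overshoot: this cannot raise the process, and it makes
    the process dominate the indicator of a stop. *)
Definition stopped_pot v k : R :=
  if below_barrier v k then pot lam phi B (barrier_mx v k) else 1.

Lemma barrier_mx_ext v v' k : (forall j, (j < k)%N -> v j = v' j) ->
  barrier_mx v k = barrier_mx v' k.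
Proof.
elim: k => //= k ih h; rewrite ih ?h// => j jk; apply: h; exact: ltnW.
Qed.

Lemma below_barrier_ext v v' k : (forall j, (j < k)%N -> v j = v' j) ->
  below_barrier v k = below_barrier v' k.
Proof.
elim: k => //= k ih h; rewrite ih => [|j jk]; last by apply: h; exact: ltnW.
by rewrite (@barrier_mx_ext v v')// => j jk; apply: h; exact: ltnW.
Qed.

Lemma barrier_mx_form v k u : dotv u (barrier_mx v k *m u) =
  (s - k%:R * eta) * dotv u u + \sum_(j < k) dotv (v j) u ^+ 2.
Proof.
elim: k => [|k ih] /=.
  by rewrite big_ord0 addr0 mul_scalar_mx dotvZr mul0r subr0.
rewrite big_ord_recr /= !mulmxDl mulNmx mul_scalar_mx !dotvDr dotvNr dotvZr ih.
have -> : dotv u (v k *m (v k)^T *m u) = dotv (v k) u ^+ 2.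
  rewrite -mulmxA outer_mul -[_%:M](scalemx1) -scalemxAr mulmx1 dotvZr.
  by rewrite (dotvC u) expr2.
by rewrite -[k.+1]addn1 natrD; ring.
Qed.

Section measurability.
Context {d : measure_display} {T : measurableType d}.
Variable v : T -> nat -> 'cV[R]_p.
Hypothesis mv : forall j, mxmeas (fun t => v t j).

Lemma measurable_barrier_mx k : mxmeas (fun t => barrier_mx (v t) k).
Proof.
elim: k => [|k ih] /=; first exact: mxmeas_cst.
apply: mxmeasD; first by apply: mxmeasB => //; exact: mxmeas_cst.
by apply: mxmeasM => //; exact: mxmeas_tr.
Qed.

Lemma measurable_below_barrier k :
  measurable_fun setT (fun t => below_barrier (v t) k).
Proof.
elim: k => [|k ih] /=; first exact: measurable_cst.
apply: measurable_and => //; apply: measurable_fun_ltr => //.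
by apply: measurable_pot; exact: measurable_barrier_mx.
Qed.

Lemma measurable_stopped_pot k :
  measurable_fun setT (fun t => stopped_pot (v t) k).
Proof.
apply: measurable_fun_ifT => //; first exact: measurable_below_barrier.
by apply: measurable_pot; exact: measurable_barrier_mx.
Qed.

End measurability.
End barrier_path.

Section smallest_eigenvalue.
Context {R : realType}.
Variables (Ll Lw : probability R R) (nu c0 : R).
Hypothesis Lw1 : has_mean Lw id 0.
Hypothesis Lw2 : has_mean Lw (fun s => s ^+ 2) 1.
Hypothesis Lw4 : has_mean Lw (fun s => s ^+ 4) nu.
Hypothesis c0_gt0 : 0 < c0.
Hypothesis Ll0 : Ll `]- c0, c0[%classic = 0%E.

Variables (p n : nat) (S : 'M[R]_p) (P : probability (p.-tuple R * R)%type R).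
Hypothesis Sp : symmetric_posdef S.
Hypothesis Px : design_law Ll Lw S (pushforward P fst).

Context {d : measure_display} {T : measurableType d}.
Variables (Pr : probability T R) (z : nat -> T -> p.-tuple R * R).
Hypothesis iid : iid_data Pr n z P.

Variables (lam phi eta e1 B r0 s : R).
Hypotheses (lam0 : 0 < lam) (B0 : 0 < B) (r00 : 0 < r0) (r04 : r0 <= 4^-1)
  (Kr : 2 * (2 + `|nu - 3|) * r0 <= e1) (lr : 2 * lam * r0 <= e1)
  (eta0 : 0 <= eta) (e10 : 0 < e1) (phi0 : 0 <= phi)
  (etae : eta + 2 * e1 <= (1 + phi + 4^-1)^-1)
  (lamK : 2 * (1 + (2 + `|nu - 3|)) <= lam * e1)
  (Br : expR (lam * phi) <= B * r0 ^+ 2) (s0 : 0 < s).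

(* The observations [2], ..., [n] only, so that the event that they are well
   conditioned is independent of the first observation. *)
Definition rows (h : 'I_n.+1 -> p.-tuple R * R) (j : nat) : 'cV[R]_p :=
  whiten c0 S (h (inord j.+2)).1.

Let X (i : 'I_n.+1) (w : T) := z i w.
Let good (v : nat -> 'cV[R]_p) k := below_barrier s eta lam phi B v k.
Let F (v : nat -> 'cV[R]_p) k := stopped_pot s eta lam phi B v k.

Lemma posdef_below_barrier v k : good v k -> symmetric_posdef (barrier_mx s eta v k).
Proof.
elim: k => [_|k ih /= /andP[gk lt1]].
  split; first by rewrite /= tr_scalar_mx.
  by move=> u u0; rewrite /= mul_scalar_mx dotvZr mulr_gt0// lt_def dotv_ge0 dotv_eq0 u0.
have [h _] := pot_step Lw1 Lw2 Lw4 c0_gt0 Ll0 Sp Px lam0 B0 r00 r04 Kr lr eta0 e10 phi0 etae lamK Br (ih gk) lt1.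
by have := posdef_rank1 (v k) h ler01; rewrite scale1r.
Qed.

Lemma stopped_pot_ge0 v k : 0 <= F v k.
Proof.
rewrite /F /stopped_pot; case: ifP => // gk.
by apply/ltW/pot_gt0; [exact: ltW|exact: posdef_below_barrier].
Qed.

Lemma rows_mxmeas dV (V : measurableType dV) (h : V -> 'I_n.+1 -> p.-tuple R * R) :
  (forall i, measurable_fun setT (h ^~ i)) ->
  forall j, mxmeas (fun t => rows (h t) j).
Proof.
move=> mh j a b; have mw := @whiten_mxmeas _ c0 _ S a b.
have m1 : measurable_fun setT (fun t => (h t (inord j.+2)).1).
  exact: (measurableT_comp (@measurable_fst _ _ _ _) (mh _)).
exact: (measurableT_comp mw m1).
Qed.

Let mX i : measurable_fun setT (X i). Proof. by have [/(_ i) []] := iid. Qed.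

(** The supermartingale property, with resampling of row [k] in the role of the conditional
    expectation: the decision to continue and the matrix of index [k] are frozen, and [pot_step]
    bounds the inner integral. *)
Lemma stopped_pot_decr k : (k < n.-1)%N ->
  (\int[Pr]_w (F (rows (X ^~ w)) k.+1)%:E <= \int[Pr]_w (F (rows (X ^~ w)) k)%:E)%E.
Proof.
(* Row [k] is the observation of index [k.+2]: index zero is outside the sample and the first
   observation is skipped. *)
move=> kn; pose i0 : 'I_n.+1 := inord k.+2.
have k2 : (k.+2 < n.+1)%N by case: n kn => // m; rewrite /= !ltnS.
have lawX A : measurable A -> Pr (X i0 @^-1` A) = P A.
  by have [/(_ i0) [_ h] _] := iid; exact: h.
have mG l : measurable_fun setT (fun t : #|'I_n.+1|.-tuple (p.-tuple R * R)%type =>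
    F (rows (fun i => tnth t (enum_rank i))) l).
  by apply: measurable_stopped_pot; apply: rows_mxmeas => i; exact: measurable_tnth.
have mF : mfam (fun h : 'I_n.+1 -> (p.-tuple R * R)%type => (F (rows h) k.+1)%:E).
  by apply/measurable_EFinP.
have [_ indX] := iid.
rewrite (resample_ge0 mX indX lawX _ mF); last first.
  by move=> h; rewrite lee_fin; exact: stopped_pot_ge0.
have mC l : measurable_fun setT (fun w => (F (rows (X^~ w)) l)%:E).
  apply/measurable_EFinP; apply: measurable_stopped_pot.
  by apply: rows_mxmeas => i; exact: mX.
apply: ge0_le_integral => //.
- by move=> w _; apply: integral_ge0 => x _; rewrite lee_fin; exact: stopped_pot_ge0.
- apply: (@measurable_fun_fubini_tonelli_F _ _ _ _ _ P (fun y : T * (p.-tuple R * R) => (F (rows (upd i0 (X ^~ y.1) y.2)) k.+1)%:E)).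
    exact: (mfam_upd i0 mX mF).
  by move=> y; exact: stopped_pot_ge0.
move=> w _; set v := rows (X ^~ w).
have ve x j : (j < k)%N -> rows (upd i0 (X ^~ w) x) j = v j.
  move=> jk; rewrite /v /rows /upd /i0; case: eqVneq => // e; exfalso.
  move: (congr1 val e); rewrite /= !inordK//; last by rewrite (leq_trans _ k2)// !ltnS ltnW.
  by case=> ej; rewrite ej ltnn in jk.
have vk x : rows (upd i0 (X ^~ w) x) k = whiten c0 S x.1.
  by rewrite /rows /upd eqxx.
have FE x : F (rows (upd i0 (X ^~ w) x)) k.+1 = if good v k.+1 then
    pot lam phi B (barrier_mx s eta v k - eta%:M + whiten c0 S x.1 *m (whiten c0 S x.1)^T) else 1.
  rewrite /F /stopped_pot /good /=.
  by rewrite (below_barrier_ext _ _ _ _ _ (ve x)) (barrier_mx_ext _ _ (ve x)) vk.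
under eq_integral do rewrite FE.
rewrite /F /stopped_pot -/(good v k) /good /= -/(good v k).
have [gk|gk] /= := boolP (good v k); last first.
  by rewrite integral_cst//= probability_setT mule1.
have [lt1|ge1] := boolP (_ < 1); last first.
  by rewrite integral_cst//= probability_setT mule1 lee_fin leNgt.
by have [_] := pot_step Lw1 Lw2 Lw4 c0_gt0 Ll0 Sp Px lam0 B0 r00 r04 Kr lr eta0 e10 phi0 etae lamK Br (posdef_below_barrier gk) lt1.
Qed.

(** The stopped potential dominates the indicator of a stop at or before the last test, so its mean
    bounds the probability directly, in place of a maximal inequality. *)
Lemma prob_not_below_barrier :
  measurable [set w | ~~ good (rows (X ^~ w)) n.-1] /\
  (Pr [set w | ~~ good (rows (X ^~ w)) n.-1] <= (pot lam phi B (s%:M : 'M[R]_p))%:E)%E.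
Proof.
have mr : forall j, mxmeas (fun w => rows (X ^~ w) j) by apply: rows_mxmeas => i; exact: mX.
have mg := measurable_below_barrier s eta lam phi B mr n.-1.
have mN : measurable [set w | ~~ good (rows (X ^~ w)) n.-1].
  have := measurable_neg mg measurableT (Y := [set true]).
  by rewrite setTI; apply.
split=> //.
have mF k : measurable_fun setT (fun w => (F (rows (X^~ w)) k)%:E).
  by apply/measurable_EFinP; exact: measurable_stopped_pot.
have F0 w k : (0 <= (F (rows (X^~ w)) k)%:E)%E by rewrite lee_fin stopped_pot_ge0.
have h k : (k <= n.-1)%N -> (\int[Pr]_w (F (rows (X ^~ w)) k)%:E <= (pot lam phi B (s%:M : 'M[R]_p))%:E)%E.
  elim: k => [_|k ih kn].
    by rewrite /F /stopped_pot /= integral_cst//= probability_setT mule1.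
  by rewrite (le_trans (stopped_pot_decr kn))// ih// ltnW.
apply: le_trans (h _ (leqnn _)).
have := integral_indic Pr measurableT mN; rewrite setIT => <-.
apply: ge0_le_integral => //.
  by apply/measurable_EFinP; exact: measurable_indic.
move=> w _; rewrite lee_fin indicE; case: (boolP (w \in _)) => [|_]; last first.
  exact: stopped_pot_ge0.
by rewrite inE /= => /negPf gw; rewrite /F /stopped_pot -/(good _ _) gw.
Qed.

End smallest_eigenvalue.

Section pot_start.
Context {R : realType}.

Lemma pot_scalar p (lam phi B s : R) : 0 < s ->
  pot lam phi B (s%:M : 'M[R]_p) =
  (1 + B * (p%:R / s ^+ 2)) * expR (lam * (p%:R / s - phi)).
Proof.
move=> s0; rewrite /pot (_ : invmx _ = (s^-1)%:M); last first.
  by apply: invmx_uniq; rewrite -scalar_mxM divff// gt_eqF.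
rewrite -scalar_mxM !mxtrace_scalar -[(_ * _) *+ p]mulr_natl -[s^-1 *+ p]mulr_natl.
by rewrite expr2 invfM.
Qed.

End pot_start.

Section smallest_eigenvalue_limit.
Context {R : realType}.

(** The threshold [n1] is chosen before the dimension and the law, so the bound is uniform over the
    class. The event is given as a Boolean function of the observations, not as a subset of [T], so
    that the first observation can be resampled inside it. *)
Lemma smallest_eigenvalue_lower_bound (C0 c0 k1 : R) (Ll Lw : probability R R) :
  0 < c0 -> admissible_Lw Lw -> admissible_Ll c0 Ll -> 0 <= k1 -> k1 < 1 ->
  exists2 del : R, 0 < del & forall eps : R, 0 < eps -> exists n1 : nat,
  forall (n p : nat) (P : probability (p.-tuple R * R)%type R) (th : params R p)
    (d : measure_display) (T : measurableType d) (Pr : probability T R)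
    (z : nat -> T -> p.-tuple R * R),
  (n1 <= n)%N -> (p%:R <= k1 * n.-1%:R) ->
  in_model Ll Lw C0 P th -> iid_data Pr n z P ->
  exists g : ('I_n.+1 -> p.-tuple R * R) -> bool,
  [/\ mfam g,
      forall h x, g (upd (inord 1) h x) = g h,
      forall h, g h -> forall u : 'cV[R]_p,
        del * n.-1%:R * dotv (Sigma_half th *m u) (Sigma_half th *m u) <=
        \sum_(j < n.-1) dotv (vec (h (inord j.+2)).1) u ^+ 2 &
      (Pr [set w | ~~ g (fun i : 'I_n.+1 => z i w)] <= eps%:E)%E].
Proof.
move=> c00 [Lwm Lwv /fourth_moment[nu Lw4]] [_ Ll0] k10 k11.
have Lw1 := standardized_mean Lwm Lwv; have Lw2 := standardized_sqr Lwm Lwv.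
(* The room for [eta] is [1 / (1 + phi + 1/4) = 2 (1 - k1) / (3 + k1)], which exceeds [s1] exactly
   because [k1 < 1]. The gap is [(1 - k1)^2 / (2 (3 + k1))], and [4 * e1 = (1 - k1)^2 / 8] fits into
   it. *)
pose s1 := (1 - k1) / 2; have s10 : 0 < s1 by rewrite /s1; lra.
pose e1 := (1 - k1) ^+ 2 / 32.
have e10 : 0 < e1 by rewrite /e1 divr_gt0// exprn_gt0//; lra.
pose phi := k1 / s1 + 4^-1.
have phi0 : 0 <= phi by rewrite addr_ge0// divr_ge0// ltW.
pose eta := s1 + 2 * e1.
have eta0 : 0 <= eta by rewrite /eta; lra.
have etae : eta + 2 * e1 <= (1 + phi + 4^-1)^-1.
  have -> : 1 + phi + 4^-1 = (3 + k1) / (2 * (1 - k1)).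
    by rewrite /phi /s1; field; lra.
  rewrite invf_div ler_pdivlMr; last lra.
  rewrite -subr_ge0.
  have -> : 2 * (1 - k1) - (eta + 2 * e1) * (3 + k1) = (1 - k1) ^+ 3 / 8.
    by rewrite /eta /s1 /e1; field.
  by rewrite divr_ge0// exprn_ge0// subr_ge0 ltW.
have e11 : e1 <= 1 by rewrite /e1 ler_pdivrMr//; nra.
(* The shifts exceed the start by [n.-1 * eta - s = 2 * e1 * n.-1], which the rank one updates must
   make up for; [c0 ^+ 2] undoes the scaling in [whiten]. *)
exists (c0 ^+ 2 * (2 * e1)).
  by rewrite mulr_gt0 ?exprn_gt0//; lra.
move=> eps eps0.
pose K := 2 + `|nu - 3|; have K0 : 0 < K by rewrite /K; have := normr_ge0 (nu - 3); lra.
(* The first summand is there for [lamK]. The second one makes the start small: the exponent is at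
   most [- lam / 4], and [2 * expR (- (lam / 4)) <= 2 / (1 + lam / 4) <= eps]. *)
pose lam := 2 * (1 + K) / e1 + 8 / eps.
have lam0 : 0 < lam by rewrite addr_gt0// divr_gt0//; lra.
have lamK : 2 * (1 + K) <= lam * e1.
  have -> : lam * e1 = 2 * (1 + K) + 8 / eps * e1.
    by rewrite /lam; field; rewrite !gt_eqF.
  rewrite lerDl; apply: mulr_ge0; [apply: divr_ge0 => //; exact: ltW|exact: ltW].
pose r0 := Num.min 4^-1 (Num.min (e1 / (2 * K)) (e1 / (2 * lam))).
have r00 : 0 < r0.
  by rewrite !lt_min; apply/and3P; split=> //; rewrite divr_gt0// mulr_gt0.
have r04 : r0 <= 4^-1 by rewrite ge_min lexx.
have Kr : 2 * K * r0 <= e1.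
  by rewrite mulrC -ler_pdivlMr ?mulr_gt0// !ge_min lexx orbT.
have lr : 2 * lam * r0 <= e1.
  by rewrite mulrC -ler_pdivlMr ?mulr_gt0// !ge_min lexx !orbT.
pose B := expR (lam * phi) / r0 ^+ 2.
have B0 : 0 < B by rewrite divr_gt0 ?expR_gt0 ?exprn_gt0.
have Br : expR (lam * phi) <= B * r0 ^+ 2 by rewrite divfK// gt_eqF// exprn_gt0.
(* [B] is large but free of [n], whereas [tr D^-2 = p / s^2] at the start is of order [1 / n]; from
   [N1] on their product is at most one. *)
have [N1 hN1] : exists N1 : nat, B * k1 / s1 ^+ 2 <= N1%:R.
  exists (Num.bound (B * k1 / s1 ^+ 2)); apply/ltW/archi_boundP.
  by apply: divr_ge0; [apply: mulr_ge0 => //; exact: ltW|exact: sqr_ge0].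
exists N1.+2 => n p P th d T Pr z n1n pk1 mod iid.
have N0 : (0 < n.-1)%N by case: n n1n {pk1 iid} => [//|[//|m]].
have NR : 0 < n.-1%:R :> R by rewrite ltr0n.
have NN1 : N1%:R <= n.-1%:R :> R by rewrite ler_nat; case: n n1n {pk1 iid N0 NR} => // m; rewrite /= ltnS => /ltnW.
pose s := s1 * n.-1%:R; have s0 : 0 < s by rewrite mulr_gt0.
have [Sp _] := Sigma_halfP mod.
pose rw := rows c0 (Sigma_half th) : ('I_n.+1 -> p.-tuple R * R) -> nat -> 'cV[R]_p.
exists (fun h => below_barrier s eta lam phi B (rw h) n.-1); split.
- apply: measurable_below_barrier; apply: rows_mxmeas => i.
  exact: measurable_tnth.
- move=> h x; apply: below_barrier_ext => j jn; rewrite /rw /rows /upd.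
  case: eqVneq => // /(congr1 val) /=; rewrite !inordK//; by case: n n1n jn {pk1 iid N0 NR NN1 s s0 rw h} => // -[].
- move=> h gh u; set v := Sigma_half th *m u.
  have := posdef_below_barrier Lw1 Lw2 Lw4 c00 Ll0 Sp (x_law mod) lam0 B0 r00 r04 Kr lr eta0 e10 phi0 etae lamK Br s0 gh.
  move=> /posdef_psd[_ /(_ v)]; rewrite barrier_mx_form => h1.
  have E j : dotv (rw h j) v = c0^-1 * dotv (vec (h (inord j.+2)).1) u.
    rewrite /rw /rows /whiten dotvZl dotvC dotv_mulmx (psd_sym (posdef_inv Sp)).
    by rewrite /v mulKmx ?posdef_unitmx// dotvC.
  have E2 : \sum_(j < n.-1) dotv (rw h j) v ^+ 2 =
      c0^-1 ^+ 2 * \sum_(j < n.-1) dotv (vec (h (inord j.+2)).1) u ^+ 2.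
    by rewrite mulr_sumr; apply: eq_bigr => j _; rewrite E exprMn.
  rewrite E2 in h1; have c2 : 0 < c0 ^+ 2 by rewrite exprn_gt0.
  have h2 : (n.-1%:R * eta - s) * dotv v v <= c0^-1 ^+ 2 * \sum_(j < n.-1) dotv (vec (h (inord j.+2)).1) u ^+ 2 by lra.
  rewrite exprVn -(ler_pM2l c2) mulVKf ?gt_eqF// in h2.
  apply: le_trans h2; rewrite le_eqVlt; apply/orP; left; apply/eqP.
  by rewrite /eta /s; ring.
- have [_] := prob_not_below_barrier Lw1 Lw2 Lw4 c00 Ll0 Sp (x_law mod) iid lam0 B0 r00 r04 Kr lr eta0 e10 phi0 etae lamK Br s0.
  move=> /le_trans; apply; rewrite lee_fin pot_scalar//.
  have a1 : B * (p%:R / s ^+ 2) <= 1.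
    rewrite (@le_trans _ _ (B * (k1 * n.-1%:R / s ^+ 2)))//.
      by rewrite ler_pM2l// ler_pM2r// invr_gt0 exprn_gt0.
    have -> : B * (k1 * n.-1%:R / s ^+ 2) = (B * k1 / s1 ^+ 2) / n.-1%:R.
      by rewrite /s; field; rewrite !gt_eqF.
    by rewrite ler_pdivrMr// mul1r (le_trans hN1).
  have a2 : lam * (p%:R / s - phi) <= - (lam / 4).
    have : p%:R / s <= k1 / s1.
      rewrite ler_pdivrMr// (le_trans pk1)// /s mulrA divfK// gt_eqF//.
    move=> q; have : lam * (p%:R / s - phi) <= lam * (- 4^-1).
      by rewrite ler_pM2l// /phi; lra.
    lra.
  have a3 : expR (lam * (p%:R / s - phi)) <= (1 + lam / 4)^-1.
    rewrite (@le_trans _ _ (expR (- (lam / 4))))// ?ler_expR//.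
    rewrite expRN lef_pV2 ?posrE ?expR_gt0 ?expR_ge1Dx//; lra.
  have a4 : (1 + lam / 4)^-1 <= eps / 2.
    rewrite -[leRHS]invrK lef_pV2 ?posrE ?invr_gt0 ?divr_gt0//; last by lra.
    have -> : (eps / 2)^-1 = (8 / eps) / 4 by field; rewrite gt_eqF.
    have : 0 <= 2 * (1 + K) / e1 by rewrite divr_ge0 ?ltW//; lra.
    rewrite /lam; lra.
  have a5 := expR_gt0 (lam * (p%:R / s - phi)).
  move: a1 a3 a5; set E := expR _ => a1 a3 a5.
  have : (1 + B * (p%:R / s ^+ 2)) * E <= 2 * E by rewrite ler_pM2r//; lra.
  lra.
Qed.

End smallest_eigenvalue_limit.

(** * Second moments of the design and of the residual *)

Section model_moments.
Context {R : realType} {p : nat}.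
Variables (Ll Lw : probability R R) (C0 c0 : R).
Variables (P : probability (p.-tuple R * R)%type R) (th : params R p).
Hypothesis adw : admissible_Lw Lw.
Hypothesis adl : admissible_Ll c0 Ll.
Hypothesis mod : in_model Ll Lw C0 P th.

Lemma design_second_moment (u : 'cV[R]_p) :
  (\int[P]_z (dotv (vec z.1) u ^+ 2)%:E)%E =
  (dotv (Sigma_half th *m u) (Sigma_half th *m u))%:E.
Proof.
have [Lwm Lwv _] := adw; have [Ll2 _] := adl.
have Lw1 := standardized_mean Lwm Lwv; have Lw2 := standardized_sqr Lwm Lwv.
have L2 : has_mean Ll (fun s => s ^+ 2) 1.
  apply: has_mean_ge0; [exact: measurable_funX|by move=> t; exact: sqr_ge0|].
  by move: Ll2; rewrite unlock.
have [Sp _] := Sigma_halfP mod.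
have [d [T [Pr [X [mX iX lX wX intX]]]]] := design_integral (x_law mod).
have mf : measurable_fun setT (fun x : p.-tuple R => (dotv (vec x) u ^+ 2)%:E).
  apply/measurable_EFinP/measurable_funX/measurable_dotv; last exact: mxmeas_cst.
  exact: vec_mxmeas.
rewrite (intX _ mf); last by move=> x; rewrite lee_fin sqr_ge0.
set a := Sigma_half th *m u.
have hm := has_mean_sum (index_enum 'I_p) (fun j => has_mean_sum (index_enum 'I_p)
  (fun k => has_meanZ (a j 0 * a k 0) (has_mean_scale_form mX iX lX wX Lw1 Lw2 j k L2))).
have e : forall t, \sum_(j <- index_enum 'I_p) \sum_(k <- index_enum 'I_p)
    a j 0 * a k 0 * (X None t ^+ 2 * (X (Some j) t * X (Some k) t)) =
    dotv (vec (design_tuple (Sigma_half th) (X^~ t))) u ^+ 2.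
  move=> t; rewrite vec_tuple dotvZl dotvC dotv_mulmx (psd_sym (posdef_psd Sp)) -/a.
  rewrite exprMn dotvE expr2 [X in _ = _ * X]mulr_suml mulr_sumr; apply: eq_bigr => j _.
  by rewrite mulr_sumr mulr_sumr; apply: eq_bigr => k _; rewrite !mxE; ring.
have [_] := eq_has_mean e hm.
move=> ->; congr (_%:E); rewrite dotvE; apply: eq_bigr => j _.
rewrite (bigD1 j)//= eqxx mulr1 big1 ?addr0// => k /negPf kj.
by rewrite eq_sym kj mulr0.
Qed.

(** The noise is not a function on the given space. The clause [y_conditional] on rectangles
    identifies [P] with the image of [P \x v_law th] under [f], and there Tonelli's theorem isolates
    the noise. *)
Lemma noise_second_moment :
  (\int[P]_z (((z.2 - mu th z.1) / sigma th) ^+ 2)%:E)%E = 1%E.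
Proof.
have s0 := sigma_gt0 mod; have mmu := mu_measurable mod.
pose f (y : (p.-tuple R * R) * R) : p.-tuple R * R := (y.1.1, mu th y.1.1 + sigma th * y.2).
have mf : measurable_fun setT f.
  apply: measurable_fun_pair; first exact: measurableT_comp.
  apply: measurable_funD; first by apply: measurableT_comp => //; exact: measurableT_comp.
  exact: measurable_funM.
pose mf' := isMeasurableFun.Build _ _ _ _ _ mf.
pose ff : {mfun ((p.-tuple R * R) * R)%type >-> (p.-tuple R * R)%type} := HB.pack f mf'.
pose P' := pushforward (P \x v_law th)%E ff.
have PP' A : measurable A -> P A = P' A.
  pose C : set (set (p.-tuple R * R)) :=
    [set C | exists A, measurable A /\ exists B, measurable B /\ C = A `*` B].
  move=> mA; apply: (measure_unique C (fun=> setT)) => //.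
  - rewrite measurable_prod_measurableType //; congr (<<s _ >>).
    rewrite predeqE; split => [[A' mA' [B mB <-]]|[A' [mA' [B [mB ->]]]]].
      by exists A'; split => //; exists B.
    by exists A' => //; exists B.
  - move=> _ _ [X1 [mX1 [X2 [mX2 ->]]]] [Y1 [mY1 [Y2 [mY2 ->]]]].
    rewrite -setXI; exists (X1 `&` Y1); split; first exact: measurableI.
    by exists (X2 `&` Y2); split => //; exact: measurableI.
  - by move=> _; exists setT; split => //; exists setT; split => //; rewrite setXTT.
  - by apply/seteqP; split => // x _; exists 0%N.
  - move=> _ [A1 [mA1 [B1 [mB1 ->]]]].
    apply: (etrans (y_conditional mod mA1 mB1)); rewrite /P' /pushforward /= /product_measure1 /=.
    rewrite integral_mkcond; apply: eq_integral => y _; rewrite patchE /=.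
    rewrite xsectionE /f; case: ifPn => h.
      congr (v_law th _); move: h; rewrite inE => -[/= h _].
      by apply/seteqP; split => [v hv|v [] //]; split.
    rewrite [X in v_law th X](_ : _ = set0) ?measure0//; apply/seteqP; split => // v [/= h1 h2].
    by move: h; rewrite notin_setE; apply; split.
  - by move=> _; apply: (le_lt_trans (probability_le1 P measurableT)); rewrite ltry.
have mg : measurable_fun setT (fun z : p.-tuple R * R => (((z.2 - mu th z.1) / sigma th) ^+ 2)%:E).
  apply/measurable_EFinP/measurable_funX/measurable_funM => //.
  by apply: measurable_funB => //; exact: measurableT_comp.
rewrite (eq_measure_integral P'); last by move=> A mA _; exact: PP'.
rewrite ge0_integral_pushforward//=; last by move=> y _; rewrite lee_fin sqr_ge0.
rewrite fubini_tonelli1/=; last 2 first.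
- exact: (measurableT_comp mg mf).
- by move=> y; rewrite lee_fin sqr_ge0.
have [_ v2] := standardized_sqr (v_mean mod) (v_var mod).
under eq_integral => y _.
  rewrite (_ : fubini_F _ _ _ = 1%E).
  over.
  rewrite /fubini_F -v2; apply: eq_integral => v _ /=.
  by congr (_%:E); rewrite addrC addKr mulrC mulKf// gt_eqF.
by rewrite integral_cst//= probability_setT mule1.
Qed.

(** The residual is misspecification plus noise; the cross term is absorbed by
    [(a + b)^2 <= 2 a^2 + 2 b^2], hence the factors two. *)
Lemma residual_second_moment (beta : 'cV[R]_p) (K : R) :
  (misspecification P th beta <= K%:E)%E ->
  (\int[P]_z (((z.2 - dotv (vec z.1) beta) / sigma th) ^+ 2)%:E <= (2 * K + 2)%:E)%E.
Proof.
rewrite /misspecification unlock => hK.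
have mmu := mu_measurable mod.
have mv : measurable_fun setT (fun z : p.-tuple R * R => dotv (vec z.1) beta).
  apply: measurable_dotv; last exact: mxmeas_cst.
  by move=> i j; apply: (measurableT_comp (vec_mxmeas i j)).
have m1 : measurable_fun setT (fun z : p.-tuple R * R => (((mu th z.1 - dotv (vec z.1) beta) / sigma th) ^+ 2)).
  apply/measurable_funX/measurable_funM => //.
  by apply: measurable_funB => //; exact: measurableT_comp.
have m2 : measurable_fun setT (fun z : p.-tuple R * R => ((z.2 - mu th z.1) / sigma th) ^+ 2).
  apply/measurable_funX/measurable_funM => //.
  by apply: measurable_funB => //; exact: measurableT_comp.
apply: (@le_trans _ _ (\int[P]_z (2%:E * (((mu th z.1 - dotv (vec z.1) beta) / sigma th) ^+ 2)%:E
   + 2%:E * (((z.2 - mu th z.1) / sigma th) ^+ 2)%:E))%E).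
  apply: ge0_le_integral => //.
  - by move=> z _; rewrite lee_fin sqr_ge0.
  - apply/measurable_EFinP/measurable_funX/measurable_funM => //.
    exact: measurable_funB.
  - by apply: emeasurable_funD; apply: emeasurable_funM => //; exact/measurable_EFinP.
  move=> z _; rewrite -!EFinM -EFinD lee_fin.
  set a := (mu _ _ - _) / _; set b := (z.2 - mu _ _) / _.
  have -> : (z.2 - dotv (vec z.1) beta) / sigma th = a + b by rewrite /a /b; ring.
  have := sqr_ge0 (a - b); nra.
rewrite ge0_integralD//; last 4 first.
- by move=> z _; rewrite -EFinM lee_fin mulr_ge0// sqr_ge0.
- by apply: emeasurable_funM => //; exact/measurable_EFinP.
- by move=> z _; rewrite -EFinM lee_fin mulr_ge0// sqr_ge0.
- by apply: emeasurable_funM => //; exact/measurable_EFinP.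
have Z2 (f : p.-tuple R * R -> R) : measurable_fun setT f -> (forall z, 0 <= f z) ->
    (\int[P]_z (2%:E * (f z)%:E) = 2%:E * \int[P]_z (f z)%:E)%E.
  move=> mf f0; rewrite ge0_integralZl//; first exact/measurable_EFinP.
  by move=> z _; rewrite lee_fin.
rewrite Z2//; last by move=> z; exact: sqr_ge0.
rewrite Z2//; last by move=> z; exact: sqr_ge0.
by rewrite noise_second_moment mule1 [leRHS]EFinD EFinM leeD2r// lee_pmul2l.
Qed.

End model_moments.

(** * Deterministic bounds for least squares and James-Stein *)

Section least_squares.
Context {R : realType}.

Lemma moore_penrose_unit p (G : 'M[R]_p) : G \in unitmx -> moore_penrose G = invmx G.
Proof.
move=> uG; apply: (penrose_uniq (moore_penroseP G)).
by split; rewrite ?mulmxV ?mulVmx ?mul1mx ?trmx1.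
Qed.

Section one_sample.
Context {m p : nat}.
Variables (X : 'M[R]_(m, p)) (Y : 'cV[R]_m) (S : 'M[R]_p) (d1 : R).
Hypothesis Sp : symmetric_posdef S.
Hypothesis d10 : 0 < d1.
Hypothesis coercive : forall u, d1 * dotv (S *m u) (S *m u) <= dotv (X *m u) (X *m u).

Let b := ols X Y.

Definition rss := dotv (Y - X *m ols X Y) (Y - X *m ols X Y).

Lemma posdef_mul_eq0 u : dotv (S *m u) (S *m u) = 0 -> u = 0.
Proof.
move/eqP; rewrite dotv_eq0 => /eqP Su.
by rewrite -(mulKmx (posdef_unitmx Sp) u) Su mulmx0.
Qed.

Lemma gram_posdef : symmetric_posdef (X^T *m X).
Proof.
split; first by rewrite trmx_mul trmxK.
move=> v v0; rewrite -mulmxA dotv_mulmx trmxK.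
apply: lt_le_trans (coercive v); rewrite mulr_gt0// lt_def dotv_ge0 andbT.
by apply: contra_neq v0; exact: posdef_mul_eq0.
Qed.

Lemma ols_normal : X^T *m (Y - X *m b) = 0.
Proof.
have uG := posdef_unitmx gram_posdef.
rewrite mulmxBr /b /ols (moore_penrose_unit uG) -!mulmxA (mulmxA X^T X).
by rewrite mulKVmx// subrr.
Qed.

Lemma ols_pythagoras (v : 'cV[R]_p) :
  dotv (Y - X *m v) (Y - X *m v) = rss + dotv (X *m (b - v)) (X *m (b - v)).
Proof.
have -> : Y - X *m v = (Y - X *m b) + X *m (b - v).
  by rewrite mulmxBr addrA subrK.
have orth : dotv (Y - X *m b) (X *m (b - v)) = 0.
  by rewrite dotv_mulmx ols_normal dotv0l.
have G (e f : 'cV[R]_m) : dotv e f = 0 -> dotv (e + f) (e + f) = dotv e e + dotv f f.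
  by move=> ef; rewrite dotvDl !dotvDr (dotvC f e) ef addr0 add0r.
exact: G.
Qed.

Lemma rss_ge0 : 0 <= rss. Proof. exact: dotv_ge0. Qed.

Lemma rss_le v : rss <= dotv (Y - X *m v) (Y - X *m v).
Proof. by rewrite ols_pythagoras lerDl dotv_ge0. Qed.

Lemma ols_error_le v :
  d1 * dotv (S *m (b - v)) (S *m (b - v)) <= dotv (Y - X *m v) (Y - X *m v).
Proof.
by rewrite (le_trans (coercive _))// ols_pythagoras lerDr rss_ge0.
Qed.

(** [tau] stands for [c * p * sigma2_hat] and [s] for the squared length of the fitted values. *)
Definition js_weight (tau s : R) := if 0 < s then Num.max (1 - tau / s) 0 else 0.

Lemma james_steinE c : james_stein c X Y =
  js_weight (c * p%:R * (rss / (m%:R - p%:R))) (dotv (X *m b) (X *m b)) *: b.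
Proof.
rewrite /james_stein /js_weight -/b /sigma2_hat norm2_sqr -/rss.
have -> : (b^T *m X^T *m X *m b) 0 0 = dotv (X *m b) (X *m b).
  by rewrite /dotv (trmx_mul X b) !mulmxA.
by case: ifP => // _; rewrite scale0r.
Qed.

End one_sample.

Lemma js_weight_ge0 (tau s : R) : 0 <= js_weight tau s.
Proof. by rewrite /js_weight; case: ifP => // _; rewrite le_max lexx orbT. Qed.

Lemma js_weight_le1 (tau s : R) : 0 <= tau -> js_weight tau s <= 1.
Proof.
move=> t0; rewrite /js_weight; case: ifP => // s0.
by rewrite ge_max ler01 andbT gerBl divr_ge0// ltW.
Qed.

(** Multiplying by [s] merges the positive part and the degenerate case into one minimum; later
    estimates of the weight start from this identity. *)
Lemma js_weightE (tau s : R) : 0 <= tau -> 0 <= s ->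
  s * js_weight tau s = s - Num.min tau s.
Proof.
move=> t0 s0; rewrite /js_weight; case: ifPn => [sp|].
  have [ts|ts] := leP tau s.
    rewrite max_l; last by rewrite subr_ge0 ler_pdivrMr// mul1r.
    by rewrite mulrBr mulr1 mulrCA divff ?mulr1// gt_eqF.
  rewrite max_r; first by rewrite mulr0 subrr.
  by rewrite subr_le0 ler_pdivlMr// mul1r ltW.
rewrite -leNgt => s1; have -> : s = 0 by apply/eqP; rewrite eq_le s1.
by rewrite min_r// mul0r subr0.
Qed.

Lemma js_weight_sqr (tau s : R) : 0 <= tau -> 0 <= s ->
  (1 - js_weight tau s) ^+ 2 * s <= tau.
Proof.
move=> t0 s0; have w0 := js_weight_ge0 tau s; have w1 := js_weight_le1 s t0.
have E := js_weightE t0 s0; have m1 : Num.min tau s <= tau by rewrite ge_min lexx.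
set w := js_weight tau s in w0 w1 E *.
have : (1 - w) * ((1 - w) * s) <= 1 * ((1 - w) * s).
  by apply: ler_wpM2r; [rewrite mulr_ge0// subr_ge0|lra].
lra.
Qed.

Lemma norm2_sqrt_le p (v : 'cV[R]_p) (a : R) : 0 <= a -> dotv v v <= a ->
  norm2 v <= Num.sqrt a.
Proof. by move=> a0 h; rewrite norm2E ler_sqrt. Qed.

(** The error is that of least squares minus the shrinkage [(1 - w) *: b]. By [js_weight_sqr] the
    shrinkage has squared fitted length at most [tau], whatever the size of [beta]. *)
Lemma james_stein_error_le m p (X : 'M[R]_(m, p)) Y (S : 'M[R]_p) d1 c beta :
  symmetric_posdef S -> 0 < d1 -> (p < m)%N -> 0 <= c <= 1 ->
  (forall u, d1 * dotv (S *m u) (S *m u) <= dotv (X *m u) (X *m u)) ->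
  let U := dotv (Y - X *m beta) (Y - X *m beta) in
  is_true (norm2 (S *m (james_stein c X Y - beta)) <=
  Num.sqrt (U / d1) + Num.sqrt (p%:R / (m%:R - p%:R) * U / d1)).
Proof.
move=> Sp d10 pm /andP[c0 c1] H U.
rewrite james_steinE.
set b := ols X Y; set tau := c * _ * _; set s := dotv _ _; set w := js_weight _ _.
have mp0 : 0 < m%:R - p%:R :> R by rewrite subr_gt0 ltr_nat.
have U0 : 0 <= U by exact: dotv_ge0.
have r0 := rss_ge0 X Y; have rU : rss X Y <= U by exact: (rss_le Y Sp d10 H).
have tau0 : 0 <= tau by rewrite !mulr_ge0// invr_ge0 ltW.
have tauU : tau <= p%:R / (m%:R - p%:R) * U.
  have -> : tau = c * (p%:R / (m%:R - p%:R) * rss X Y) by rewrite /tau; ring.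
  rewrite (@le_trans _ _ (1 * (p%:R / (m%:R - p%:R) * rss X Y)))//.
    by rewrite ler_wpM2r// mulr_ge0// divr_ge0// ltW.
  by rewrite mul1r ler_wpM2l// divr_ge0// ltW.
have s0 : 0 <= s by exact: dotv_ge0.
have -> : S *m (w *: b - beta) = S *m (b - beta) - (1 - w) *: (S *m b).
  by rewrite !mulmxBr -scalemxAr scalerBl scale1r opprB [RHS]addrC addrA subrK.
rewrite (le_trans (norm2D _ _))// norm2N lerD//.
  apply: norm2_sqrt_le; first by rewrite divr_ge0// ltW.
  by rewrite ler_pdivlMr// mulrC; exact: (ols_error_le Y Sp d10 H).
apply: norm2_sqrt_le.
  apply: divr_ge0; last exact: ltW.
  by apply: mulr_ge0 => //; apply: divr_ge0 => //; exact: ltW.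
rewrite dotvZl dotvZr mulrA -expr2 ler_pdivlMr//.
apply: le_trans tauU; apply: le_trans (js_weight_sqr tau0 s0).
rewrite -mulrA ler_wpM2l ?sqr_ge0// mulrC; exact: H.
Qed.

Lemma min_sub_le (t t' s : R) : t' <= t ->
  0 <= Num.min t s - Num.min t' s <= t - t'.
Proof.
by move=> tt; rewrite /Num.min; case: ltP => h1; case: ltP => h2; apply/andP; split; lra.
Qed.

(* [r * js_weight tau (r ^+ 2)] is [(r - tau / r)_+]. *)
Lemma js_radial_tau (t t' r : R) : 0 <= t' -> t' <= t -> 0 <= r ->
  0 <= r * js_weight t' (r ^+ 2) - r * js_weight t (r ^+ 2) <= Num.sqrt (t - t').
Proof.
move=> t'0 tt r0; have t0 : 0 <= t by exact: le_trans tt.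
have [->|r1] := eqVneq r 0; first by rewrite !mul0r subrr lexx sqrtr_ge0.
have rp : 0 < r by rewrite lt_def r1.
have E1 := js_weightE t0 (sqr_ge0 r); have E2 := js_weightE t'0 (sqr_ge0 r).
have /andP[m1 m2] := min_sub_le (r ^+ 2) tt.
have m3 : 0 <= Num.min t' (r ^+ 2) by rewrite le_min t'0 sqr_ge0.
have m4 : Num.min t (r ^+ 2) <= r ^+ 2 by rewrite ge_min lexx orbT.
set x := r * js_weight t' _ - r * js_weight t _.
have xE : r * x = Num.min t (r ^+ 2) - Num.min t' (r ^+ 2).
  have -> : r * x = r ^+ 2 * js_weight t' (r ^+ 2) - r ^+ 2 * js_weight t (r ^+ 2).
    by rewrite /x; ring.
  rewrite E1 E2; ring.
have x0 : 0 <= x by rewrite -(pmulr_rge0 _ rp) xE.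
(* [x <= r] gives [x ^+ 2 <= r * x], and [r * x] is a difference of minima, at most [t - t']; hence
   the square root. *)
rewrite x0 /= -[leLHS]ger0_norm// -sqrtr_sqr ler_sqrt ?subr_ge0//.
apply: le_trans m2; rewrite -xE expr2 ler_wpM2r//.
by rewrite -(ler_pM2l rp) xE; move: m4; rewrite expr2; lra.
Qed.

(** Where [r - t / r] is positive its derivative [1 + t / r^2] is at most two, as [t <= r^2]
    there. *)
Lemma js_radial_r (t r r' : R) : 0 <= t -> 0 <= r' -> r' <= r ->
  `|r * js_weight t (r ^+ 2) - r' * js_weight t (r' ^+ 2)| <= 2 * (r - r').
Proof.
move=> t0 r'0 rr; have r0 : 0 <= r by exact: le_trans rr.
have [z|r1] := eqVneq r 0.
  have -> : r' = 0 by apply/eqP; rewrite eq_le r'0 -z rr.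
  by rewrite z !mul0r subrr normr0 mulr0.
have rp : 0 < r by rewrite lt_def r1.
have E1 := js_weightE t0 (sqr_ge0 r); have E2 := js_weightE t0 (sqr_ge0 r').
have w0 := js_weight_ge0 t (r ^+ 2); have w0' := js_weight_ge0 t (r' ^+ 2).
have w1 := js_weight_le1 (r ^+ 2) t0; have w1' := js_weight_le1 (r' ^+ 2) t0.
set w := js_weight t (r ^+ 2) in E1 w0 w1 *; set w' := js_weight t (r' ^+ 2) in E2 w0' w1' *.
have rr2 : r' ^+ 2 <= r ^+ 2 by rewrite ler_sqr.
have [tr'|tr'] := leP t (r' ^+ 2).
  rewrite (min_l tr') in E2; rewrite (min_l (le_trans tr' rr2)) in E1.
  have [z|z] := eqVneq r' 0.
    rewrite z mul0r subr0 subr0 ger0_norm ?mulr_ge0//.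
    have := mulr_ge0 r0 (_ : 0 <= 1 - w); rewrite subr_ge0 => /(_ w1); lra.
  have r'p : 0 < r' by rewrite lt_def z.
  have F1 : r * w = r - t / r.
    by apply: (mulfI (lt0r_neq0 rp)); rewrite mulrA -expr2 E1; field.
  have F2 : r' * w' = r' - t / r'.
    by apply: (mulfI (lt0r_neq0 r'p)); rewrite mulrA -expr2 E2; field.
  have q1 : 0 <= t / (r * r') <= 1.
    rewrite divr_ge0 ?mulr_ge0//= ler_pdivrMr ?mulr_gt0// mul1r (le_trans tr')//.
    by rewrite expr2 ler_wpM2r.
  have -> : r * w - r' * w' = (r - r') * (1 + t / (r * r')).
    by rewrite F1 F2; field; rewrite r1 z.
  have rr0 : 0 <= r - r' by rewrite subr_ge0.
  case/andP: q1 => q0 q1; rewrite ger0_norm; last by rewrite mulr_ge0// addr_ge0.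
  rewrite mulrC ler_wpM2r//; lra.
rewrite (min_r (ltW tr')) subrr in E2.
have -> : r' * w' = 0.
  move/eqP: E2; rewrite mulf_eq0 sqrf_eq0 => /orP[/eqP->|/eqP->]; by rewrite ?mul0r ?mulr0.
rewrite subr0 ger0_norm ?mulr_ge0//.
have [tr|tr] := leP t (r ^+ 2); last first.
  rewrite (min_r (ltW tr)) subrr in E1.
  move/eqP: E1; rewrite mulf_eq0 sqrf_eq0 (negPf r1) => /eqP ->.
  by rewrite mulr0 mulr_ge0// subr_ge0.
rewrite (min_l tr) in E1.
have : r * (r * w) <= r * (2 * (r - r')).
  rewrite mulrA -expr2 E1; nra.
by rewrite ler_pM2l.
Qed.

(** The factor [r'] tames the weight, which by itself can vary fast near zero. The comparison
    changes [r] at fixed [t], then [t] at fixed [r']; exchanging [r] and [r'] in front of the weight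
    costs one more [|r - r'|], which makes three. *)
Lemma js_weight_diff (t t' r r' : R) : 0 <= t -> 0 <= t' -> 0 <= r -> 0 <= r' ->
  `|js_weight t (r ^+ 2) - js_weight t' (r' ^+ 2)| * r' <=
  3 * `|r - r'| + Num.sqrt `|t - t'|.
Proof.
move=> t0 t'0 r0 r'0.
have w0 := js_weight_ge0 t (r ^+ 2); have w1 := js_weight_le1 (r ^+ 2) t0.
have h1 : `|r * js_weight t (r ^+ 2) - r' * js_weight t (r' ^+ 2)| <= 2 * `|r - r'|.
  have [rr|rr] := leP r' r.
    have -> : `|r - r'| = r - r' by rewrite ger0_norm// subr_ge0.
    exact: js_radial_r.
  have -> : `|r - r'| = r' - r by rewrite distrC ger0_norm// subr_ge0 ltW.
  by rewrite distrC; apply: js_radial_r => //; exact: ltW.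
have h2 : `|r' * js_weight t (r' ^+ 2) - r' * js_weight t' (r' ^+ 2)| <= Num.sqrt `|t - t'|.
  have [tt|tt] := leP t' t.
    have /andP[a1 a2] := js_radial_tau t'0 tt r'0.
    have -> : `|t - t'| = t - t' by rewrite ger0_norm// subr_ge0.
    by rewrite distrC ger0_norm.
  have /andP[a1 a2] := js_radial_tau t0 (ltW tt) r'0.
  have -> : `|t - t'| = t' - t by rewrite distrC ger0_norm// subr_ge0 ltW.
  by rewrite ger0_norm.
set w := js_weight t (r ^+ 2) in w0 w1 h1 *; set w' := js_weight t' (r' ^+ 2) in h2 *.
set w'' := js_weight t (r' ^+ 2) in h1 h2.
rewrite -{1}(ger0_norm r'0) -normrM.
have -> : (w - w') * r' = (r * w - r' * w'') + ((r' * w'' - r' * w') + w * (r' - r)) by ring.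
rewrite (le_trans (ler_normD _ _))//.
have := ler_normD (r' * w'' - r' * w') (w * (r' - r)).
have : `|w * (r' - r)| <= `|r - r'|.
  by rewrite normrM (ger0_norm w0) distrC ler_piMl.
lra.
Qed.

End least_squares.

(** * Stability under removal of one observation, deterministic part *)

Section leave_one_out.
Context {R : realType} {m m' p : nat}.
Variables (X : 'M[R]_(m, p)) (Y : 'cV[R]_m) (X' : 'M[R]_(m', p)) (Y' : 'cV[R]_m').
Variables (x : 'cV[R]_p) (y : R) (S : 'M[R]_p) (d1 : R) (c : R) (beta : 'cV[R]_p).
Hypothesis Sp : symmetric_posdef S.
Hypothesis d10 : 0 < d1.
Hypothesis coercive' : forall u, d1 * dotv (S *m u) (S *m u) <= dotv (X' *m u) (X' *m u).
Hypothesis XE : forall v, dotv (X *m v) (X *m v) = dotv x v ^+ 2 + dotv (X' *m v) (X' *m v).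
Hypothesis YE : forall v, dotv (Y - X *m v) (Y - X *m v) =
  (y - dotv x v) ^+ 2 + dotv (Y' - X' *m v) (Y' - X' *m v).
Hypothesis mE : m%:R = m'%:R + 1 :> R.
Hypothesis pm : (p < m')%N.
Hypothesis c01 : 0 <= c <= 1.

Let b := ols X Y.
Let b' := ols X' Y'.
Let e := y - dotv x b'.
Let q := dotv x b'.
Let U := dotv (Y - X *m beta) (Y - X *m beta).
Let Q := p%:R / (m'%:R - p%:R) : R.

Lemma coercive_full u : d1 * dotv (S *m u) (S *m u) <= dotv (X *m u) (X *m u).
Proof. by rewrite (le_trans (coercive' u))// XE lerDr sqr_ge0. Qed.

Let H := coercive_full.

Let pyth v : dotv (Y - X *m v) (Y - X *m v) = rss X Y + dotv (X *m (b - v)) (X *m (b - v)).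
Proof. exact: (ols_pythagoras Y Sp d10 H). Qed.

Let pyth' v : dotv (Y' - X' *m v) (Y' - X' *m v) = rss X' Y' + dotv (X' *m (b' - v)) (X' *m (b' - v)).
Proof. exact: (ols_pythagoras Y' Sp d10 coercive'). Qed.

Let rss_loo : rss X' Y' <= rss X Y.
Proof.
have E : rss X Y = (y - dotv x b) ^+ 2 + (rss X' Y' + dotv (X' *m (b' - b)) (X' *m (b' - b))).
  by rewrite -pyth'; exact: YE.
have := dotv_ge0 (X' *m (b' - b)); have := sqr_ge0 (y - dotv x b); lra.
Qed.

Let full_at_loo : rss X Y + dotv (X *m (b - b')) (X *m (b - b')) = e ^+ 2 + rss X' Y'.
Proof. by rewrite -pyth YE. Qed.

(** At [b'] the full residual sum of squares is [e ^+ 2 + rss X' Y'], and [rss X' Y' <= rss X Y]; so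
    its excess over the minimum, which Pythagoras identifies with the left side, is at most
    [e ^+ 2]. *)
Let ols_diff : dotv (X *m (b - b')) (X *m (b - b')) <= e ^+ 2.
Proof. have := full_at_loo; have := rss_loo; lra. Qed.

Let mp' : 0 < m'%:R - p%:R :> R. Proof. by rewrite subr_gt0 ltr_nat. Qed.

Let Q0 : 0 <= Q. Proof. by rewrite divr_ge0// ltW. Qed.

Let U0 : 0 <= U. Proof. exact: dotv_ge0. Qed.

Let U_loo : rss X' Y' <= U.
Proof.
rewrite /U YE pyth'; have := dotv_ge0 (X' *m (b' - beta)).
have := sqr_ge0 (y - dotv x beta); lra.
Qed.

Let U_full : rss X Y <= U.
Proof. by rewrite /U pyth lerDl dotv_ge0. Qed.

Let tau := c * p%:R * (rss X Y / (m%:R - p%:R)).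
Let tau' := c * p%:R * (rss X' Y' / (m'%:R - p%:R)).

Let inv_mp : (m%:R - p%:R)^-1 <= (m'%:R - p%:R)^-1 :> R.
Proof. by have h := mp'; rewrite lef_pV2 ?posrE ?mE//; lra. Qed.

Let mp : 0 < m%:R - p%:R :> R. Proof. by have h := mp'; rewrite mE; lra. Qed.

Let tau0 : 0 <= tau.
Proof.
case/andP: c01 => c0 _; rewrite !mulr_ge0 ?rss_ge0// invr_ge0; exact: ltW.
Qed.

Let tau'0 : 0 <= tau'.
Proof.
case/andP: c01 => c0 _; rewrite !mulr_ge0 ?rss_ge0// invr_ge0; exact: ltW.
Qed.

Let scale_le (a t : R) : 0 <= a -> a <= t -> c * a <= t.
Proof.
case/andP: c01 => c0 c1 a0 at_; have : c * a <= 1 * a by rewrite ler_wpM2r.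
lra.
Qed.

Let tau_le : tau <= Q * U.
Proof.
rewrite /tau -mulrA; apply: scale_le.
  by rewrite mulr_ge0// divr_ge0 ?rss_ge0// ltW.
rewrite /Q -mulrA ler_wpM2l// mulrC; apply: ler_pM => //; [|exact: rss_ge0].
by rewrite invr_ge0 ltW.
Qed.

Let tau'_le : tau' <= Q * U.
Proof.
rewrite /tau' -mulrA; apply: scale_le.
  by rewrite mulr_ge0// divr_ge0 ?rss_ge0// ltW.
rewrite /Q -mulrA ler_wpM2l// mulrC ler_wpM2l// invr_ge0 ltW//.
Qed.

(** Two effects: the residual sum of squares changes by at most [e ^+ 2], and the degrees of freedom
    change by one, which accounts for the term with [U]. *)
Let tau_diff : `|tau - tau'| <= Q * (e ^+ 2 + U / (m'%:R - p%:R)).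
Proof.
case/andP: c01 => c0 c1.
pose i := (m%:R - p%:R)^-1 : R; pose i' := (m'%:R - p%:R)^-1 : R.
have i0 : 0 < i by rewrite invr_gt0.
have i'0 : 0 < i' by rewrite invr_gt0.
have iE : i' - i = i * i'.
  by have h := mp'; rewrite /i /i' mE; field; rewrite !gt_eqF//; lra.
have -> : tau - tau' = c * (p%:R * ((rss X Y - rss X' Y') * i - rss X' Y' * (i * i'))).
  by rewrite -iE /tau /tau' -/i -/i'; ring.
rewrite normrM (ger0_norm c0); apply: scale_le => //.
rewrite normrM (ger0_norm (ler0n _ _)) /Q -/i' -mulrA ler_wpM2l//.
have r1 : 0 <= rss X Y - rss X' Y' by rewrite subr_ge0.
have r2 : rss X Y - rss X' Y' <= e ^+ 2.
  have := full_at_loo; have := dotv_ge0 (X *m (b - b')); lra.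
have a1 : (rss X Y - rss X' Y') * i <= e ^+ 2 * i' by apply: ler_pM => //; exact: ltW.
have a2 : rss X' Y' * (i * i') <= U * (i' * i').
  apply: ler_pM => //; first exact: rss_ge0; first by rewrite mulr_ge0// ltW.
  by rewrite ler_wpM2r// ltW.
have a3 : 0 <= (rss X Y - rss X' Y') * i by rewrite mulr_ge0// ltW.
have a4 : 0 <= rss X' Y' * (i * i') by rewrite mulr_ge0 ?rss_ge0// mulr_ge0// ltW.
rewrite ler_norml; apply/andP; split; lra.
Qed.

Let r := norm2 (X *m b).
Let r' := norm2 (X' *m b').

Let r_diff : `|r - r'| <= `|e| + `|q|.
Proof.
(* The intermediate length separates the change of estimator, which costs [|e|], from the removal of
   the row, which costs [|q|]. *)
pose r'' := norm2 (X *m b').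
have h0 : norm2 (X *m (b - b')) <= `|e|.
  by rewrite -sqrtr_sqr; apply: norm2_sqrt_le => //; exact: sqr_ge0.
have h1 : `|r - r''| <= `|e|.
  have n1 : r <= r'' + norm2 (X *m (b - b')).
    rewrite /r -{1}[b](subrK b') mulmxDr addrC; exact: norm2D.
  have n2 : r'' <= r + norm2 (X *m (b - b')).
    have E2 : X *m b' = X *m b - X *m (b - b') by rewrite mulmxBr opprB addrC subrK.
    by rewrite /r'' [X in norm2 X <= _]E2 (le_trans (norm2D _ _))// norm2N.
  rewrite ler_norml; apply/andP; split; lra.
have h2 : `|r'' - r'| <= `|q|.
  have E : r'' ^+ 2 = q ^+ 2 + r' ^+ 2 by rewrite !norm2_sqr XE.
  have r0 : 0 <= r'' by exact: norm2_ge0.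
  have r'0 : 0 <= r' by exact: norm2_ge0.
  have q0 := normr_ge0 q; have qq : `|q| ^+ 2 = q ^+ 2 by rewrite real_normK ?num_real.
  have k1 : r' <= r'' by rewrite -ler_sqr ?nnegrE// E lerDr sqr_ge0.
  have k2 : r'' <= r' + `|q|.
    rewrite -ler_sqr ?nnegrE ?addr_ge0// E sqrrD qq.
    have := mulr_ge0 r'0 q0; lra.
  rewrite ger0_norm ?subr_ge0//; lra.
have := ler_distD r'' r r'; lra.
Qed.

Let N v := norm2 (S *m v).

Let sd1 := Num.sqrt d1.

Let sd10 : 0 < sd1. Proof. by rewrite sqrtr_gt0. Qed.

Let N_le v : N v <= norm2 (X *m v) / sd1.
Proof.
rewrite ler_pdivlMr// -ler_sqr ?nnegrE ?mulr_ge0 ?norm2_ge0 ?(ltW sd10)//.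
rewrite exprMn /N !norm2_sqr /sd1 sqr_sqrtr ?(ltW d10)// [_ * d1]mulrC.
exact: H.
Qed.

Let N'_le v : N v <= norm2 (X' *m v) / sd1.
Proof.
rewrite ler_pdivlMr// -ler_sqr ?nnegrE ?mulr_ge0 ?norm2_ge0 ?(ltW sd10)//.
rewrite exprMn /N !norm2_sqr /sd1 sqr_sqrtr ?(ltW d10)// [_ * d1]mulrC.
exact: coercive'.
Qed.

Let w := js_weight tau (dotv (X *m b) (X *m b)).
Let w' := js_weight tau' (dotv (X' *m b') (X' *m b')).

Let js_diff : norm2 (S *m (james_stein c X Y - james_stein c X' Y')) <=
  `|e| / sd1 + `|w - w'| * N b'.
Proof.
rewrite !james_steinE -/b -/b' -/tau -/tau' -/w -/w'.
have -> : S *m (w *: b - w' *: b') = w *: (S *m (b - b')) + (w - w') *: (S *m b').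
  by rewrite !mulmxBr -!scalemxAr scalerBr scalerBl addrA subrK.
rewrite (le_trans (norm2D _ _))// !norm2Z lerD2r.
rewrite (ger0_norm (js_weight_ge0 _ _)).
have h0 : norm2 (X *m (b - b')) <= `|e|.
  by rewrite -sqrtr_sqr; apply: norm2_sqrt_le => //; exact: sqr_ge0.
have w1 : w <= 1 by exact: js_weight_le1.
rewrite (@le_trans _ _ (1 * N (b - b')))//.
  by rewrite ler_wpM2r// norm2_ge0.
by rewrite mul1r (le_trans (N_le _))// ler_wpM2r// invr_ge0 ltW.
Qed.

(** The prediction [q] at the removed row grows with the size of [beta], so this bound is meant for
    [N beta] of the order of the noise. *)
Lemma js_stability_small :
  norm2 (S *m (james_stein c X Y - james_stein c X' Y')) <=
  (4 * `|e| + 3 * `|q| + Num.sqrt (Q * (e ^+ 2 + U / (m'%:R - p%:R)))) / sd1.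
Proof.
apply: (le_trans js_diff).
have h : `|w - w'| * r' <= 3 * (`|e| + `|q|) + Num.sqrt (Q * (e ^+ 2 + U / (m'%:R - p%:R))).
  have := js_weight_diff tau0 tau'0 (norm2_ge0 (X *m b)) (norm2_ge0 (X' *m b')).
  rewrite !norm2_sqr -/w -/w' -/r -/r' => /le_trans; apply.
  apply: lerD; first by rewrite ler_wpM2l.
  by rewrite ler_sqrt// (le_trans _ tau_diff).
have h2 : `|w - w'| * N b' <= (`|w - w'| * r') / sd1.
  by rewrite -mulrA ler_wpM2l//; exact: N'_le.
apply: (le_trans (lerD (lexx _) h2)).
rewrite -mulrDl ler_wpM2r ?invr_ge0 ?(ltW sd10)//; lra.
Qed.

(** The condition on [U] keeps both least squares estimators within half the length of [beta], so
    each weight is within [4 * Q * U / (d1 * N beta ^+ 2)] of one. With [N b'] at most [3 / 2] of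
    [N beta], the constant is [(4 + 4) * 3 / 2]. The weight term shrinks as [beta] grows. *)
Lemma js_stability_large : 0 < N beta -> 4 * U <= d1 * N beta ^+ 2 ->
  norm2 (S *m (james_stein c X Y - james_stein c X' Y')) <=
  `|e| / sd1 + 12 * Q * U / (d1 * N beta).
Proof.
move=> B0 UB; set B := N beta in B0 UB *.
apply: (le_trans js_diff); rewrite lerD2l.
have near v : d1 * dotv (S *m (v - beta)) (S *m (v - beta)) <= U -> B / 2 <= N v <= 3 * B / 2.
  move=> h; have hN : N (v - beta) <= B / 2.
    rewrite -ler_sqr ?nnegrE ?norm2_ge0 ?divr_ge0 ?(ltW B0)// norm2_sqr -(ler_pM2l d10).
    apply: (le_trans h); rewrite -(ler_pM2l (_ : 0 < 4 :> R))// (le_trans UB)//.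
    by rewrite le_eqVlt; apply/orP; left; apply/eqP; field.
  have n1 : N v <= B + N (v - beta).
    by rewrite /N -{1}[v](subrK beta) mulmxDr addrC; exact: norm2D.
  have n2 : B <= N v + N (v - beta).
    rewrite /B /N; have -> : S *m beta = S *m v - S *m (v - beta).
      by rewrite mulmxBr opprB addrC subrK.
    by rewrite (le_trans (norm2D _ _))// norm2N.
  by apply/andP; split; lra.
have /andP[nb _] : B / 2 <= N b <= 3 * B / 2.
  by apply: near; exact: (ols_error_le Y Sp d10 H).
have /andP[nb' nb''] : B / 2 <= N b' <= 3 * B / 2.
  apply: near; apply: (le_trans (ols_error_le Y' Sp d10 coercive' beta)).
  by rewrite /U YE lerDr sqr_ge0.
have N2 (v : 'cV[R]_p) : N v ^+ 2 = dotv (S *m v) (S *m v) by exact: norm2_sqr.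
have wb (t s v : R) : 0 <= t -> t <= Q * U -> B / 2 <= v -> d1 * v ^+ 2 <= s ->
    0 <= 1 - js_weight t s <= 4 * (Q * U) / (d1 * B ^+ 2).
  move=> t0 tQ Bv vs; rewrite subr_ge0 js_weight_le1//=.
  have dB : 0 < d1 * B ^+ 2 by rewrite mulr_gt0// exprn_gt0.
  have v2 : B ^+ 2 / 4 <= v ^+ 2.
    have -> : B ^+ 2 / 4 = (B / 2) ^+ 2 by field.
    by rewrite ler_sqr ?nnegrE//; lra.
  have s4 : d1 * B ^+ 2 <= 4 * s.
    have := ler_wpM2l (ltW d10) v2; lra.
  have sp : 0 < s by lra.
  have E := js_weightE t0 (ltW sp).
  have m1 : Num.min t s <= t by rewrite ge_min lexx.
  have k1 : s * (1 - js_weight t s) <= Q * U by lra.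
  have j1 : 0 <= 1 - js_weight t s by rewrite subr_ge0 js_weight_le1.
  rewrite ler_pdivlMr// mulrC.
  have := ler_wpM2r j1 s4; lra.
have /andP[a1 a2] := wb tau _ (N b) tau0 tau_le nb (eq_ind_r (fun z => d1 * z <= _) (H b) (N2 b)).
have /andP[a3 a4] := wb tau' _ (N b') tau'0 tau'_le nb' (eq_ind_r (fun z => d1 * z <= _) (coercive' b') (N2 b')).
rewrite -/w in a1 a2; rewrite -/w' in a3 a4.
have dw : `|w - w'| <= 4 * (Q * U) / (d1 * B ^+ 2) + 4 * (Q * U) / (d1 * B ^+ 2).
  rewrite ler_norml; apply/andP; split; lra.
apply: (le_trans (ler_pM (normr_ge0 _) (norm2_ge0 _) dw nb'')).
by rewrite le_eqVlt; apply/orP; left; apply/eqP; field; rewrite !gt_eqF.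
Qed.

End leave_one_out.

(** * Probability bounds and limits *)

Section probability_bounds.
Context {R : realType} {d : measure_display} {T : measurableType d}.
Variable Pr : probability T R.

Lemma markov_ge0 (f : T -> R) (a b : R) : measurable_fun setT f ->
  (forall t, 0 <= f t) -> 0 < a -> (\int[Pr]_t (f t)%:E <= (a * b)%:E)%E ->
  (Pr [set t | (a < f t)%R] <= b%:E)%E.
Proof.
move=> mf f0 a0 h; have mA : measurable [set t | a < f t].
  by apply: measurable_gtset => //; exact: measurable_cst.
have : (a%:E * Pr [set t | (a < f t)%R] <= a%:E * b%:E)%E.
  apply: le_trans h.
  have := integral_indic Pr measurableT mA; rewrite setIT => <-.
  rewrite -ge0_integralZl//; last by rewrite lee_fin ltW.
    apply: ge0_le_integral => //.
    - by move=> t _; rewrite -EFinM lee_fin mulr_ge0// ltW.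
    - by apply: emeasurable_funM => //; exact/measurable_EFinP/measurable_indic.
    - exact/measurable_EFinP.
    move=> t _; rewrite -EFinM lee_fin indicE.
    case: (boolP (t \in _)) => [|_]; last by rewrite mulr0.
    by rewrite inE /= mulr1 => /ltW.
  exact/measurable_EFinP/measurable_indic.
by rewrite lee_pmul2l.
Qed.

Lemma prob_le_add (A B C : set T) (b c : \bar R) :
  measurable A -> measurable B -> measurable C -> A `<=` B `|` C ->
  (Pr B <= b)%E -> (Pr C <= c)%E -> (Pr A <= b + c)%E.
Proof.
move=> mA mB mC ABC hb hc.
apply: (@le_trans _ _ (Pr (B `|` C))).
  by apply: le_measure => //; rewrite inE//; exact: measurableU.
by rewrite (le_trans (measureU2 _ mB mC))// leeD.
Qed.

Lemma has_law_integral {d' : measure_display} {U : measurableType d'}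
    (X : T -> U) (mu : probability U R) (f : U -> \bar R) :
  has_law Pr X mu -> measurable_fun setT f -> (forall u, 0 <= f u)%E ->
  (\int[Pr]_t f (X t) = \int[mu]_u f u)%E.
Proof.
move=> [mX lX] mf f0.
have := ge0_integral_pushforward mX Pr measurableT mf.
rewrite preimage_setT => <- //; apply: eq_measure_integral => A mA _; exact: lX.
Qed.

End probability_bounds.

Section data_matrices.
Context {R : realType} {p : nat}.
Implicit Types zs : nat -> p.-tuple R * R.

Lemma Xdata_mul k m zs (v : 'cV[R]_p) i :
  (Xdata k m zs *m v) i 0 = dotv (vec (zs (k + i)%N).1) v.
Proof. by rewrite mxE dotvE; apply: eq_bigr => j _; rewrite !mxE. Qed.

Lemma Xdata_form k m zs (v : 'cV[R]_p) :
  dotv (Xdata k m zs *m v) (Xdata k m zs *m v) =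
  \sum_(i < m) dotv (vec (zs (k + i)%N).1) v ^+ 2.
Proof. by rewrite dotvE; apply: eq_bigr => i _; rewrite Xdata_mul expr2. Qed.

Lemma residual_form k m zs (v : 'cV[R]_p) :
  dotv (Ydata k m zs - Xdata k m zs *m v) (Ydata k m zs - Xdata k m zs *m v) =
  \sum_(i < m) ((zs (k + i)%N).2 - dotv (vec (zs (k + i)%N).1) v) ^+ 2.
Proof.
rewrite dotvE; apply: eq_bigr => i _.
have -> : (Ydata k m zs - Xdata k m zs *m v) i 0 =
    (zs (k + i)%N).2 - dotv (vec (zs (k + i)%N).1) v.
  by rewrite -Xdata_mul mxE [in LHS]mxE; congr (_ + _); rewrite mxE.
by rewrite expr2.
Qed.

Lemma Xdata_ext k m zs zs' : (forall i, (i < m)%N -> zs (k + i)%N = zs' (k + i)%N) ->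
  Xdata k m zs = Xdata k m zs'.
Proof. by move=> h; apply/matrixP => i j; rewrite !mxE h. Qed.

Lemma Ydata_ext k m zs zs' : (forall i, (i < m)%N -> zs (k + i)%N = zs' (k + i)%N) ->
  Ydata k m zs = Ydata k m zs'.
Proof. by move=> h; apply/matrixP => i j; rewrite !mxE h. Qed.

Context {d : measure_display} {T : measurableType d}.
Variable z : nat -> T -> p.-tuple R * R.

Lemma mxmeas_Xdata k m : (forall i, (i < m)%N -> measurable_fun setT (z (k + i)%N)) ->
  mxmeas (fun w => Xdata k m (fun i => z i w)).
Proof.
move=> mz i j; under eq_fun do rewrite mxE.
have m1 : measurable_fun setT (fun w => (z (k + i)%N w).1).
  by apply: (measurableT_comp (@measurable_fst _ _ _ _)); exact: mz.
exact: (measurableT_comp (measurable_tnth j) m1).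
Qed.

Lemma mxmeas_Ydata k m : (forall i, (i < m)%N -> measurable_fun setT (z (k + i)%N)) ->
  mxmeas (fun w => Ydata k m (fun i => z i w)).
Proof.
move=> mz i j; under eq_fun do rewrite mxE.
by apply: (measurableT_comp (@measurable_snd _ _ _ _)); exact: mz.
Qed.

End data_matrices.

(** * Probability bounds at a fixed sample size [m.+1] *)

Section sample_bounds.
Context {R : realType} {m p : nat} {d : measure_display} {T : measurableType d}.
Variables (Ll Lw : probability R R) (C0 c0 : R).
Variables (P : probability (p.-tuple R * R)%type R) (th : params R p) (beta : 'cV[R]_p).
Variables (Pr : probability T R) (z : nat -> T -> p.-tuple R * R).
Variables (c k1 Ku del e1 : R) (g : ('I_m.+2 -> p.-tuple R * R) -> bool).
Hypothesis adw : admissible_Lw Lw.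
Hypothesis adl : admissible_Ll c0 Ll.
Hypothesis mod : in_model Ll Lw C0 P th.
Hypothesis iid : iid_data Pr m.+1 z P.
Hypothesis m0 : (0 < m)%N.
Hypothesis k10 : 0 <= k1.
Hypothesis k11 : k1 < 1.
Hypothesis pk : p%:R <= k1 * m%:R.
Hypothesis c01 : 0 <= c <= 1.
Hypothesis Ku0 : 0 <= Ku.
Hypothesis res2 : (\int[P]_z (((z.2 - dotv (vec z.1) beta) / sigma th) ^+ 2)%:E <= Ku%:E)%E.
Hypothesis del0 : 0 < del.
Hypothesis mg : mfam g.
Hypothesis g_upd : forall h x, g (upd (inord 1) h x) = g h.
Hypothesis g_coercive : forall h, g h -> forall u : 'cV[R]_p,
  del * m%:R * dotv (Sigma_half th *m u) (Sigma_half th *m u) <=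
  \sum_(j < m) dotv (vec (h (inord j.+2)).1) u ^+ 2.
Hypothesis g_prob : (Pr [set w | ~~ g (fun i : 'I_m.+2 => z i w)] <= e1%:E)%E.

Let S := Sigma_half th.
Let s := sigma th.
Let zs w i := z i w.
Let h w : 'I_m.+2 -> p.-tuple R * R := fun i => z i w.
Let X w := Xdata 1 m.+1 (zs w).
Let Y w := Ydata 1 m.+1 (zs w).
Let X' w := Xdata 2 m (zs w).
Let Y' w := Ydata 2 m (zs w).
Let x w := vec (z 1%N w).1.
Let y w := (z 1%N w).2.
Let U w := dotv (Y w - X w *m beta) (Y w - X w *m beta).
Let d1 := del * m%:R.
Let b' w := ols (X' w) (Y' w).

Let Sp : symmetric_posdef S. Proof. by case: (Sigma_halfP mod). Qed.
Let s0 : 0 < s. Proof. exact: sigma_gt0 mod. Qed.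
Let mR : 0 < m%:R :> R. Proof. by rewrite ltr0n. Qed.
Let d10 : 0 < d1. Proof. by rewrite mulr_gt0. Qed.
Let km0 : 0 < 1 - k1. Proof. by rewrite subr_gt0. Qed.

Let pm : (p < m)%N.
Proof. by rewrite -(ltr_nat R) (le_lt_trans pk)// gtr_pMl. Qed.

Let mp : (1 - k1) * m%:R <= m%:R - p%:R.
Proof. have := pk; lra. Qed.

Let mp0 : 0 < m%:R - p%:R :> R. Proof. by rewrite subr_gt0 ltr_nat. Qed.

Let mz i : (i < m.+2)%N -> measurable_fun setT (z i).
Proof. by move=> im; have [/(_ (Ordinal im)) []] := iid. Qed.

Let lz i : (i < m.+2)%N -> has_law Pr (z i) P.
Proof. by move=> im; have [/(_ (Ordinal im))] := iid. Qed.

Let mX : mxmeas X. Proof. by apply: mxmeas_Xdata => i im; apply: mz. Qed.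
Let mY : mxmeas Y. Proof. by apply: mxmeas_Ydata => i im; apply: mz. Qed.
Let mX' : mxmeas X'. Proof. by apply: mxmeas_Xdata => i im; apply: mz. Qed.
Let mY' : mxmeas Y'. Proof. by apply: mxmeas_Ydata => i im; apply: mz. Qed.
Let mx : mxmeas x.
Proof.
move=> i j; have m1 : measurable_fun setT (fun w => (z 1%N w).1).
  by apply: (measurableT_comp (@measurable_fst _ _ _ _)); exact: mz.
exact: (measurableT_comp (vec_mxmeas i j) m1).
Qed.
Let my : measurable_fun setT y.
Proof. by apply: (measurableT_comp (@measurable_snd _ _ _ _)); exact: mz. Qed.
Let mU : measurable_fun setT U.
Proof.
have h1 : mxmeas (fun w => Y w - X w *m beta).
  by apply: mxmeasB => //; apply: mxmeasM => //; exact: mxmeas_cst.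
exact: measurable_dotv.
Qed.
Let mh i : measurable_fun setT (fun w => h w i). Proof. exact: mz. Qed.
Let mgh : measurable_fun setT (fun w => g (h w)).
Proof. exact: (mfam_comp mh mg). Qed.

Let XE w v : dotv (X w *m v) (X w *m v) = dotv (x w) v ^+ 2 + dotv (X' w *m v) (X' w *m v).
Proof. by rewrite !Xdata_form big_ord_recl. Qed.

Let YE w v : dotv (Y w - X w *m v) (Y w - X w *m v) =
  (y w - dotv (x w) v) ^+ 2 + dotv (Y' w - X' w *m v) (Y' w - X' w *m v).
Proof. by rewrite !residual_form big_ord_recl. Qed.

Let coercive' w : g (h w) -> forall u,
  d1 * dotv (S *m u) (S *m u) <= dotv (X' w *m u) (X' w *m u).
Proof.
move=> gw u; rewrite Xdata_form (le_trans (g_coercive gw u))//.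
rewrite ler_sum// => j _; rewrite /h /= inordK//.
by rewrite !ltnS.
Qed.

Let coercive w : g (h w) -> forall u,
  d1 * dotv (S *m u) (S *m u) <= dotv (X w *m u) (X w *m u).
Proof. by move=> gw u; rewrite (le_trans (coercive' gw u))// XE lerDr sqr_ge0. Qed.

Let mres : measurable_fun setT (fun z : p.-tuple R * R => (z.2 - dotv (vec z.1) beta) ^+ 2).
Proof.
apply: measurable_funX; apply: measurable_funB => //.
apply: measurable_dotv; last exact: mxmeas_cst.
by move=> i j; apply: (measurableT_comp (vec_mxmeas i j)).
Qed.

Let res_int : (\int[P]_z ((z.2 - dotv (vec z.1) beta) ^+ 2)%:E <= (s ^+ 2 * Ku)%:E)%E.
Proof.
have E : forall z : p.-tuple R * R, ((z.2 - dotv (vec z.1) beta) ^+ 2)%:E =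
   ((s ^+ 2)%:E * (((z.2 - dotv (vec z.1) beta) / sigma th) ^+ 2)%:E)%E.
  by move=> t; rewrite -EFinM; congr (_%:E); rewrite -/s; field; rewrite gt_eqF.
under eq_integral do rewrite E.
rewrite ge0_integralZl//; last 3 first.
- apply/measurable_EFinP; under eq_fun do rewrite exprMn.
  exact: measurable_funM.
- by move=> t _; rewrite lee_fin sqr_ge0.
- by rewrite lee_fin sqr_ge0.
by rewrite [leRHS]EFinM lee_pmul2l// lte_fin exprn_gt0.
Qed.

Let U_int : (\int[Pr]_w (U w)%:E <= (m%:R * (s ^+ 2 * (2 * Ku)))%:E)%E.
Proof.
have E w : (U w)%:E = (\sum_(i < m.+1)
    ((fun y : p.-tuple R * R => (y.2 - dotv (vec y.1) beta) ^+ 2) (z (1 + i)%N w))%:E)%E.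
  by rewrite /U residual_form sumEFin.
under eq_integral do rewrite E.
have im (i : 'I_m.+1) : (1 + i < m.+2)%N by rewrite add1n ltnS.
rewrite ge0_integral_sum//; last 2 first.
- by move=> i; apply/measurable_EFinP; apply: (measurableT_comp mres); exact: mz.
- by move=> i w _; rewrite lee_fin sqr_ge0.
have hi (i : 'I_m.+1) : (\int[Pr]_w ((fun y : p.-tuple R * R =>
    (y.2 - dotv (vec y.1) beta) ^+ 2) (z (1 + i)%N w))%:E <= (s ^+ 2 * Ku)%:E)%E.
  rewrite (has_law_integral (f := fun y : p.-tuple R * R => ((y.2 - dotv (vec y.1) beta) ^+ 2)%:E) (lz (im i)))//.
    exact/measurable_EFinP.
  by move=> u; rewrite lee_fin sqr_ge0.
apply: (le_trans (lee_sum _ (fun i _ => hi i))).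
rewrite sumEFin lee_fin sumr_const card_ord -mulr_natl.
(* All scales are expressed by the size [m] of the reduced sample; passing to it from [m.+1]
   summands costs the factor two. *)
have q : m.+1%:R <= 2 * m%:R :> R by rewrite -natrM ler_nat mul2n -addnn -addn1 leq_add2l.
have q2 : 0 <= s ^+ 2 * Ku by rewrite mulr_ge0// sqr_ge0.
have := ler_wpM2r q2 q; lra.
Qed.

Let bad_g := [set w | ~~ g (h w)].
Let bad_U A := [set w | m%:R * (s ^+ 2 * A) < U w].

Let m_bad_g : measurable bad_g.
Proof.
by have := measurable_neg mgh measurableT (Y := [set true]); rewrite setTI; apply.
Qed.

Let m_bad_U A : measurable (bad_U A).
Proof. by apply: measurable_gtset => //; exact: measurable_cst. Qed.

Let p_bad_U A : 0 < A -> (Pr (bad_U A) <= (2 * Ku / A)%:E)%E.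
Proof.
move=> A0; apply: markov_ge0 => //; first by move=> w; exact: dotv_ge0.
  by rewrite !mulr_gt0// exprn_gt0.
apply: (le_trans U_int); rewrite lee_fin le_eqVlt; apply/orP; left; apply/eqP.
by field; rewrite gt_eqF.
Qed.

Let dist_meas (F G : T -> 'cV[R]_p) : mxmeas F -> mxmeas G ->
  measurable_fun setT (fun w => scaled_dist th (F w) (G w)).
Proof.
move=> mF mG; apply: measurable_norm2; apply: mxmeasZ => //.
by apply: mxmeasM; [exact: mxmeas_cst|exact: mxmeasB].
Qed.

Let distE (v1 v2 : 'cV[R]_p) : scaled_dist th v1 v2 = norm2 (S *m (v1 - v2)) / s.
Proof. by rewrite /scaled_dist norm2Z gtr0_norm ?invr_gt0// mulrC. Qed.

Let mjs : mxmeas (fun w => js_full m.+1 c (fun i => z i w)).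
Proof. exact: mxmeas_james_stein. Qed.

Let mjs' : mxmeas (fun w => js_loo m.+1 c (fun i => z i w)).
Proof. exact: (mxmeas_james_stein c mX' mY'). Qed.

Let q1 := k1 / (1 - k1).
Let q10 : 0 <= q1. Proof. by rewrite divr_ge0// ltW. Qed.

Let ratio_le : p%:R / (m%:R - p%:R) <= q1.
Proof.
rewrite ler_pdivrMr// /q1 mulrAC ler_pdivlMr//; have := pk; have := k11.
move=> k11' pk'; have : 0 <= (1 - k1) * (k1 * m%:R - p%:R) by apply: mulr_ge0; [exact: ltW|rewrite subr_ge0].
have := mp; nra.
Qed.

Lemma risk_bound A M : 0 < A -> Num.sqrt (A / del) + Num.sqrt (q1 * (A / del)) <= M ->
  (Pr [set w | (M < scaled_dist th (js_full m.+1 c (fun i => z i w)) beta)%R] <=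
   (e1 + 2 * Ku / A)%:E)%E.
Proof.
move=> A0 AM; rewrite EFinD; apply: (@prob_le_add _ _ _ _ _ bad_g (bad_U A)) => //.
- apply: measurable_gtset; first exact: measurable_cst.
  by apply: dist_meas => //; exact: mxmeas_cst.
- move=> w /= Mw; apply: contrapT => /not_orP[/negP]; rewrite negbK => gw /negP.
  rewrite -leNgt => Uw; move: Mw; apply/negP; rewrite -leNgt distE ler_pdivrMr//.
  have pm1 : (p < m.+1)%N by rewrite ltnW// ltnS.
  have := james_stein_error_le (Y w) beta Sp d10 pm1 c01 (coercive gw).
  move=> /le_trans; apply; rewrite (@le_trans _ _ ((Num.sqrt (A / del) + Num.sqrt (q1 * (A / del))) * s))//; last first.
    by rewrite ler_wpM2r// ltW.
  have U0 : 0 <= U w by exact: dotv_ge0.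
  have Ud : U w / d1 <= (A / del) * s ^+ 2.
    rewrite ler_pdivrMr// (le_trans Uw)// /d1 le_eqVlt; apply/orP; left; apply/eqP.
    by field; rewrite gt_eqF.
  have Ud0 : 0 <= U w / d1 by rewrite divr_ge0// ltW.
  have sq t : 0 <= t -> Num.sqrt (t * s ^+ 2) = Num.sqrt t * s.
    by move=> t0; rewrite sqrtrM// sqrtr_sqr gtr0_norm.
  have Ad0 : 0 <= A / del by rewrite divr_ge0// ltW.
  have As0 : 0 <= A / del * s ^+ 2 by rewrite mulr_ge0// sqr_ge0.
  have r1 : Num.sqrt (U w / d1) <= Num.sqrt (A / del) * s by rewrite -sq// ler_sqrt.
  have r2 : Num.sqrt (p%:R / (m.+1%:R - p%:R) * U w / d1) <= Num.sqrt (q1 * (A / del)) * s.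
    rewrite -sq; last exact: mulr_ge0.
    have mp1 : 0 < m.+1%:R - p%:R :> R by rewrite subr_gt0 ltr_nat.
    rewrite -[_ * U w / d1]mulrA -[_ * s ^+ 2]mulrA ler_sqrt; last exact: mulr_ge0.
    apply: ler_pM => //; first by rewrite divr_ge0// ltW.
    apply: le_trans ratio_le; rewrite ler_wpM2l// lef_pV2 ?posrE//.
    by rewrite lerD2r ler_nat.
  by rewrite [leRHS]mulrDl lerD.
- exact: p_bad_U.
Qed.

Let i1 : 'I_m.+2 := inord 1.

Let i1E : nat_of_ord i1 = 1%N. Proof. by rewrite inordK. Qed.

(* [bh] does not depend on the first observation, so resampling that observation
   turns the mean of [F] into the mean of [norm2 (S *m (bh - beta)) ^+ 2] on [g];
   off [g] there is no moment bound. *)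
Let bh (f : 'I_m.+2 -> p.-tuple R * R) : 'cV[R]_p :=
  ols (Xdata 2 m (fun i => f (inord i))) (Ydata 2 m (fun i => f (inord i))).
Let F (f : 'I_m.+2 -> p.-tuple R * R) : R :=
  if g f then dotv (vec (f i1).1) (bh f - beta) ^+ 2 else 0.

Let bhE w : bh (h w) = b' w.
Proof.
rewrite /bh /b' /X' /Y'; congr ols; [apply: Xdata_ext|apply: Ydata_ext] => i im;
  by rewrite /h /zs inordK// !ltnS.
Qed.

Let bh_upd f y0 : bh (upd i1 f y0) = bh f.
Proof.
rewrite /bh; congr ols; [apply: Xdata_ext|apply: Ydata_ext] => i im;
  by rewrite /upd; case: eqVneq => // /(congr1 val); rewrite /= i1E inordK ?ltnS.
Qed.

Let mF : mfam F.
Proof.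
pose zt := fun (i : nat) (t : #|'I_m.+2|.-tuple (p.-tuple R * R)%type) => tnth t (enum_rank (inord i : 'I_m.+2)).
have mzt i : measurable_fun setT (zt i) by exact: measurable_tnth.
apply: measurable_fun_ifT => //; apply: measurable_funX; apply: measurable_dotv.
  move=> i j; have m1 : measurable_fun setT (fun t : #|'I_m.+2|.-tuple (p.-tuple R * R)%type => (tnth t (enum_rank i1)).1).
    by apply: (measurableT_comp (@measurable_fst _ _ _ _)); exact: measurable_tnth.
  exact: (measurableT_comp (vec_mxmeas i j) m1).
apply: mxmeasB; last exact: mxmeas_cst.
apply: mxmeas_ols; [apply: (mxmeas_Xdata (z := zt))|apply: (mxmeas_Ydata (z := zt))] => i im; exact: mzt.
Qed.

Let F0 f : 0 <= F f. Proof. by rewrite /F; case: ifP => // _; exact: sqr_ge0. Qed.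

Let F_int : (\int[Pr]_w (F (h w))%:E <= (s ^+ 2 * (2 * Ku / del))%:E)%E.
Proof.
have [_ ind] := iid.
have lawX A : measurable A -> Pr (z i1 @^-1` A) = P A.
  by have [/(_ i1) [_ l] _] := iid; exact: l.
have mEF : mfam (fun f => (F f)%:E) by exact/measurable_EFinP.
rewrite (resample_ge0 mh ind lawX _ mEF); last by move=> f; rewrite lee_fin.
have E w : (\int[P]_y (F (upd i1 (h w) y))%:E)%E =
    (if g (h w) then dotv (S *m (b' w - beta)) (S *m (b' w - beta)) else 0)%:E.
  under eq_integral => y0 _.
    rewrite /F g_upd bh_upd bhE /upd eqxx; over.
  case: (g (h w)) => /=; last by rewrite integral0.
  exact: (design_second_moment adw adl mod).
under eq_integral do rewrite E.
apply: (@le_trans _ _ (\int[Pr]_w ((d1^-1)%:E * (U w)%:E))%E).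
  apply: ge0_le_integral => //.
  - by move=> w _; rewrite lee_fin; case: ifP => // _; exact: dotv_ge0.
  - apply/measurable_EFinP/measurable_fun_ifT => //.
    have mb : mxmeas (fun w => S *m (b' w - beta)).
      apply: mxmeasM; first exact: mxmeas_cst.
      by apply: mxmeasB; [exact: mxmeas_ols|exact: mxmeas_cst].
    exact: measurable_dotv.
  - by apply: emeasurable_funM => //; exact/measurable_EFinP.
  move=> w _; rewrite -EFinM lee_fin; case: ifPn => gw; last first.
    by rewrite mulr_ge0 ?dotv_ge0// invr_ge0 ltW.
  rewrite mulrC ler_pdivlMr// mulrC.
  rewrite (le_trans (ols_error_le (Y' w) Sp d10 (coercive' gw) beta))//.
  by rewrite /U YE lerDr sqr_ge0.
rewrite ge0_integralZl//; last 3 first.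
- exact/measurable_EFinP.
- by move=> w _; rewrite lee_fin dotv_ge0.
- by rewrite lee_fin invr_ge0 ltW.
apply: (@le_trans _ _ ((d1^-1)%:E * (m%:R * (s ^+ 2 * (2 * Ku)))%:E)%E).
  by rewrite lee_pmul2l// lte_fin invr_gt0.
rewrite -EFinM lee_fin le_eqVlt; apply/orP; left; apply/eqP.
by rewrite /d1; field; rewrite !gt_eqF.
Qed.

Let B0 := norm2 (S *m beta).
Let bad_F M := [set w | s ^+ 2 * M ^+ 2 < F (h w)].
(** Scaling by [B0 + s] instead of [B0] keeps the level positive when [beta] is zero. *)
Let bad_x M := [set w | (B0 + s) ^+ 2 * M ^+ 2 < dotv (x w) beta ^+ 2].
Let bad_y M := [set w | s ^+ 2 * M ^+ 2 < (y w - dotv (x w) beta) ^+ 2].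

Let mFh : measurable_fun setT (fun w => F (h w)). Proof. exact: (mfam_comp mh mF). Qed.
Let mxb : measurable_fun setT (fun w => dotv (x w) beta ^+ 2).
Proof. by apply/measurable_funX/measurable_dotv => //; exact: mxmeas_cst. Qed.
Let myx : measurable_fun setT (fun w => (y w - dotv (x w) beta) ^+ 2).
Proof.
apply/measurable_funX/measurable_funB => //.
by apply: measurable_dotv => //; exact: mxmeas_cst.
Qed.

Let p_bad_F M : 0 < M -> (Pr (bad_F M) <= (2 * Ku / del / M ^+ 2)%:E)%E.
Proof.
move=> M0; apply: markov_ge0 => //; first by rewrite mulr_gt0 ?exprn_gt0.
apply: (le_trans F_int); rewrite lee_fin le_eqVlt; apply/orP; left; apply/eqP.
by field; rewrite !gt_eqF.
Qed.

Let p_bad_x M : 0 < M -> (Pr (bad_x M) <= (1 / M ^+ 2)%:E)%E.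
Proof.
move=> M0; have Bs : 0 < B0 + s by rewrite ltr_wpDl// norm2_ge0.
apply: markov_ge0 => //; [by move=> w; exact: sqr_ge0|by rewrite mulr_gt0 ?exprn_gt0|].
have mf : measurable_fun setT (fun u : p.-tuple R * R => (dotv (vec u.1) beta ^+ 2)%:E).
  apply/measurable_EFinP/measurable_funX/measurable_dotv; last exact: mxmeas_cst.
  by move=> i j; apply: (measurableT_comp (vec_mxmeas i j)).
rewrite (has_law_integral (f := fun u => (dotv (vec u.1) beta ^+ 2)%:E) (lz (isT : (1 < m.+2)%N)) mf); last first.
  by move=> u; rewrite lee_fin sqr_ge0.
rewrite (design_second_moment adw adl mod) lee_fin -norm2_sqr -/S -/B0.
rewrite [leRHS](_ : _ = (B0 + s) ^+ 2); last by field; rewrite gt_eqF.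
by rewrite ler_sqr ?nnegrE ?norm2_ge0 ?(ltW Bs)// lerDl ltW.
Qed.

Let p_bad_y M : 0 < M -> (Pr (bad_y M) <= (Ku / M ^+ 2)%:E)%E.
Proof.
move=> M0; apply: markov_ge0 => //; [by move=> w; exact: sqr_ge0|by rewrite mulr_gt0 ?exprn_gt0|].
rewrite (has_law_integral (f := fun u : p.-tuple R * R => ((u.2 - dotv (vec u.1) beta) ^+ 2)%:E) (lz (isT : (1 < m.+2)%N)))//.
- apply: (le_trans res_int); rewrite lee_fin le_eqVlt; apply/orP; left; apply/eqP.
  by field; rewrite gt_eqF.
- exact/measurable_EFinP.
- by move=> u; rewrite lee_fin sqr_ge0.
Qed.

(** [A], [M] are the levels of the exceptional events, and [L * s] separates small from large [B0].
    The first three conditions serve large [B0], the last one small [B0]: there [|e| <= 2 * s * M]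
    and [|q| <= (L + 2) * s * M], so [4 * |e| + 3 * |q|] gives [14 * M + 3 * M * L], up to [s]. *)
Lemma stability_bound A M L eps : 0 < A -> 0 < M -> 0 < L -> 0 < eps ->
  4 * A / del <= L ^+ 2 -> 12 * q1 * A / (del * L) <= eps / 2 ->
  2 * M <= eps / 2 * Num.sqrt d1 ->
  14 * M + 3 * M * L + Num.sqrt (q1 * (4 * M ^+ 2 + A / (1 - k1))) <= eps * Num.sqrt d1 ->
  (Pr [set w | (eps < scaled_dist th (js_full m.+1 c (fun i => z i w))
      (js_loo m.+1 c (fun i => z i w)))%R] <=
   (e1 + (2 * Ku / A + (2 * Ku / del / M ^+ 2 + (1 / M ^+ 2 + Ku / M ^+ 2))))%:E)%E.
Proof.
move=> A0 M0 L0 eps0 LA Leps dM dL.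
have m1 : measurable (bad_F M) by apply: measurable_gtset => //; exact: measurable_cst.
have m2 : measurable (bad_x M) by apply: measurable_gtset => //; exact: measurable_cst.
have m3 : measurable (bad_y M) by apply: measurable_gtset => //; exact: measurable_cst.
have m4 : measurable (bad_x M `|` bad_y M) by exact: measurableU.
have m5 : measurable (bad_F M `|` (bad_x M `|` bad_y M)) by exact: measurableU.
have m6 : measurable (bad_U A `|` (bad_F M `|` (bad_x M `|` bad_y M))) by exact: measurableU.
rewrite EFinD; apply: (prob_le_add (B := bad_g) (C := bad_U A `|` (bad_F M `|` (bad_x M `|` bad_y M)))) => //.
- by apply: measurable_gtset; [exact: measurable_cst|exact: dist_meas].
- move=> w /= dw; apply: contrapT => /not_orP[/negP]; rewrite negbK => gw.
  move=> /not_orP[/negP]; rewrite -leNgt => Uw /not_orP[/negP]; rewrite -leNgt => Fw.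
  move=> /not_orP[/negP]; rewrite -leNgt => xw /negP; rewrite -leNgt => yw.
  move: dw; apply/negP; rewrite -leNgt distE ler_pdivrMr//.
  have U0 : 0 <= U w by exact: dotv_ge0.
  have B00 : 0 <= B0 by exact: norm2_ge0.
  have sq_le a t : 0 <= a -> t ^+ 2 <= a ^+ 2 * M ^+ 2 -> `|t| <= a * M.
    move=> a0 ht; rewrite -ler_sqr ?nnegrE ?mulr_ge0 ?(ltW M0)//.
    by rewrite real_normK ?num_real// exprMn.
  have f1 : `|dotv (x w) (b' w - beta)| <= s * M.
    by apply: sq_le; [exact: ltW|move: Fw; rewrite /F gw bhE /h i1E].
  have f2 : `|dotv (x w) beta| <= (B0 + s) * M by apply: sq_le => //; rewrite addr_ge0// ltW.
  have f3 : `|y w - dotv (x w) beta| <= s * M by apply: sq_le => //; exact: ltW.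
  have qw : `|dotv (x w) (b' w)| <= (B0 + 2 * s) * M.
    have -> : dotv (x w) (b' w) = dotv (x w) beta + dotv (x w) (b' w - beta).
      by rewrite dotvBr addrC subrK.
    rewrite (le_trans (ler_normD _ _))//; lra.
  have ew : `|y w - dotv (x w) (b' w)| <= 2 * s * M.
    have -> : y w - dotv (x w) (b' w) = (y w - dotv (x w) beta) - dotv (x w) (b' w - beta).
      by rewrite dotvBr; ring.
    rewrite (le_trans (ler_normB _ _))//; lra.
  have mE : m.+1%:R = m%:R + 1 :> R by rewrite -natr1.
  have sd1 : 0 < Num.sqrt d1 by rewrite sqrtr_gt0.
  have Qu : p%:R / (m%:R - p%:R) * U w <= q1 * (m%:R * (s ^+ 2 * A)).
    by apply: ler_pM => //; rewrite divr_ge0// ltW.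
  have [LB|LB] := leP (L * s) B0.
    have Bp : 0 < B0 by rewrite (lt_le_trans _ LB)// mulr_gt0.
    have UB : 4 * U w <= d1 * B0 ^+ 2.
      have l1 : (L * s) ^+ 2 <= B0 ^+ 2 by rewrite ler_sqr ?nnegrE// mulr_ge0 ?(ltW L0) ?(ltW s0).
      have l2 : 4 * A * s ^+ 2 <= del * (L * s) ^+ 2.
        have -> : del * (L * s) ^+ 2 = L ^+ 2 * del * s ^+ 2 by ring.
        by rewrite ler_wpM2r ?sqr_ge0// -ler_pdivrMr.
      have l3 : m%:R * (4 * A * s ^+ 2) <= m%:R * (del * B0 ^+ 2).
        by rewrite ler_wpM2l// (le_trans l2)// ler_wpM2l ?(ltW del0).
      rewrite /d1; lra.
    have := @js_stability_large _ _ _ _ (X w) (Y w) (X' w) (Y' w) (x w) (y w) S d1 c beta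
      Sp d10 (coercive' gw) (XE w) (YE w) mE pm c01 Bp UB.
    move=> /le_trans; apply.
    have t1 : `|y w - dotv (x w) (b' w)| / Num.sqrt d1 <= eps / 2 * s.
      rewrite ler_pdivrMr// (le_trans ew)//.
      have := ler_wpM2r (ltW s0) dM; lra.
    have t2 : 12 * (p%:R / (m%:R - p%:R)) * U w / (d1 * B0) <= eps / 2 * s.
      rewrite ler_pdivrMr ?mulr_gt0//.
      have u1 : 12 * q1 * A <= eps / 2 * (del * L) by move: Leps; rewrite ler_pdivrMr// mulr_gt0.
      have u2 : m%:R * s ^+ 2 * (12 * q1 * A) <= m%:R * s ^+ 2 * (eps / 2 * (del * L)).
        by rewrite ler_wpM2l// mulr_ge0// sqr_ge0.
      have u3 : eps / 2 * del * m%:R * s * (L * s) <= eps / 2 * del * m%:R * s * B0.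
        by rewrite ler_wpM2l// !mulr_ge0 ?divr_ge0 ?(ltW eps0) ?(ltW s0) ?(ltW del0).
      rewrite /d1; move: Qu u2 u3; rewrite expr2; lra.
    have -> : eps * s = eps / 2 * s + eps / 2 * s by field.
    exact: lerD.
  have := @js_stability_small _ _ _ _ (X w) (Y w) (X' w) (Y' w) (x w) (y w) S d1 c beta
    Sp d10 (coercive' gw) (XE w) (YE w) mE pm c01.
  move=> /le_trans; apply; rewrite ler_pdivrMr//.
  set W := 4 * M ^+ 2 + A / (1 - k1) in dL.
  have A1 : 0 <= A / (1 - k1) by apply: divr_ge0; exact: ltW.
  have W0 : 0 <= W by apply: addr_ge0 => //; apply: mulr_ge0 => //; exact: sqr_ge0.
  have Wb : (y w - dotv (x w) (b' w)) ^+ 2 + U w / (m%:R - p%:R) <= W * s ^+ 2.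
    have v1 : (y w - dotv (x w) (b' w)) ^+ 2 <= 4 * M ^+ 2 * s ^+ 2.
      have -> : 4 * M ^+ 2 * s ^+ 2 = (2 * s * M) ^+ 2 by ring.
      rewrite -[leLHS]real_normK ?num_real// ler_sqr ?nnegrE//.
      by rewrite !mulr_ge0 ?(ltW s0) ?(ltW M0).
    have v2 : U w / (m%:R - p%:R) <= A / (1 - k1) * s ^+ 2.
      rewrite ler_pdivrMr// (le_trans Uw)//.
      have -> : m%:R * (s ^+ 2 * A) = A / (1 - k1) * s ^+ 2 * ((1 - k1) * m%:R).
        by field; rewrite gt_eqF.
      by rewrite ler_wpM2l// mulr_ge0 ?sqr_ge0.
    by rewrite /W mulrDl lerD.
  have Sb : Num.sqrt (p%:R / (m%:R - p%:R) * ((y w - dotv (x w) (b' w)) ^+ 2 + U w / (m%:R - p%:R)))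
     <= Num.sqrt (q1 * W) * s.
    have -> : Num.sqrt (q1 * W) * s = Num.sqrt (q1 * W * s ^+ 2).
      have qW : 0 <= q1 * W by exact: mulr_ge0.
      by rewrite (sqrtrM _ qW) sqrtr_sqr gtr0_norm.
    rewrite ler_sqrt; last by apply: mulr_ge0; [exact: mulr_ge0|exact: sqr_ge0].
    rewrite -[leRHS]mulrA; apply: ler_pM => //; first by rewrite divr_ge0// ltW.
    by rewrite addr_ge0 ?sqr_ge0// divr_ge0// ltW.
  have dLs := ler_wpM2r (ltW s0) dL.
  have BL : B0 * M <= L * s * M by rewrite ler_wpM2r ?(ltW M0)// ltW.
  lra.
rewrite EFinD; apply: (le_trans (measureU2 _ (m_bad_U A) m5)); apply: leeD; first exact: p_bad_U.
rewrite EFinD; apply: (le_trans (measureU2 _ m1 m4)); apply: leeD; first exact: p_bad_F.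
by rewrite EFinD; apply: (le_trans (measureU2 _ m2 m3)); apply: leeD; [exact: p_bad_x|exact: p_bad_y].
Qed.

End sample_bounds.

(** * Limits, and the choice of the levels *)

Section limits.
Context {R : realType}.

Lemma cvge0_le (I : Type) (F : set_system I) {FF : Filter F} (f : I -> \bar R) :
  (forall x, 0 <= f x)%E ->
  (forall eps : R, 0 < eps -> \forall x \near F, (f x <= eps%:E)%E) ->
  f @ F --> 0%E.
Proof.
move=> f0 fe; apply/fine_cvgP; split.
  have := fe 1 ltr01; apply: filterS => x fx.
  by rewrite ge0_fin_numE// (le_lt_trans fx)// ltry.
apply/cvgr0Pnorm_le => eps eps0; have := fe _ eps0; apply: filterS => x fx /=.
have fin : f x \is a fin_num by rewrite ge0_fin_numE// (le_lt_trans fx)// ltry.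
by rewrite ger0_norm ?fine_ge0// -lee_fin fineK.
Qed.

Lemma limn_esup_le (u : nat -> \bar R) (a : \bar R) n1 :
  (forall n, (n1 <= n)%N -> (u n <= a)%E) -> (limn_esup u <= a)%E.
Proof.
move=> ua; apply: ge_ereal_inf; exists (ereal_sup (u @` [set n | (n1 <= n)%N])).
  by exists [set n | (n1 <= n)%N] => //; exists n1.
by apply: ge_ereal_sup => _ [n /= n1n <-]; exact: ua.
Qed.

Lemma limn_esup_lty (u : nat -> \bar R) : (limn_esup u < +oo)%E ->
  exists K n1, forall n, (n1 <= n)%N -> (u n <= K%:E)%E.
Proof.
move=> /ereal_inf_lt[_ [V [n1 _ n1V] <-]] sup_lt.
have [K sK] : exists K : R, (ereal_sup (u @` V) <= K%:E)%E.
  move: sup_lt; case: (ereal_sup _) => [r _|//|_]; first by exists r.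
  by exists 0; rewrite leNye.
exists K, n1 => n n1n; apply: le_trans sK; apply: ereal_sup_ubound.
by exists n => //; exact: n1V.
Qed.

Lemma ratio_bound (p : nat -> nat) (kappa : R) : 0 <= kappa < 1 ->
  ((p n)%:R / n%:R : R) @[n --> \oo] --> kappa ->
  exists (k1 : R) n1, [/\ 0 <= k1, k1 < 1 &
    forall n, (n1 <= n)%N -> (p n)%:R <= k1 * n.-1%:R].
Proof.
(* [1 - kappa] is cut in three: one part for the convergence of the ratio, one for passing from [n]
   to [n.-1], and one that keeps the bound below one. *)
move=> /andP[k0 k1] h; pose dl := (1 - kappa) / 3.
have dl0 : 0 < dl by rewrite /dl; lra.
have [N1 _ hN1] : \forall n \near \oo, ((p n)%:R / n%:R : R) <= kappa + dl.
  have /cvgrPdist_le/(_ _ dl0) := h; apply: filterS => n.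
  rewrite distrC => /(le_trans (ler_norm _)); lra.
pose N2 := Num.bound (dl^-1).
exists (kappa + 2 * dl), (maxn N1 N2.+1); split; [by lra|by rewrite /dl; lra|].
move=> n; rewrite geq_max => /andP[n1 n2].
have := hN1 n n1; case: n n1 n2 => // n n1 n2 /=.
rewrite ler_pdivrMr ?ltr0n// -natr1 => /le_trans; apply.
have q : 1 <= dl * n%:R.
  have i0 : 0 <= dl^-1 by rewrite invr_ge0 ltW.
  rewrite mulrC -ler_pdivrMr// mul1r (le_trans (ltW (archi_boundP i0)))//.
  by rewrite ler_nat.
have : kappa + dl <= 1 by rewrite /dl; lra.
lra.
Qed.

End limits.

Ltac nonneg := by do ![done | exact: sqr_ge0 | exact: sqrtr_ge0 | exact: ltW
  | apply: divr_ge0 | apply: mulr_ge0 | apply: addr_ge0].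

Theorem theorem3p1 (R : realType) (C0 c0 : R) (Ll Lw : probability R R)
  (n0 : nat) (p : nat -> nat)
  (P : forall n, probability ((p n).-tuple R * R)%type R)
  (th : forall n, params R (p n))
  (beta : forall n, 'cV[R]_(p n))
  (c : nat -> R) (kappa : R)
  (d : nat -> measure_display) (Omega : forall n, measurableType (d n))
  (PP : forall n, probability (Omega n) R)
  (z : forall n, nat -> Omega n -> (p n).-tuple R * R) :
  0 < C0 -> 0 < c0 -> admissible_Lw Lw -> admissible_Ll c0 Ll ->
  (forall n, (n0 <= n)%N -> (0 < p n)%N /\ (p n + 1 < n)%N) ->
  (forall n, (n0 <= n)%N -> in_model Ll Lw C0 (P n) (th n)) ->
  (forall n, (n0 <= n)%N -> has_lebesgue_density (v_law (th n))) ->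
  (forall n, (n0 <= n)%N -> iid_data (PP n) n (z n) (P n)) ->
  (forall n, (n0 <= n)%N -> is_risk_minimizer (P n) (beta n)) ->
  0 <= kappa < 1 ->
  ((p n)%:R / n%:R : R) @[n --> \oo] --> kappa ->
  (forall n, (n0 <= n)%N -> 0 <= c n <= 1) ->
  (limn_esup (fun n => misspecification (P n) (th n) (beta n)) < +oo)%E ->
  limn_esup (fun n => PP n [set w |
    M < scaled_dist (th n) (js_full n (c n) (fun i => z n i w)) (beta n)])
    @[M --> +oo] --> 0%E
  /\
  (0 < kappa -> forall eps : R, 0 < eps ->
   PP n [set w |
     eps < scaled_dist (th n) (js_full n (c n) (fun i => z n i w))
                              (js_loo n (c n) (fun i => z n i w))]
     @[n --> \oo] --> 0%E).
Proof.
move=> _ c00 adw adl _ mod _ iid _ k01 pk cn mis.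
have [k1 [n1 [k10 k11 pk1]]] := ratio_bound k01 pk.
have [Km [n2 misK]] := limn_esup_lty mis.
have [del del0 eig] := smallest_eigenvalue_lower_bound C0 c00 adw adl k10 k11.
(* [Km] comes from an upper limit and carries no sign; the maximum makes [Ku] positive. *)
pose Kp := Num.max Km 0.
have Kp0 : 0 <= Kp by rewrite le_max lexx orbT.
pose Ku := 2 * Kp + 2.
have Ku0 : 0 < Ku by rewrite /Ku; lra.
have res n : (n0 <= n)%N -> (n2 <= n)%N -> (\int[P n]_z
    (((z.2 - dotv (vec z.1) (beta n)) / sigma (th n)) ^+ 2)%:E <= Ku%:E)%E.
  move=> n0n n2n; apply: (residual_second_moment (mod n n0n)).
  by rewrite (le_trans (misK n n2n))// lee_fin le_max lexx.
split.
- apply: cvge0_le.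
    by move=> M; apply: limf_esup_ge0 => [[N _ /(_ N (leqnn N))]|n] //; exact: measure_ge0.
  move=> eps eps0; have e20 : 0 < eps / 2 by rewrite divr_gt0.
  have [n3 good] := eig _ e20.
  (* This makes [2 * Ku / A] equal to [eps / 2]. [A] and the threshold on [n] are fixed before [M],
     so one threshold serves all large [M]. *)
  pose A := 4 * Ku / eps; have A0 : 0 < A by rewrite divr_gt0// mulr_gt0.
  near=> M.
  apply: (@limn_esup_le _ _ _ (maxn (maxn n0 n1) (maxn n2 (maxn n3 2)))) => n.
  rewrite !geq_max => /andP[/andP[n0n n1n] /andP[n2n /andP[n3n n_2]]].
  have [g [mg gu gc gp]] := good n (p n) (P n) (th n) (d n) (Omega n) (PP n) (z n) n3n (pk1 n n1n) (mod n n0n) (iid n n0n).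
  have resn := res n n0n n2n; have iidn := iid n n0n; have pkn := pk1 n n1n.
  case: n n_2 n0n {n1n n2n n3n good} g mg gu gc gp resn iidn pkn => [//|m] m1 n0n g mg gu gc gp resn iidn pkn.
  have m0 : (0 < m)%N by [].
  have -> : eps = eps / 2 + 2 * Ku / A by rewrite /A; field; rewrite !gt_eqF.
  apply: (risk_bound (mod _ n0n) iidn m0 k10 k11 pkn (cn _ n0n) (ltW Ku0) resn del0 mg gc gp A0).
  by near: M; apply: nbhs_pinfty_ge; exact: num_real.
- move=> _ eps eps0; apply: cvge0_le => [n|e e0]; first exact: measure_ge0.
  (* Five exceptional events share [e]: the design, [U], the prediction [F], and the size and
     residual of the first observation. *)
  have e50 : 0 < e / 5 by rewrite divr_gt0.
  have [n3 good] := eig _ e50.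
  pose A := 10 * Ku / e; have A0 : 0 < A by rewrite divr_gt0// mulr_gt0.
  pose M2 := 10 * Ku / (del * e) + (5 * Ku / e + 5 / e).
  have M20 : 0 < M2 by rewrite !addr_gt0// divr_gt0// ?mulr_gt0.
  pose M := Num.sqrt M2; have M0 : 0 < M by rewrite sqrtr_gt0.
  have M2E : M ^+ 2 = M2 by rewrite sqr_sqrtr// ltW.
  pose q1 := k1 / (1 - k1).
  have q10 : 0 <= q1 by rewrite divr_ge0// subr_ge0 ltW.
  (* A sum in place of a maximum: each of the first two terms meets one condition on [L], and the
     last makes it positive. *)
  pose L := Num.sqrt (4 * A / del) + (24 * q1 * A / (del * eps) + 1).
  have sL : 0 <= Num.sqrt (4 * A / del) by exact: sqrtr_ge0.
  have qL : 0 <= 24 * q1 * A / (del * eps) by nonneg.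
  have L0 : 0 < L by rewrite /L; lra.
  have LA : 4 * A / del <= L ^+ 2.
    have a0 : 0 <= 4 * A / del by nonneg.
    rewrite -[leLHS]sqr_sqrtr// ler_sqr ?nnegrE ?(ltW L0)// /L; lra.
  have Leps : 12 * q1 * A / (del * L) <= eps / 2.
    rewrite ler_pdivrMr ?mulr_gt0//.
    have : 24 * q1 * A / (del * eps) <= L by rewrite /L; lra.
    rewrite ler_pdivrMr ?mulr_gt0//; lra.
  pose W := 14 * M + 3 * M * L + Num.sqrt (q1 * (4 * M ^+ 2 + A / (1 - k1))).
  (* [W] does not depend on [n] while [d1 = del * m] grows; [D] is the value of [m] from which
     [2 * W <= eps * Num.sqrt d1]. The factor two covers the condition with [eps / 2]. *)
  pose D := (2 * W / eps) ^+ 2 / del.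
  have W0 : 0 <= W.
    by nonneg.
  have D0 : 0 <= D by nonneg.
  exists (maxn (maxn n0 n1) (maxn n2 (maxn n3 (Num.bound D).+2))) => // n /=.
  rewrite !geq_max => /andP[/andP[n0n n1n] /andP[n2n /andP[n3n n_2]]].
  have [g [mg gu gc gp]] := good n (p n) (P n) (th n) (d n) (Omega n) (PP n) (z n) n3n (pk1 n n1n) (mod n n0n) (iid n n0n).
  have resn := res n n0n n2n; have iidn := iid n n0n; have pkn := pk1 n n1n.
  case: n n_2 n0n {n1n n2n n3n good} g mg gu gc gp resn iidn pkn => [//|m] m1 n0n g mg gu gc gp resn iidn pkn.
  have m0 : (0 < m)%N by case: m m1 {n0n g mg gu gc gp resn iidn pkn}.
  have Dm : D <= m%:R.
    by rewrite (le_trans (ltW (archi_boundP D0)))// ler_nat ltnW.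
  have dL : 2 * W <= eps * Num.sqrt (del * m%:R).
    rewrite -ler_pdivrMl// mulrC -ler_sqr ?nnegrE ?sqrtr_ge0 ?divr_ge0 ?mulr_ge0 ?(ltW eps0)//.
    rewrite sqr_sqrtr; last by rewrite mulr_ge0// ltW.
    by rewrite [del * _]mulrC -ler_pdivrMr.
  have := @stability_bound _ m (p m.+1) _ _ Ll Lw C0 c0 (P m.+1) (th m.+1) (beta m.+1)
    (PP m.+1) (z m.+1) (c m.+1) k1 Ku del (e / 5) g adw adl (mod _ n0n) iidn m0 k10 k11 pkn
    (cn _ n0n) (ltW Ku0) resn del0 mg gu gc gp A M L eps A0 M0 L0 eps0 LA Leps.
  have MW : 14 * M <= W by rewrite /W -addrA lerDl; nonneg.
  have sW : W <= 2 * W by lra.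
  move=> /(_ _ _)/le_trans; apply; [lra|exact: le_trans dL|].
  rewrite lee_fin M2E.
  have b1 : 2 * Ku / A = e / 5 by rewrite /A; field; rewrite !gt_eqF.
  have b2 : 2 * Ku / del / M2 <= e / 5.
    rewrite ler_pdivrMr// /M2.
    have -> : 2 * Ku / del = e / 5 * (10 * Ku / (del * e)) by field; rewrite !gt_eqF.
    rewrite ler_pM2l// lerDl; nonneg.
  have b3 : 1 / M2 <= e / 5.
    rewrite ler_pdivrMr// /M2.
    have {1}-> : 1 = e / 5 * (5 / e) by field; rewrite !gt_eqF.
    rewrite ler_pM2l// addrA lerDr; nonneg.
  have b4 : Ku / M2 <= e / 5.
    rewrite ler_pdivrMr// /M2.
    have {1}-> : Ku = e / 5 * (5 * Ku / e) by field; rewrite !gt_eqF.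
    rewrite ler_pM2l// addrCA lerDl; nonneg.
  lra.
Unshelve. all: by end_near.
Qed.
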